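(* Let $F\subset\mathbb{R}^d$ be the self-similar set of a system $\{\Phi_1,\dots,\Phi_N\}$, $N\ge2$, of contractive similarity mappings of $\mathbb{R}^d$ with scaling ratios $r_1,\dots,r_N\in(0,1)$ satisfying the open set condition, and suppose that $F$ has Minkowski dimension $D\in(d-1,d)$. Assume there exists a feasible open set $O$ for $F$ such that $$\partial O\subset F,$$ and such that the associated self-similar tiling $\mathcal{T}=\mathcal{T}(O)$ has a single generator $G$, which is monophase (with inradius $g$ and coefficients $\kappa_k(G)$). Assume moreover that for $K:=\overline{O}$ the outer $D$-dimensional Minkowski content $\mathcal{M}^{\mathrm{out}}_D(K)$ exists and satisfies $0\le\mathcal{M}^{\mathrm{out}}_D(K)<\infty$. Then $F$ is Minkowski measurable if and only if $F$ is nonlattice. In this (nonlattice) case, the Minkowski content of $F$ is given by $$\mathcal{M}_D(F)=\mathcal{M}_D(\mathcal{T})+\mathcal{M}^{\mathrm{out}}_D(K),$$ where $\mathcal{M}_D(\mathcal{T})$ is the Minkowski content of $\mathcal{T}$, and both $\mathcal{M}_D(F)$ and $\mathcal{M}_D(\mathcal{T})$ lie in $(0,\infty)$. In the lattice case, with $r_n=r^{k_n}$ for $n=1,\dots,N$, the ($D$-dimensional) Minkowski content of $F$ does not exist, but the average Minkowski content $\overline{\mathcal{M}}_D(F)$ exists and is given by $$\overline{\mathcal{M}}_D(F)=\overline{\mathcal{M}}_D(\mathcal{T})+\mathcal{M}^{\mathrm{out}}_D(K),$$ where $\overline{\mathcal{M}}_D(\mathcal{T})$ is the average Minkowski content of $\mathcal{T}$,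 namely $$\overline{\mathcal{M}}_D(\mathcal{T})=\frac{\Gamma_D(G)}{(d-D)\sum_{n=1}^N r^{k_nD}\,k_n\log r^{-1}},\qquad \Gamma_D(G):=\sum_{k=0}^{d-1}\frac{g^{D-k}}{D-k}(d-k)\kappa_k(G),$$ and $0<\overline{\mathcal{M}}_D(F)<\infty$.
   Context: **Self-similar sets and the open set condition.** For $A\subset\mathbb{R}^d$ write $\Phi(A):=\bigcup_{n=1}^N\Phi_n(A)$. The self-similar set (attractor) $F$ is the unique nonempty compact set with $F=\Phi(F)$. The open set condition (OSC) holds if there is a nonempty open set $O\subset\mathbb{R}^d$ with $\Phi_n(O)\subset O$ for all $n$ and $\Phi_n(O)\cap\Phi_m(O)=\emptyset$ for $n\ne m$; any such $O$ is called a feasible open set for $F$. Under OSC, the Minkowski dimension $D$ of $F$ is the unique real solution of $\sum_{n=1}^N r_n^s=1$. **Self-similar tiling.** Let $\mathcal{W}:=\bigcup_{k\ge0}\{1,\dots,N\}^k$ be the set of finite words. For $w=w_1\cdots w_n$ put $\Phi_w:=\Phi_{w_1}\circ\cdots\circ\Phi_{w_n}$, with $\Phi_w=\mathrm{Id}$ for the empty word. For a feasible open set $O$, the generators are the connected components $G_q$ ($q\in Q$, $Q$ finite) of the open set $O\setminus\Phi(\overline{O})$, and the self-similar tiling is $\mathcal{T}(O):=\{\Phi_w(G_q): w\in\mathcal{W}, q\in Q\}$. A single generator $G$ means that $O\setminus\Phi(\overline{O})=G$ is connected (and nonempty). Let $T:=\bigcup_{R\in\mathcal{T}}R$ be the union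 of the tiles. **Monophase.** For a bounded open set $G\subset\mathbb{R}^d$, let $g>0$ be its inradius (the maximal radius of a ball contained in $G$) and $V(G,\varepsilon):=\lambda_d(\{x\in G: d(x,G^c)\le\varepsilon\})$, where $\lambda_d$ is Lebesgue measure and $d(x,\cdot)$ is Euclidean distance to a set. $G$ is monophase if there are real constants $\kappa_0(G),\dots,\kappa_d(G)$ with $V(G,\varepsilon)=\sum_{k=0}^{d}\kappa_k(G)\,\varepsilon^{d-k}$ for all $0<\varepsilon\le g$. These constants are then unique, and $\kappa_d(G)=0$. **Lattice/nonlattice.** $F$ (more precisely, its system $\{\Phi_n\}$) is lattice if there are $r\in(0,1)$ and positive integers $k_1,\dots,k_N$ with $r_n=r^{k_n}$ for all $n$; otherwise it is nonlattice. **Minkowski contents of sets.** For bounded $A\subset\mathbb{R}^d$ and $\varepsilon\ge0$ let $A_\varepsilon:=\{x\in\mathbb{R}^d: d(x,A)\le\varepsilon\}$. For $0\le\alpha\le d$: - $\mathcal{M}_\alpha(A):=\lim_{\varepsilon\to0^+}\varepsilon^{\alpha-d}\lambda_d(A_\varepsilon)$, whenever the limit exists in $[0,\infty]$. $A$ is Minkowski measurable (of dimension $\alpha$) if $\mathcal{M}_\alpha(A)$ exists and lies in $(0,\infty)$; ''Minkowski measurable'' without further specification means of some dimension $\alpha\in[0,d]$. - Outer Minkowski content: $\mathcal{M}^{\mathrm{out}}_\alpha(A):=\lim_{\varepsilon\to0^+}\varepsilon^{\alpha-d}\big(\lambda_d(A_\varepsilon)-\lambda_d(A)\big)$, when the limit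 exists. - Average Minkowski content: $\overline{\mathcal{M}}_\alpha(A):=\lim_{b\to\infty}\frac1{\log b}\int_{1/b}^1\varepsilon^{\alpha-d}\lambda_d(A_\varepsilon)\,\frac{d\varepsilon}{\varepsilon}$, when the limit exists in $[0,\infty]$. **Minkowski contents of tilings.** Let $V(T,\varepsilon):=\lambda_d(\{x\in T: d(x,T^c)\le\varepsilon\})$. Then $\mathcal{M}_\alpha(\mathcal{T}):=\lim_{\varepsilon\to0^+}\varepsilon^{\alpha-d}V(T,\varepsilon)$ and $\overline{\mathcal{M}}_\alpha(\mathcal{T}):=\lim_{b\to\infty}\frac1{\log b}\int_{1/b}^1\varepsilon^{\alpha-d}V(T,\varepsilon)\,\frac{d\varepsilon}{\varepsilon}$, whenever the respective limits exist in $[0,\infty]$. *)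

(* Defs.v *)
From HB Require Import structures.
From mathcomp Require Import all_boot all_order all_algebra.
From mathcomp Require Import all_classical all_reals all_analysis.
Set Implicit Arguments.
Unset Strict Implicit.
Unset Printing Implicit Defensive.
Import Order.TTheory GRing.Theory Num.Theory.
Import numFieldNormedType.Exports.
Local Open Scope classical_set_scope.
Local Open Scope ring_scope.

(* The space R^d is 'rV[R]_d.  Its library topology (product topology) is the
   Euclidean one, but its library norm is the sup norm, hence the explicit
   Euclidean norm below. *)

Section Euclidean.
Variables (R : realType) (d : nat).
Implicit Types (x y a b : 'rV[R]_d) (A G : set 'rV[R]_d).

Definition enorm x : R := Num.sqrt (\sum_(i < d) x 0 i ^+ 2).

Definition eball x (rho : R) : set 'rV[R]_d := [set y | enorm (y - x) < rho].

Definition ebounded A : Prop := exists M : R, forall x, A x -> enorm x <= M.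

(* Extended-real valued, so that the distance to the empty set is +oo. *)
Definition dist_set x A : \bar R :=
  ereal_inf [set (enorm (x - y))%:E | y in A].

Definition parallel_set A (eps : R) : set 'rV[R]_d :=
  [set x | (dist_set x A <= eps%:E)%E].

Definition boundary A : set 'rV[R]_d := closure A `\` A°.

Definition box a b : set 'rV[R]_d :=
  [set x | forall i, a 0 i < x 0 i <= b 0 i].

Definition box_volume a b : R := \prod_(i < d) Num.max 0 (b 0 i - a 0 i).

(* d-dimensional Lebesgue (outer) measure, for 0 < d; all the sets it is
   applied to below are Borel sets. *)
Definition lebesgue_d A : \bar R :=
  ereal_inf [set \sum_(0 <= j <oo) (box_volume (s j).1 (s j).2)%:E |
    s in [set s : nat -> 'rV[R]_d * 'rV[R]_d |
           A `<=` \bigcup_j box (s j).1 (s j).2]]%E.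

(* V(A, eps) *)
Definition inner_tube_volume A (eps : R) : \bar R :=
  lebesgue_d [set x | A x /\ (dist_set x (~` A) <= eps%:E)%E].

Definition inradius G : R :=
  sup [set rho | 0 < rho /\ exists x, eball x rho `<=` G].

Definition monophase G (kappa : 'I_d.+1 -> R) : Prop :=
  [/\ open G, ebounded G &
   forall eps : R, 0 < eps <= inradius G ->
     inner_tube_volume G eps = (\sum_(k < d.+1) kappa k * eps ^+ (d - k))%:E].

Definition Gamma_coef (D : R) G (kappa : 'I_d.+1 -> R) : R :=
  \sum_(k < d.+1 | (k < d)%N)
     inradius G `^ (D - k%:R) / (D - k%:R) * (d%:R - k%:R) * kappa k.

End Euclidean.

Section Contents.
Variables (R : realType) (d : nat).
Implicit Types (alpha : R) (V : R -> \bar R) (m : \bar R) (A T : set 'rV[R]_d).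

Definition has_content alpha V m : Prop :=
  (fun eps : R => (eps `^ (alpha - d%:R))%:E * V eps)%E @ 0^'+ --> m.

Definition has_average_content alpha V m : Prop :=
  (fun b : R => ((ln b)^-1)%:E *
     \int[lebesgue_measure]_(eps in `[b^-1%R, 1%R])
       ((eps `^ (alpha - d%:R) / eps)%:E * V eps))%E
    @ (+oo%R : set_system R) --> m.

Definition has_minkowski_content alpha A m : Prop :=
  has_content alpha (fun eps => lebesgue_d (parallel_set A eps)) m.

Definition has_outer_minkowski_content alpha A m : Prop :=
  has_content alpha
    (fun eps => lebesgue_d (parallel_set A eps) - lebesgue_d A)%E m.

Definition has_average_minkowski_content alpha A m : Prop :=
  has_average_content alpha (fun eps => lebesgue_d (parallel_set A eps)) m.

(* For a tiling, T stands for the union of its tiles. *)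
Definition has_tiling_content alpha T m : Prop :=
  has_content alpha (inner_tube_volume T) m.

Definition has_average_tiling_content alpha T m : Prop :=
  has_average_content alpha (inner_tube_volume T) m.

Definition minkowski_measurable A : Prop :=
  exists alpha m : R, [/\ 0 <= alpha <= d%:R, 0 < m &
    has_minkowski_content alpha A m%:E].

Definition has_minkowski_dimension A (D : R) : Prop :=
  (fun eps : R => d%:R - ln (fine (lebesgue_d (parallel_set A eps))) / ln eps)
    @ 0^'+ --> D.

End Contents.

Section SelfSimilar.
Variables (R : realType) (d N : nat).
Variable Phi : 'I_N -> 'rV[R]_d -> 'rV[R]_d.
Implicit Types (r : 'I_N -> R) (A F O : set 'rV[R]_d).

Definition contractive_similarities r : Prop :=
  forall n, 0 < r n < 1 /\
    forall x y, enorm (Phi n x - Phi n y) = r n * enorm (x - y).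

Definition ifs_image A : set 'rV[R]_d := \bigcup_n (Phi n @` A).

Definition attractor F : Prop := [/\ F !=set0, compact F & F = ifs_image F].

Definition feasible O : Prop :=
  [/\ open O, O !=set0, forall n, Phi n @` O `<=` O &
   forall n m, n != m -> (Phi n @` O) `&` (Phi m @` O) = set0].

Definition open_set_condition : Prop := exists O, feasible O.

(* word_map [:: w1; ...; wk] = Phi w1 \o ... \o Phi wk *)
Definition word_map (w : seq 'I_N) : 'rV[R]_d -> 'rV[R]_d :=
  fun x => foldr Phi x w.

Definition generators O : set (set 'rV[R]_d) :=
  let U := O `\` ifs_image (closure O) in
  [set connected_component U x | x in U].

Definition tiling O : set (set 'rV[R]_d) :=
  [set S | exists w G, generators O G /\ S = word_map w @` G].

Definition tiling_union O : set 'rV[R]_d := \bigcup_(S in tiling O) S.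

Definition lattice_with r (rho : R) (k : 'I_N -> nat) : Prop :=
  0 < rho < 1 /\ forall n, (0 < k n)%N /\ r n = rho ^+ k n.

Definition lattice r : Prop := exists rho k, lattice_with r rho k.

End SelfSimilar.

(* Main.v *)
From HB Require Import structures.
From mathcomp Require Import all_boot all_order all_algebra.
From mathcomp Require Import all_classical all_reals all_analysis.
From mathcomp Require Import measurable_realfun.
From mathcomp Require Import ring lra.
Require Import Defs.
Set Implicit Arguments.
Unset Strict Implicit.
Unset Printing Implicit Defensive.
Import Order.TTheory GRing.Theory Num.Theory.
Import numFieldNormedType.Exports.
Local Open Scope classical_set_scope.
Local Open Scope ring_scope.

(** The volume of the parallel set [F_e] of the attractor splits at the feasible
    open set [O]: outside [O] it is the outer parallel volume of [K = closure O],
    since the boundary of [O] lies in [F]; inside it is the tube volume [V e] of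
    the tiling, since the tiles fill [O] up to the null set [F]
    ([parallel_volumeE]). The first part has a content by assumption, and the
    theorem is about the second one.

    Writing [O] as the disjoint union of the generator [G], of the images
    [Phi i @` O] and of part of [F], one obtains the renewal equation
    [V e = \sum_i r i ^+ d * V (e / r i) + v e], with [v] the tube volume of [G]
    ([tube_volume_renewal]). After weighting by [e `^ (D - d)] its coefficients
    become [p i = r i `^ D]. They sum to 1: the renewal relations, by a maximum
    principle ([renewal_maximum_principle]), bound the volumes of tubes above and
    below by multiples of [e `^ (d - s)], [s] being the solution of the Moran
    equation, whence [D = s]. Write [phi] and [zeta] for the weighted functions,
    so that [phi e = \sum_i p i * phi (e / r i) + zeta e].

    Integrate against ds/s over [e, +oo). The integral of [zeta] tends to the
    constant [Z = Gamma_D(G) / (d - D)], by integration of the monophase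
    polynomial ([zeta_tail_cvg]); it is positive. The integral of [phi] is
    therefore asymptotic to [Z / m] times [- ln e], with
    [m = \sum_i p i * - ln (r i)] ([tail_integral_asymptotics]): this is the
    average content of the tiling.

    If the numbers [- ln (r i)] generate a dense group, then [phi] itself
    converges ([renewal_nonlattice_limit]). Choose a sequence along which [phi]
    tends to its limit superior [L]; as [phi] is asymptotically an average of its
    translates, all translates by sums of [- ln (r i)] tend to [L] too. Such sums
    are eventually dense, and [V] is monotone, so that [phi] is close to [L] on
    whole periods, over which the integral of [phi] is known; hence [L = Z / m].
    The same applies to the limit inferior.

    In the lattice case the renewal equation telescopes to a one-step recursion
    over the powers of [rho]. A limit of [phi] would then force a polynomial with
    nonzero constant term to coincide on an interval with a multiple of the power
    [e `^ (d - D)], whose exponent is strictly between 0 and 1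
    ([lattice_no_limit]).

    All this needs that Lebesgue measure scales under similarities. For the outer
    measure defined by covers with boxes this is proved directly: a linear map
    expands all sets at most as much as the unit cube, and an orthogonal map
    cannot expand the cube, since it preserves the ball
    ([lebesgue_d_similarity]). *)

(** * Euclidean geometry *)
Section EuclideanGeometry.
Context {R : realType} {d : nat}.
Implicit Types (x y z a b : 'rV[R]_d) (A B : set 'rV[R]_d).

Definition dotp x y : R := \sum_(i < d) x 0 i * y 0 i.

Lemma dotpC x y : dotp x y = dotp y x.
Proof. by apply: eq_bigr => i _; rewrite mulrC. Qed.

Lemma dotpDl x y z : dotp (x + y) z = dotp x z + dotp y z.
Proof. by rewrite -big_split; apply: eq_bigr => i _; rewrite mxE mulrDl. Qed.

Lemma dotpZl (k : R) x z : dotp (k *: x) z = k * dotp x z.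
Proof. by rewrite mulr_sumr; apply: eq_bigr => i _; rewrite mxE mulrA. Qed.

Lemma dotpNl x z : dotp (- x) z = - dotp x z.
Proof. by rewrite -scaleN1r dotpZl mulN1r. Qed.

Lemma dotpDr x y z : dotp z (x + y) = dotp z x + dotp z y.
Proof. by rewrite dotpC dotpDl !(dotpC z). Qed.

Lemma dotpZr (k : R) x z : dotp z (k *: x) = k * dotp z x.
Proof. by rewrite dotpC dotpZl dotpC. Qed.

Lemma dotpNr x z : dotp z (- x) = - dotp z x.
Proof. by rewrite dotpC dotpNl dotpC. Qed.

Lemma dotp_ge0 x : 0 <= dotp x x.
Proof. by apply: sumr_ge0 => i _; rewrite -expr2 sqr_ge0. Qed.

Lemma enorm_sqr x : enorm x ^+ 2 = dotp x x.
Proof.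
rewrite sqr_sqrtr; last by apply: sumr_ge0 => i _; rewrite sqr_ge0.
by apply: eq_bigr => i _; rewrite expr2.
Qed.

Lemma enorm_ge0 x : 0 <= enorm x.
Proof. exact: sqrtr_ge0. Qed.

Lemma enorm_eq0 x : enorm x = 0 -> x = 0.
Proof.
move=> x0; apply/rowP => i; rewrite mxE.
have /eqP := enorm_sqr x; rewrite x0 expr0n /= eq_sym psumr_eq0 => [/allP|j _].
  move=> /(_ i (mem_index_enum _)) /=.
  by rewrite mulf_eq0 orbb => /eqP.
by rewrite -expr2 sqr_ge0.
Qed.

Lemma enorm0 : enorm (0 : 'rV[R]_d) = 0.
Proof. by rewrite /enorm big1 ?sqrtr0// => i _; rewrite mxE expr0n. Qed.

Lemma enormZ (k : R) x : enorm (k *: x) = `|k| * enorm x.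
Proof.
apply/eqP; rewrite -(@eqrXn2 _ 2) ?mulr_ge0 ?enorm_ge0//.
by rewrite enorm_sqr dotpZl dotpZr exprMn enorm_sqr mulrA real_normK ?num_real.
Qed.

Lemma enormN x : enorm (- x) = enorm x.
Proof. by rewrite -scaleN1r enormZ normrN1 mul1r. Qed.

Lemma enormB x y : enorm (x - y) = enorm (y - x).
Proof. by rewrite -enormN opprB. Qed.

Lemma cauchy_schwarz x y : dotp x y <= enorm x * enorm y.
Proof.
have [x0|x0] := eqVneq (enorm x) 0.
  by rewrite (enorm_eq0 x0) -(scale0r (0 : 'rV_d)) dotpZl mul0r enormZ normr0 !mul0r.
have [y0|y0] := eqVneq (enorm y) 0.
  by rewrite (enorm_eq0 y0) -(scale0r (0 : 'rV_d)) dotpZr mul0r enormZ normr0 !(mul0r,mulr0).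
have := dotp_ge0 (enorm y *: x - enorm x *: y).
rewrite !(dotpDl, dotpDr, dotpNl, dotpNr, dotpZl, dotpZr) -!enorm_sqr (dotpC y x).
have : 0 < enorm x * enorm y by rewrite mulr_gt0// lt_neqAle eq_sym ?x0 ?y0 enorm_ge0.
set u := enorm x; set v := enorm y; set w := dotp x y => uv.
rewrite (_ : _ + _ = (u * v) * (2 * (u * v - w))); last by ring.
by rewrite pmulr_rge0// pmulr_rge0// subr_ge0.
Qed.

Lemma enormD x y : enorm (x + y) <= enorm x + enorm y.
Proof.
rewrite -(@ler_pXn2r _ 2) ?nnegrE ?addr_ge0 ?enorm_ge0//.
rewrite enorm_sqr !(dotpDl, dotpDr) sqrrD -!enorm_sqr (dotpC y x).
have := cauchy_schwarz x y; lra.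
Qed.

Lemma enorm_triangle z x y : enorm (x - y) <= enorm (x - z) + enorm (z - y).
Proof. by apply: le_trans (enormD _ _); rewrite addrA subrK. Qed.

Lemma ler_coord_enorm x i : `|x 0 i| <= enorm x.
Proof.
rewrite -(@ler_pXn2r _ 2) ?nnegrE ?enorm_ge0// enorm_sqr.
rewrite real_normK ?num_real// /dotp (bigD1 i)//= -expr2 lerDl.
by apply: sumr_ge0 => j _; rewrite -expr2 sqr_ge0.
Qed.

Lemma enorm_le_coord x (m : R) :
  0 <= m -> (forall i, `|x 0 i| <= m) -> enorm x <= d%:R * m.
Proof.
move=> m0 xm; rewrite -(@ler_pXn2r _ 2) ?nnegrE ?mulr_ge0 ?enorm_ge0//.
rewrite enorm_sqr exprMn; apply: (@le_trans _ _ (\sum_(i < d) m ^+ 2)).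
  apply: ler_sum => i _; rewrite -expr2 -real_normK ?num_real//.
  by rewrite ler_pXn2r ?nnegrE.
rewrite sumr_const card_ord -[m ^+ 2 *+ d]mulr_natl ler_wpM2r ?sqr_ge0//.
rewrite -natrX ler_nat; case: d => // n.
by rewrite expnS expn1 leq_pmulr.
Qed.

(** The library topology of row vectors is the Euclidean one: the sup norm and
    the Euclidean norm are equivalent. *)
Lemma openP_eball A :
  open A <-> forall x, A x -> exists2 e, 0 < e & eball x e `<=` A.
Proof.
rewrite openE; split => [oA x Ax|oA x Ax].
  have /nbhs_ballP[e /= e0 xeA] := oA _ Ax.
  exists e => // y yx; apply: xeA; split => // i j.
  rewrite ord1; have := ler_coord_enorm (y - x) j.
  rewrite !mxE distrC => /le_lt_trans; apply.
  exact: yx.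
have [e e0 eA] := oA _ Ax; apply/nbhs_ballP.
exists (e / d.+1%:R) => /=; first by rewrite divr_gt0.
move=> y [_ yx]; apply: eA; rewrite /eball /=.
have /enorm_le_coord : 0 <= e / d.+1%:R by rewrite divr_ge0 // ltW.
move=> /(_ (y - x)) /(_ _) /le_lt_trans; apply => [i|].
  by have := yx 0 i; rewrite /ball /= !mxE distrC => /ltW.
rewrite mulrCA -[ltRHS]mulr1 ltr_pM2l// ltr_pdivrMr// mul1r.
by rewrite ltr_nat.
Qed.

Lemma open_eball x e : open (eball x e).
Proof.
apply/openP_eball => y xy; exists (e - enorm (y - x)).
  by rewrite subr_gt0.
move=> z; rewrite /eball/= ltrBrDr; apply: le_lt_trans.
exact: enorm_triangle.
Qed.

Lemma closureP_eball A x :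
  closure A x <-> forall e, 0 < e -> exists2 y, A y & enorm (y - x) < e.
Proof.
split => [cx e e0|cx B].
  have [|y [Ay yx]] := cx (eball x e).
    by apply: open_nbhs_nbhs; split; [exact: open_eball|rewrite /eball/= subrr enorm0].
  by exists y.
rewrite nbhsE => -[U [oU Ux] UB].
have [e e0 eU] := (openP_eball U).1 oU _ Ux.
have [y Ay yx] := cx _ e0; exists y; split => //.
exact/UB/eU.
Qed.

(** The segment from a point of an open set to a point outside of it meets the
    boundary; otherwise the part of the segment in [A] would be clopen. *)
Lemma segment_meets_boundary A x y : open A -> A x -> ~ A y ->
  exists z, [/\ closure A z, ~ A z, enorm (x - z) <= enorm (x - y) &
                enorm (y - z) <= enorm (x - y)].
Proof.
move=> oA Ax nAy.
pose g (t : R) := x + t *: (y - x).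
have cg : continuous g.
  move=> t; apply: cvgD; first exact: cvg_cst.
  by apply: cvgZ; [exact: cvg_id|exact: cvg_cst].
apply: contrapT => noz.
have clA t : 0 <= t <= 1 -> closure A (g t) -> A (g t).
  move=> /andP[t0 t1] cAt; apply: contrapT => nAt; apply: noz; exists (g t).
  have xg : x - g t = - t *: (y - x) by rewrite /g opprD addrA subrr add0r scaleNr.
  have yg : y - g t = (1 - t) *: (y - x) by rewrite /g opprD addrA scalerBl scale1r.
  split => //.
    rewrite xg enormZ normrN ger0_norm// (enormB x y) -[leRHS]mul1r.
    by rewrite ler_wpM2r ?enorm_ge0.
  rewrite yg enormZ ger0_norm ?subr_ge0// (enormB x y) -[leRHS]mul1r.
  by rewrite ler_wpM2r ?enorm_ge0// gerBl.
have : [set` `[0, 1]%R] `&` g @^-1` A = [set` `[(0:R), 1]%R].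
  apply: (@segment_connected R 0 1).
  - exists 0; split; first by rewrite /= in_itv /= lexx ler01.
    by rewrite /= /g scale0r addr0.
  - by exists (g @^-1` A) => //; apply: open_comp => // t _; exact: cg.
  - exists (g @^-1` (closure A)); last first.
      apply/seteqP; split => t /= [t01 At]; split => //.
        exact: subset_closure.
      by apply: clA.
    apply: closed_comp => [t _|]; first exact: cg.
    exact: closed_closure.
move=> /seteqP[_ /(_ 1)] /=; rewrite in_itv /= lexx ler01 => /(_ isT)[_].
by rewrite /g scale1r addrC subrK => /nAy.
Qed.

End EuclideanGeometry.

(** * Similarities are affine *)
Section Similarity.
Context {R : realType} {d : nat}.
Implicit Types (x y : 'rV[R]_d) (f : 'rV[R]_d -> 'rV[R]_d).

Definition similarity f (k : R) :=
  0 < k /\ forall x y, enorm (f x - f y) = k * enorm (x - y).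

(** A similarity, normalised to fix the origin, preserves norms and hence inner
    products; expanding the square of [f x - \sum_i x_i f e_i] then shows that it
    is linear. *)
Lemma similarity_affine f k : similarity f k ->
  exists (M : 'M[R]_d), M *m M^T = 1%:M /\ forall x, f x = k *: (x *m M) + f 0.
Proof.
move=> [k0 fk].
pose h x := k^-1 *: (f x - f 0).
have hE x y : enorm (h x - h y) = enorm (x - y).
  rewrite /h -scalerBr opprB addrA subrK enormZ gtr0_norm ?invr_gt0// fk.
  by rewrite mulrA mulVf ?mul1r// gt_eqF.
have h0 : h 0 = 0 by rewrite /h subrr scaler0.
have hn x : dotp (h x) (h x) = dotp x x.
  by have := hE x 0; rewrite h0 !subr0 -!enorm_sqr => ->.
have hd x y : dotp (h x) (h y) = dotp x y.
  have : enorm (h x - h y) ^+ 2 = enorm (x - y) ^+ 2 by rewrite hE.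
  rewrite !enorm_sqr !(dotpDl, dotpDr, dotpNl, dotpNr) !hn.
  rewrite (dotpC (h y)) (dotpC y); lra.
pose e i : 'rV[R]_d := delta_mx 0 i.
have de x i : dotp x (e i) = x 0 i.
  rewrite /dotp (bigD1 i)//= big1 => [|j ji]; rewrite !mxE ?eqxx/= ?addr0 ?mulr1//.
  by rewrite (negbTE ji) mulr0.
pose M : 'M[R]_d := \matrix_(i, j) h (e i) 0 j.
exists M; split.
  apply/matrixP => i j; rewrite !mxE.
  transitivity (dotp (h (e i)) (h (e j))).
    by apply: eq_bigr => l _; rewrite !mxE.
  by rewrite hd de !mxE eqxx /= eq_sym.
have dM y x : dotp y (x *m M) = \sum_i x 0 i * dotp y (h (e i)).
  rewrite {1}/dotp; under eq_bigr => l _.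
    rewrite mxE mulr_sumr.
    under eq_bigr do rewrite mxE mulrCA.
    over.
  by rewrite exchange_big /=; apply: eq_bigr => i _; rewrite -mulr_sumr.
have hM x : h x = x *m M.
  have xM y : dotp (h y) (x *m M) = dotp y x.
    by rewrite dM; apply: eq_bigr => i _; rewrite hd de mulrC.
  apply/eqP; rewrite -subr_eq0; apply/eqP/enorm_eq0/eqP.
  rewrite -sqrf_eq0 enorm_sqr !(dotpDl, dotpDr, dotpNl, dotpNr) hn xM.
  rewrite (dotpC _ (h x)) xM dM.
  have -> : \sum_i x 0 i * dotp (x *m M) (h (e i)) = dotp x x.
    by apply: eq_bigr => i _; rewrite dotpC xM dotpC de.
  by apply/eqP; ring.
move=> x; rewrite -hM /h scalerA divff ?gt_eqF// scale1r subrK //.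
Qed.

End Similarity.

(** * Lebesgue outer measure *)
Section OuterMeasure.
Context {R : realType} {n : nat}.
Local Notation d := n.+1.
Implicit Types (a b x y : 'rV[R]_d) (A B U X : set 'rV[R]_d).
Local Notation lam := (@lebesgue_d R d).

Lemma box_volume_ge0 a b : 0 <= box_volume a b.
Proof. by apply: prodr_ge0 => i _; rewrite le_max lexx. Qed.

Lemma box_volume_degenerate a : box_volume a a = 0.
Proof. by rewrite /box_volume (bigD1 ord0)//= subrr maxxx mul0r. Qed.

(** Smallest volume of a box containing a set: Caratheodory's construction
    applied to it is [lebesgue_d], so that the latter inherits sigma-subadditivity. *)
Let hull (A : set (g_sigma_algebraType [set: set 'rV[R]_d])) : \bar R :=
  ereal_inf [set (box_volume ab.1 ab.2)%:E
            | ab in [set ab : 'rV[R]_d * 'rV[R]_d | A `<=` box ab.1 ab.2]].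

Let hull_ge0 A : (0 <= hull A)%E.
Proof.
by apply: le_ereal_inf_tmp => _ [ab _ <-]; rewrite lee_fin box_volume_ge0.
Qed.

Let hull0 : hull set0 = 0%E.
Proof.
apply/eqP; rewrite eq_le hull_ge0 andbT; apply: ereal_inf_lbound.
by exists (0, 0) => //=; rewrite box_volume_degenerate.
Qed.

Let lebesgue_dE : lam = mu_ext hull.
Proof.
apply/funext => A; apply/eqP; rewrite eq_le; apply/andP; split.
  apply: le_ereal_inf_tmp => _ [C [mC AC] <-].
  have [[k koo]|noo] := pselect (exists k, hull (C k) = +oo%E).
    by rewrite (nneseries_pinfty _ _ koo) ?leey.
  apply/lee_addgt0Pr => e e0.
  apply: le_trans (epsilon_trick _ _ (ltW e0)) => //.
  have [s Ps] : {s : nat -> 'rV[R]_d * 'rV[R]_d & forall k,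
      C k `<=` box (s k).1 (s k).2 /\ ((box_volume (s k).1 (s k).2)%:E
        <= hull (C k) + (e / (2 ^ k.+1)%:R)%:E)%E}.
    apply: (@choice _ _ (fun k ab => C k `<=` box ab.1 ab.2 /\
      ((box_volume ab.1 ab.2)%:E <= hull (C k) + (e / (2 ^ k.+1)%:R)%:E)%E)) => k.
    have ek : 0 < e / (2 ^ k.+1)%:R by rewrite divr_gt0// ltr0n expn_gt0.
    have hk : hull (C k) \is a fin_num.
      by rewrite ge0_fin_numE// ltey; apply/eqP => koo; apply: noo; exists k.
    have [_ [ab Cab <-] lt] := lb_ereal_inf_adherent ek hk.
    by exists ab; split => //; exact: ltW.
  apply: (@le_trans _ _ (\sum_(0 <= j <oo) (box_volume (s j).1 (s j).2)%:E)%E).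
    apply: ereal_inf_lbound; exists s => //= x Ax.
    by have [j _ Cx] := AC _ Ax; exists j => //; exact: (Ps j).1.
  apply: lee_nneseries => [k _ _|k _]; first by rewrite lee_fin box_volume_ge0.
  exact: (Ps k).2.
apply: le_ereal_inf_tmp => _ [s As <-].
apply: (@le_trans _ _ (\sum_(0 <= j <oo) hull (box (s j).1 (s j).2))%E).
  apply: ereal_inf_lbound; exists (fun j => box (s j).1 (s j).2) => //; split => //.
  by move=> i; exact: sub_sigma_algebra.
apply: lee_nneseries => // k _.
by apply: ereal_inf_lbound; exists (s k).
Qed.

Lemma lebesgue_d_ge0 A : (0 <= lam A)%E.
Proof. by rewrite lebesgue_dE mu_ext_ge0. Qed.

Lemma lebesgue_d0 : lam set0 = 0%E.
Proof. by rewrite lebesgue_dE mu_ext0. Qed.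

Lemma le_lebesgue_d : {homo lam : A B / A `<=` B >-> (A <= B)%E}.
Proof. by move=> A B AB; rewrite lebesgue_dE; exact: (@le_mu_ext _ _ _ hull). Qed.

Lemma lebesgue_d_sigma_subadditive : sigma_subadditive lam.
Proof.
by move=> A; rewrite lebesgue_dE; exact: (@mu_ext_sigma_subadditive _ _ _ hull hull_ge0 A).
Qed.

HB.instance Definition _ := isOuterMeasure.Build R 'rV[R]_d lam
  lebesgue_d0 lebesgue_d_ge0 le_lebesgue_d lebesgue_d_sigma_subadditive.

Lemma lebesgue_dU A B : (lam (A `|` B) <= lam A + lam B)%E.
Proof. exact: outer_measureU2. Qed.

Lemma lebesgue_d_box_le a b : (lam (box a b) <= (box_volume a b)%:E)%E.
Proof.
pose s (j : nat) := if j is 0%N then (a, b) else (0, 0) : 'rV[R]_d * 'rV[R]_d.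
apply: (@le_trans _ _ (\sum_(0 <= j <oo) (box_volume (s j).1 (s j).2)%:E)%E).
  by apply: ereal_inf_lbound; exists s => //= x abx; exists 0%N.
rewrite nneseries_recl//; last by move=> j; rewrite lee_fin box_volume_ge0.
rewrite eseries0 => [|[|j]//= _ _]; first by rewrite adde0.
by rewrite box_volume_degenerate.
Qed.

Let setcoord (a : 'rV[R]_d) i (c : R) : 'rV[R]_d :=
  \row_j (if j == i then c else a 0 j).

(** Cutting a box by a coordinate hyperplane gives two boxes whose volumes add
    up, so that half-spaces satisfy the criterion of Caratheodory. *)
Lemma halfspace_caratheodory i (c : R) :
  lam.-caratheodory [set x : 'rV[R]_d | c < x 0 i].
Proof.
apply: le_caratheodory_measurable => X; set H := [set x | _].
apply: le_ereal_inf_tmp => _ [s Xs <-].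
pose s1 j := (setcoord (s j).1 i (Num.max ((s j).1 0 i) c), (s j).2).
pose s2 j := ((s j).1, setcoord (s j).2 i (Num.min ((s j).2 0 i) c)).
have sE j : box_volume (s j).1 (s j).2
    = box_volume (s1 j).1 (s1 j).2 + box_volume (s2 j).1 (s2 j).2.
  rewrite /box_volume /s1 /s2 /= (bigD1 i)//= [X in _ = X + _](bigD1 i)//=.
  rewrite [X in _ = _ + X](bigD1 i)//= !mxE eqxx.
  have e1 : \prod_(i0 < d | i0 != i) Num.max 0 ((s j).2 0 i0 -
      setcoord (s j).1 i (Num.max ((s j).1 0 i) c) 0 i0) =
      \prod_(i0 < d | i0 != i) Num.max 0 ((s j).2 0 i0 - (s j).1 0 i0).
    by apply: eq_bigr => l /negbTE li; rewrite !mxE li.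
  have e2 : \prod_(i0 < d | i0 != i) Num.max 0
      (setcoord (s j).2 i (Num.min ((s j).2 0 i) c) 0 i0 - (s j).1 0 i0) =
      \prod_(i0 < d | i0 != i) Num.max 0 ((s j).2 0 i0 - (s j).1 0 i0).
    by apply: eq_bigr => l /negbTE li; rewrite !mxE li.
  rewrite e1 e2 -mulrDl; congr (_ * _).
  move: ((s j).1 0 i) ((s j).2 0 i) => u v.
  by case: (leP u c) => ?; case: (leP v c) => ?; rewrite !maxEle;
    do ?[case: ifPn; rewrite -?ltNge => ?]; lra.
rewrite (_ : \sum_(0 <= j <oo) _ = \sum_(0 <= j <oo)
   ((box_volume (s1 j).1 (s1 j).2)%:E + (box_volume (s2 j).1 (s2 j).2)%:E))%E;
  last by apply: eq_eseriesr => j _; rewrite sE EFinD.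
rewrite nneseriesD => [||j _ _]; do ?[by move=> *; rewrite lee_fin box_volume_ge0].
apply: leeD; apply: ereal_inf_lbound.
  exists s1 => //= x [/Xs[j _ xj] Hx]; exists j => // l /=.
  have /andP[lx ux] := xj l; rewrite ux andbT mxE.
  by case: eqP => [->|//]; rewrite gt_max Hx andbT; have /andP[] := xj i.
exists s2 => //= x [/Xs[j _ xj] /negP]; rewrite -leNgt => Hx.
exists j => // l /=; have /andP[lx ux] := xj l; rewrite lx /= mxE.
by case: eqP => [->|//]; rewrite le_min Hx andbT; have /andP[] := xj i.
Qed.

Lemma box_caratheodory a b : lam.-cara.-measurable (box a b).
Proof.
rewrite (_ : box a b = \bigcap_(i in [set: 'I_d])
    ([set x : 'rV[R]_d | a 0 i < x 0 i] `&` ~` [set x : 'rV[R]_d | b 0 i < x 0 i])).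
  apply: fin_bigcap_measurable => [|i _]; first exact: finite_finset.
  apply: measurableI; last apply: measurableC; exact: halfspace_caratheodory.
apply/seteqP; split => x xab i.
  by have /andP[? ?] := xab i; split => //=; apply/negP; rewrite -leNgt.
by have [/= -> /negP] := xab i I; rewrite -leNgt => ->.
Qed.

(** An open set is the countable union of the boxes with rational corners that it
    contains. *)
Lemma open_caratheodory U : open U -> lam.-cara.-measurable U.
Proof.
move=> oU.
pose q (p : 'rV[rat]_d) : 'rV[R]_d := map_mx ratr p.
pose W (p : 'rV[rat]_d * 'rV[rat]_d) :=
  if `[< box (q p.1) (q p.2) `<=` U >] then box (q p.1) (q p.2) else set0.
rewrite (_ : U = \bigcup_p W p).
  apply: countable_bigcupT_measurable => [|p]; first exact: countableP.
  rewrite /W.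
  by case: asboolP => _; [exact: box_caratheodory|exact: measurable0].
apply/seteqP; split => [x Ux|x [p _]]; last first.
  by rewrite /W; case: asboolP => // sub; exact: sub.
have [e e0 eU] := (openP_eball U).1 oU _ Ux.
pose h := e / d.+1%:R; have h0 : 0 < h by rewrite divr_gt0.
have [p1 Hp1] : exists p : 'rV[rat]_d, forall i, x 0 i - h < q p 0 i < x 0 i.
  have /choice[f Hf] i : exists r : rat, x 0 i - h < ratr r < x 0 i.
    have /rat_in_itvoo[r] : x 0 i - h < x 0 i by rewrite gtrBl.
    by rewrite in_itv /=; exists r.
  by exists (\row_i f i) => i; rewrite !mxE.
have [p2 Hp2] : exists p : 'rV[rat]_d, forall i, x 0 i < q p 0 i < x 0 i + h.
  have /choice[f Hf] i : exists r : rat, x 0 i < ratr r < x 0 i + h.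
    have /rat_in_itvoo[r] : x 0 i < x 0 i + h by rewrite ltrDl.
    by rewrite in_itv /=; exists r.
  by exists (\row_i f i) => i; rewrite !mxE.
exists (p1, p2) => //; rewrite /W asboolT /=.
  by move=> i; have /andP[_ ->] := Hp1 i; have /andP[/ltW-> _] := Hp2 i.
move=> y yp; apply: eU; rewrite /eball/=.
have /enorm_le_coord : 0 <= h by exact: ltW.
move=> /(_ _ (y - x)) /(_ _) /le_lt_trans; apply => [i|]; last first.
  rewrite mulrCA -[ltRHS]mulr1 ltr_pM2l// ltr_pdivrMr// mul1r.
  by rewrite ltr_nat.
rewrite !mxE ler_norml; have := yp i.
have := Hp1 i; have := Hp2 i; lra.
Qed.

(** Caratheodory's criterion holds for all sets, so that an open set splits the
    measure even of a set that is not measurable. *)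
Lemma lebesgue_d_split U X : open U -> lam X = (lam (X `&` U) + lam (X `\` U))%E.
Proof. by move=> /open_caratheodory; exact. Qed.

End OuterMeasure.

(** * Lebesgue measure under similarities *)
Section MeasureOfImages.
Context {R : realType} {n : nat}.
Local Notation d := n.+1.
Implicit Types (a b x y v : 'rV[R]_d) (A B U X : set 'rV[R]_d).
Local Notation lam := (@lebesgue_d R d).

Lemma lebesgue_d_fin_cover (I : finType) (P : pred I) (C : I -> set 'rV[R]_d) A :
  A `<=` [set x | exists2 i, P i & C i x] -> (lam A <= \sum_(i | P i) lam (C i))%E.
Proof.
move=> AC; apply: (@le_trans _ _ (lam (\big[setU/set0]_(i | P i) C i))).
  apply: le_lebesgue_d => x /AC[i Pi Cx].
  by rewrite (bigD1 i)//=; left.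
elim/big_ind2 : _ => [|X1 x1 X2 x2 le1 le2|//]; first by rewrite lebesgue_d0.
by apply: le_trans (lebesgue_dU _ _) _; exact: leeD.
Qed.

(** A bound on the images of boxes passes to all sets through their covers. *)
Lemma le_lebesgue_d_image (f : 'rV[R]_d -> 'rV[R]_d) (c : R) : 0 < c ->
  (forall a b, (lam (f @` box a b) <= (c * box_volume a b)%:E)%E) ->
  forall A, (lam (f @` A) <= c%:E * lam A)%E.
Proof.
move=> c0 fc A; rewrite -lee_pdivrMl//.
apply: le_ereal_inf_tmp => _ [s As <-]; rewrite lee_pdivrMl// -nneseriesZl; last first.
  by move=> j _; rewrite lee_fin box_volume_ge0.
apply: (@le_trans _ _ (\sum_(0 <= j <oo) lam (f @` box (s j).1 (s j).2))%E).
  apply: le_trans (lebesgue_d_sigma_subadditive _).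
  by apply: le_lebesgue_d => _ [x /As[j _ xj] <-]; exists j => //; exists x.
by apply: lee_nneseries => [j _ _|j _]; [exact: lebesgue_d_ge0|rewrite -EFinM].
Qed.

Let le_homothety (k : R) v A : 0 < k ->
  (lam ((fun x => k *: x + v)%R @` A) <= (k ^+ d)%:E * lam A)%E.
Proof.
move=> k0; apply: le_lebesgue_d_image => [|a b]; first exact: exprn_gt0.
rewrite (_ : _ * _ = box_volume (k *: a + v) (k *: b + v)).
  apply: le_trans (lebesgue_d_box_le _ _); apply: le_lebesgue_d => _ [x xab <-] i.
  by have /andP[ax xb] := xab i; rewrite !mxE ltrD2r lerD2r ltr_pM2l// ler_pM2l// ax.
rewrite /box_volume -[X in _ ^+ X]card_ord -prodr_const -big_split /=.
apply: eq_bigr => i _; rewrite !mxE opprD addrACA subrr addr0 -mulrBr.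
by rewrite maxr_pMr ?(ltW k0)// mulr0.
Qed.

Lemma lebesgue_d_homothety (k : R) v A : 0 < k ->
  lam ((fun x => k *: x + v) @` A) = ((k ^+ d)%:E * lam A)%E.
Proof.
move=> k0; apply/eqP; rewrite eq_le le_homothety//=.
have kV : 0 < k^-1 by rewrite invr_gt0.
have := le_homothety (- (k^-1 *: v)) ((fun x => k *: x + v) @` A) kV.
rewrite image_comp (_ : _ \o _ = id) ?image_id; last first.
  by apply/funext => x /=; rewrite scalerDr scalerA mulVf ?gt_eqF// scale1r addrK.
by rewrite exprVn lee_pdivlMl ?exprn_gt0.
Qed.

Lemma lebesgue_d_bounded A : ebounded A -> (lam A < +oo)%E.
Proof.
move=> [M AM]; apply: (@le_lt_trans _ _ (lam (box (const_mx (- M - 1)) (const_mx M)))).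
  apply: le_lebesgue_d => x /AM xM i; rewrite !mxE.
  have := le_trans (ler_coord_enorm x i) xM; rewrite ler_norml; lra.
by apply: le_lt_trans (lebesgue_d_box_le _ _) _; rewrite ltry.
Qed.

Let Q := box (0 : 'rV[R]_d) (const_mx 1).

(** A box is covered by small translates of scaled copies of the unit cube whose
    total volume exceeds that of the box by as little as desired; hence a linear
    map expands all measures at most as much as that of the unit cube. *)
Lemma le_lebesgue_d_linear (M : 'M[R]_d) (c : R) : 0 < c ->
  (lam ((fun x => x *m M) @` Q) <= c%:E)%E ->
  forall A, (lam ((fun x => x *m M) @` A) <= c%:E * lam A)%E.
Proof.
move=> c0 Qc; apply: le_lebesgue_d_image => // a b.
pose l i := Num.max 0 (b 0 i - a 0 i).
(* [P.[h]] bounds the total volume of the cubes of side [h] needed to cover the box. *)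
pose P : {poly R} := \prod_(i < d) ((l i)%:P + 'X).
have PE t : P.[t] = \prod_(i < d) (l i + t).
  by rewrite horner_prod; apply: eq_bigr => i _; rewrite !hornerE.
suff le m : (lam ((fun x => x *m M) @` box a b) <= (c * P.[m.+1%:R^-1])%:E)%E.
  have -> : box_volume a b = P.[0] by rewrite PE; apply: eq_bigr => i _; rewrite addr0.
  have cv : (fun m => (c * P.[m.+1%:R^-1])%:E) @ \oo --> (c * P.[0])%:E.
    apply: cvg_EFin; first by near=> m.
    apply: cvgMr; exact: (cvg_comp _ _ cvg_harmonic (@continuous_horner _ P 0)).
  rewrite -(cvg_lim _ cv)//; apply: lime_ge; first by apply/cvg_ex; eexists; exact: cv.
  by near=> m; exact: le.
set h := m.+1%:R^-1; have h0 : 0 < h by rewrite invr_gt0.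
pose N i := (Num.truncn (l i * m.+1%:R)).+1.
pose N0 := (\max_i N i)%N.
pose v (j : {ffun 'I_d -> 'I_N0}) : 'rV[R]_d := \row_i (b 0 i - (j i).+1%:R * h).
pose C j := (fun x => x *m M) @` ((fun x => h *: x + v j) @` Q).
have lamC j : (lam (C j) <= (c * h ^+ d)%:E)%E.
  rewrite /C image_comp.
  rewrite (_ : _ \o _ = (fun x => h *: x + v j *m M) \o (fun x => x *m M)); last first.
    by apply/funext => x /=; rewrite mulmxDl scalemxAl.
  rewrite -image_comp lebesgue_d_homothety// mulrC EFinM.
  by rewrite lee_pmul2l// ?lte_fin ?exprn_gt0.
apply: (@le_trans _ _ (\sum_(j in family (fun i => [pred q : 'I_N0 | (q < N i)%N])) lam (C j))%E).
  apply: lebesgue_d_fin_cover => _ [x xab <-].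
  have tN (i : 'I_d) : (Num.truncn ((b 0 i - x 0 i) * m.+1%:R)%R < N i)%N.
    rewrite ltnS; apply: le_truncn; rewrite ler_wpM2r// le_max.
    by have /andP[/ltW ax _] := xab i; rewrite lerD2l lerN2 ax orbT.
  have tN0 (i : 'I_d) : (Num.truncn ((b 0 i - x 0 i) * m.+1%:R)%R < N0)%N.
    by apply: leq_trans (tN i) _; exact: leq_bigmax.
  pose j : {ffun 'I_d -> 'I_N0} := [ffun i => Ordinal (tN0 i)].
  exists j; first by apply/familyP => i; rewrite inE ffunE /=.
  exists x => //; exists (h^-1 *: (x - v j)); last first.
    by rewrite scalerA divff ?gt_eqF// scale1r subrK.
  move=> i; rewrite !mxE ffunE /= /h invrK.
  have /truncn_itv/andP[t1 t2] : 0 <= (b 0 i - x 0 i) * m.+1%:R.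
    by rewrite mulr_ge0// subr_ge0; have /andP[] := xab i.
  move: t1 t2; set t := Num.truncn _; rewrite -!natr1.
  set q := m%:R + 1; have q0 : q != 0 by rewrite /q natr1.
  rewrite (_ : q * _ = q * x 0 i - b 0 i * q + (t%:R + 1)); last by field.
  move=> t1 t2; lra.
apply: (@le_trans _ _ (\sum_(j in family (fun i => [pred q : 'I_N0 | (q < N i)%N])) (c * h ^+ d)%:E)%E).
  by apply: lee_sum => j _.
rewrite sumEFin lee_fin -mulr_sumr ler_pM2l// PE.
under eq_bigr do rewrite -[X in _ ^+ X](card_ord d) -prodr_const.
rewrite -(bigA_distr_big_dep _ (fun i j => h)); apply: ler_prod => i _.
have iN0 : (N i <= N0)%N by exact: leq_bigmax.
rewrite -(big_ord_widen _ (fun=> h) iN0) sumr_const card_ord -mulr_natl.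
rewrite mulr_ge0 ?(ltW h0)//= /N -natr1 mulrDl mul1r lerD2r.
have l0 : 0 <= l i by rewrite /l le_max lexx.
rewrite /h ler_pdivrMr ?ltr0n//.
by have /truncn_itv/andP[] : 0 <= l i * m.+1%:R by rewrite mulr_ge0.
Unshelve. all: by end_near. Qed.

Hypothesis ball_pos : (0 < lam (eball 0 1))%E.

Let ball_fin : (lam (eball 0 1) < +oo)%E.
Proof.
apply: lebesgue_d_bounded; exists 1 => x; rewrite /eball/= subr0.
exact: ltW.
Qed.

(** If the unit cube had measure less than [1], then the identity, as a linear map,
    would strictly decrease the measure of the unit ball. *)
Lemma lebesgue_d_unit_cube : lam Q = 1%E.
Proof.
have Q1 : (lam Q <= 1%E)%E.
  apply: le_trans (lebesgue_d_box_le _ _) _; rewrite lee_fin /box_volume big1// => i _.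
  by rewrite !mxE subr0 max_r.
apply/eqP; rewrite eq_le Q1 /= leNgt; apply/negP => lt1.
have Qfin : lam Q \is a fin_num by rewrite ge0_fin_numE ?lebesgue_d_ge0// (lt_trans lt1)// ltry.
have q0 : 0 <= fine (lam Q) by rewrite fine_ge0 ?lebesgue_d_ge0.
have q1 : fine (lam Q) < 1 by rewrite -lte_fin fineK.
pose c := (fine (lam Q) + 1) / 2.
have c0 : 0 < c by rewrite /c; lra.
have := @le_lebesgue_d_linear 1%:M c c0 _ (eball 0 1).
rewrite (_ : (fun x => x *m 1%:M) = id); last by apply/funext => x; rewrite mulmx1.
rewrite !image_id => /(_ _)/wrap[|].
  by rewrite -(fineK Qfin) lee_fin /c; lra.
have Bfin : lam (eball 0 1) \is a fin_num by rewrite ge0_fin_numE ?lebesgue_d_ge0.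
move: ball_pos; rewrite -(fineK Bfin) -EFinM lee_fin lte_fin => B0.
by rewrite ler_pMl// /c; lra.
Qed.

(** An orthogonal map [u] preserves the unit ball. Comparing a cube with the images
    of the ball and of its complement in the cube, of which only the latter may
    have its measure increased by the factor [c = lam (u @` Q)], gives [c <= 1]. *)
Lemma le_lebesgue_d_orthogonal (M : 'M[R]_d) A : M *m M^T = 1%:M ->
  (lam ((fun x => x *m M) @` A) <= lam A)%E.
Proof.
move=> MM; set u := fun x : 'rV[R]_d => x *m M.
have un x : enorm (u x) = enorm x.
  apply/eqP; rewrite -(@eqrXn2 _ 2) ?enorm_ge0// !enorm_sqr.
  have dE y : dotp y y = (y *m y^T) 0 0.
    by rewrite mxE; apply: eq_bigr => i _; rewrite mxE.
  by rewrite !dE /u trmx_mul mulmxA -(mulmxA x) MM mulmx1.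
have uB : u @` eball 0 1 = eball 0 1.
  apply/seteqP; split => [_ [x xB <-]|x xB]; rewrite /eball/=.
    by rewrite subr0 un; move: xB; rewrite /eball/= subr0.
  exists (x *m M^T); last by rewrite /u -mulmxA (mulmx1C MM) mulmx1.
  rewrite /eball/= subr0 -un /u -mulmxA (mulmx1C MM) mulmx1.
  by move: xB; rewrite /eball/= subr0.
have uQfin : lam (u @` Q) \is a fin_num.
  rewrite ge0_fin_numE ?lebesgue_d_ge0//; apply: lebesgue_d_bounded.
  exists (d%:R * 1) => _ [x xQ <-]; rewrite un; apply: enorm_le_coord => // i.
  by have := xQ i; rewrite !mxE => /andP[/ltW x0 x1]; rewrite ger0_norm.
set c := fine (lam (u @` Q)); have cE : lam (u @` Q) = c%:E by rewrite fineK.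
suff c1 : c <= 1.
  have := @le_lebesgue_d_linear M 1 ltr01 _ A.
  by rewrite mul1e; apply; rewrite -/u cE lee_fin.
rewrite leNgt; apply/negP => c1.
pose Q2 := (fun x => 2 *: x + const_mx (-1)) @` Q.
have BQ2 : eball 0 1 `<=` Q2.
  move=> x; rewrite /eball/= subr0 => x1.
  exists (2^-1 *: (x + const_mx 1)).
    move=> i; rewrite !mxE.
    have := le_lt_trans (ler_coord_enorm x i) x1; rewrite ltr_norml; lra.
  by apply/rowP => i; rewrite !mxE; field.
have lamQ2 : lam Q2 = (2 ^+ d)%:E.
  by rewrite lebesgue_d_homothety// lebesgue_d_unit_cube mule1.
have lamuQ2 : lam (u @` Q2) = (2 ^+ d * c)%:E.
  rewrite /Q2 image_comp.
  rewrite (_ : _ \o _ = (fun x => 2 *: x + u (const_mx (-1))) \o u); last first.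
    by apply/funext => x /=; rewrite /u mulmxDl scalemxAl.
  by rewrite -image_comp lebesgue_d_homothety// cE EFinM.
have := @lebesgue_d_split _ _ (eball 0 1) Q2 (@open_eball _ _ _ _).
rewrite (setIidr BQ2) lamQ2.
have Bfin : lam (eball 0 1) \is a fin_num by rewrite ge0_fin_numE ?lebesgue_d_ge0.
have Dfin : lam (Q2 `\` eball 0 1) \is a fin_num.
  rewrite ge0_fin_numE ?lebesgue_d_ge0//; apply: (@le_lt_trans _ _ (lam Q2)).
    by apply: le_lebesgue_d => x [].
  by rewrite lamQ2 ltry.
have c0 : 0 < c by lra.
have le : (lam (u @` Q2) <= lam (eball 0 1) + c%:E * lam (Q2 `\` eball 0 1))%E.
  apply: (@le_trans _ _ (lam (u @` eball 0 1 `|` u @` (Q2 `\` eball 0 1)))).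
    apply: le_lebesgue_d => _ [x xQ <-].
    by have [xB|xB] := pselect (eball 0 1 x); [left|right]; exists x.
  apply: le_trans (lebesgue_dU _ _) _; rewrite uB leeD2l//.
  by apply: le_lebesgue_d_linear => //; rewrite -/u cE.
move: ball_pos le; rewrite lamuQ2 -(fineK Bfin) -(fineK Dfin).
set B := fine _; set E := fine _; rewrite -EFinM -!EFinD lte_fin lee_fin => B0 le [e].
have : 0 < B * (c - 1) by rewrite mulr_gt0// subr_gt0.
move: le; rewrite e; nra.
Qed.

(** Both the orthogonal part and its inverse do not increase the measure. *)
Lemma lebesgue_d_similarity f (k : R) A : similarity f k ->
  lam (f @` A) = ((k ^+ d)%:E * lam A)%E.
Proof.
move=> fk; have [M [MM fE]] := similarity_affine fk; have [k0 _] := fk.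
rewrite (_ : f @` A = (fun x => k *: x + f 0) @` ((fun x => x *m M) @` A)); last first.
  by rewrite image_comp; apply: eq_imagel => x _; rewrite fE.
rewrite lebesgue_d_homothety//; congr (_ * _)%E.
apply/eqP; rewrite eq_le le_lebesgue_d_orthogonal//=.
have MM' : M^T *m M^T^T = 1%:M by rewrite trmxK; exact: mulmx1C.
have := le_lebesgue_d_orthogonal ((fun x => x *m M) @` A) MM'.
rewrite image_comp (_ : _ \o _ = id) ?image_id//.
by apply/funext => x /=; rewrite -mulmxA MM mulmx1.
Qed.

End MeasureOfImages.

(** * Distances and parallel sets *)
Section Distance.
Context {R : realType} {d : nat}.
Implicit Types (x y z : 'rV[R]_d) (A B U : set 'rV[R]_d).

Lemma parallel_setP A (e : R) x : parallel_set A e x <->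
  forall e', e < e' -> exists2 y, A y & enorm (x - y) < e'.
Proof.
rewrite /parallel_set /=; split => [xA e' ee'|xA].
  have : (dist_set x A < e'%:E)%E by apply: le_lt_trans xA _; rewrite lte_fin.
  move=> /ereal_inf_lt[_ [y Ay <-]]; rewrite lte_fin => lt.
  by exists y.
apply/lee_addgt0Pr => t t0; have [|y Ay lt] := xA (e + t); first by rewrite ltrDl.
apply: le_trans (_ : (enorm (x - y))%:E <= _)%E; last by rewrite lee_fin ltW.
by apply: ereal_inf_lbound; exists y.
Qed.

Lemma parallel_set_sub A B (e : R) x :
  (forall y, A y -> exists2 z, B z & enorm (x - z) <= enorm (x - y)) ->
  parallel_set A e x -> parallel_set B e x.
Proof.
move=> AB /parallel_setP xA; apply/parallel_setP => e' /xA[y /AB[z Bz zy] lt].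
by exists z => //; exact: le_lt_trans lt.
Qed.

Lemma parallel_set_mono A (e e' : R) : e <= e' ->
  parallel_set A e `<=` parallel_set A e'.
Proof. by move=> ee' x /le_trans; apply; rewrite lee_fin. Qed.

Lemma sub_parallel_set A (e : R) : 0 <= e -> A `<=` parallel_set A e.
Proof.
move=> e0 x Ax; apply/parallel_setP => e' ee'; exists x => //.
by rewrite subrr enorm0; exact: le_lt_trans ee'.
Qed.

Lemma ebounded_parallel_set A (e : R) : ebounded A -> ebounded (parallel_set A e).
Proof.
move=> [M AM]; exists (e + 1 + M) => x /parallel_setP/(_ (e + 1)).
rewrite ltrDl => /(_ ltr01)[y /AM yM xy].
rewrite -[x](subrK y); apply: le_trans (enormD _ _) _.
by rewrite lerD// ltW.
Qed.

Lemma ebounded_sub A B : A `<=` B -> ebounded B -> ebounded A.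
Proof. by move=> AB [M BM]; exists M => x /AB/BM. Qed.

Lemma compact_ebounded A : compact A -> ebounded A.
Proof.
move=> /compact_bounded[M [_ AM]]; exists (d%:R * (`|M| + 1)) => x Ax.
apply: enorm_le_coord => [|i]; first by rewrite addr_ge0.
apply: le_trans (AM (`|M| + 1) _ x Ax); last first.
  by rewrite (le_lt_trans (ler_norm _))// ltrDl.
rewrite [leRHS]mx_normrE; apply: le_trans (le_bigmax _ _ (0, i)) => //.
Qed.

Lemma compact_eclosed A : compact A -> closed A.
Proof. by apply: compact_closed; exact: norm_hausdorff. Qed.

Lemma closed_parallel_set A x : closed A ->
  (forall e : R, 0 < e -> exists2 y, A y & enorm (x - y) < e) -> A x.
Proof.
move=> cA xA; apply: cA; apply/closureP_eball => e /xA[y Ay xy].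
by exists y => //; rewrite enormB.
Qed.

Lemma disjoint_open_closure A B : open A -> A `&` B = set0 -> A `&` closure B = set0.
Proof.
move=> oA AB; apply/seteqP; split => // x [Ax /closureP_eball Bx].
have [e e0 eA] := (openP_eball A).1 oA _ Ax.
have [y By yx] := Bx _ e0; suff : (A `&` B) y by rewrite AB.
by split => //; exact: eA.
Qed.

End Distance.

Section SimilarityTopology.
Context {R : realType} {d : nat} (f : 'rV[R]_d -> 'rV[R]_d) (k : R).
Hypothesis fk : similarity f k.
Implicit Types (x y z : 'rV[R]_d) (A B U : set 'rV[R]_d).

Lemma similarity_inj : injective f.
Proof.
case: fk => k0 fE x y fxy; have := fE x y; rewrite fxy subrr enorm0.
move=> /esym/eqP; rewrite mulf_eq0 gt_eqF//= => /eqP/enorm_eq0/eqP.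
by rewrite subr_eq0 => /eqP.
Qed.

Lemma similarity_surj y : exists x, f x = y.
Proof.
have [k0 _] := fk; have [M [MM fE]] := similarity_affine fk.
exists (k^-1 *: (y - f 0) *m M^T).
rewrite fE -mulmxA (mulmx1C MM) mulmx1 scalerA divff ?gt_eqF//.
by rewrite scale1r subrK.
Qed.

Lemma similarity_open U : open U -> open (f @` U).
Proof.
case: fk => k0 fE oU; apply/openP_eball => _ [x Ux <-].
have [e e0 eU] := (openP_eball U).1 oU _ Ux.
exists (k * e); first exact: mulr_gt0.
move=> y; have [z <-] := similarity_surj y.
by rewrite /eball/= fE ltr_pM2l// => zx; exists z => //; exact: eU.
Qed.

Lemma similarity_closure A : f @` closure A = closure (f @` A).
Proof.
case: fk => k0 fE; apply/seteqP; split => [_ [x /closureP_eball Ax <-]|y].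
  apply/closureP_eball => e e0.
  have [|y Ay yx] := Ax (e / k); first exact: divr_gt0.
  by exists (f y); [exists y|rewrite fE mulrC -ltr_pdivlMr].
have [x <-] := similarity_surj y => /closureP_eball Ax; exists x => //.
apply/closureP_eball => e e0; have [|_ [y' Ay <-]] := Ax (k * e).
  exact: mulr_gt0.
by rewrite fE ltr_pM2l// => ?; exists y'.
Qed.

End SimilarityTopology.

(** * Measures of balls and of parallel sets *)
Section Measure.
Context {R : realType} {n : nat}.
Local Notation d := n.+1.
Implicit Types (x y z : 'rV[R]_d) (A B U X : set 'rV[R]_d).
Local Notation lam := (@lebesgue_d R d).

Lemma lebesgue_d_ball (e : R) x : 0 < e ->
  lam (eball x e) = ((e ^+ d)%:E * lam (eball 0 1))%E.
Proof.
move=> e0; rewrite -(lebesgue_d_homothety x _ e0); congr lam.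
apply/seteqP; split => [y|_ [y yB <-]]; rewrite /eball/=; last first.
  move: yB; rewrite /eball/= subr0 addrK enormZ gtr0_norm// => y1.
  by rewrite -[ltRHS]mulr1 ltr_pM2l.
move=> yx; exists (e^-1 *: (y - x)).
  by rewrite /eball/= subr0 enormZ gtr0_norm ?invr_gt0// mulrC ltr_pdivrMr// mul1r.
by rewrite scalerA divff ?gt_eqF// scale1r subrK.
Qed.

Lemma lebesgue_d_split_fin (I : finType) (U : I -> set 'rV[R]_d) X :
  (forall i, open (U i)) -> (forall i j, i != j -> U i `&` U j = set0) ->
  lam X = (\sum_i lam (X `&` U i) + lam (X `\` \bigcup_i U i))%E.
Proof.
move=> oU tU.
suff H (s : seq I) : uniq s -> lam X =
    (\sum_(i <- s) lam (X `&` U i) + lam (X `\` \bigcup_(i in [set` s]) U i))%E.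
  rewrite (H _ (index_enum_uniq I)); congr (_ + lam (_ `\` _))%E.
  by apply/seteqP; split => x [i _ Ux]; exists i => //=; rewrite mem_index_enum.
elim: s => [_|i s ih /= /andP[si us]].
  rewrite big_nil add0e; congr lam; apply/seteqP; split => [x Xx|x []//].
  by split => // -[].
rewrite big_cons {1}ih// (lebesgue_d_split (X `\` _) (oU i)) [LHS]addeCA addeA.
congr (lam _ + _ + lam _)%E.
  apply/seteqP; split => [x [[Xx _] Ux]|x [Xx Ux]]//; split => //; split => //.
  move=> [j /= js Uj]; suff : (U i `&` U j) x by rewrite tU//; apply: contraNneq si => ->.
  by [].
apply/seteqP; split => [x [[Xx nU] nUi]|x [Xx nU]].
  split => // -[j /=]; rewrite inE => /orP[/eqP->//|js Uj].
  by apply: nU; exists j.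
split; first split => //.
  by move=> [j /= js Uj]; apply: nU; exists j => //=; rewrite inE js orbT.
by move=> Ui; apply: nU; exists i => //=; rewrite inE eqxx.
Qed.

Hypothesis ball_pos : (0 < lam (eball 0 1))%E.

(** An unbounded set has infinitely many points at pairwise distance at least
    [2 * e], and the balls of radius [e] around them are disjoint. *)
Lemma parallel_set_bounded A (e : R) : 0 < e ->
  (lam (parallel_set A e) < +oo)%E -> ebounded A.
Proof.
move=> e0 fin; apply: contrapT => nb.
have ex M : exists2 x, A x & M < enorm x.
  apply: contrapT => nx; apply: nb; exists M => x Ax.
  by rewrite leNgt; apply/negP => Mx; apply: nx; exists x.
have Bfin x : lam (eball x e) \is a fin_num.
  rewrite ge0_fin_numE ?lebesgue_d_ge0// lebesgue_d_bounded//.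
  exists (e + enorm x) => y yx; rewrite -[y](subrK x).
  by apply: le_trans (enormD _ _) _; rewrite lerD2r ltW.
set c := fine (lam (eball 0 e)).
have cE x : lam (eball x e) = c%:E.
  by rewrite /c fineK// !(lebesgue_d_ball _ e0).
have c0 : 0 < c.
  by rewrite -lte_fin -(cE 0) lebesgue_d_ball// mule_gt0// lte_fin exprn_gt0.
have H m : forall M : R, ((m%:R * c)%:E <=
    lam (parallel_set A e `&` [set x | (M <= enorm x)%R]))%E.
  elim: m => [|m ih] M; first by rewrite mul0r lebesgue_d_ge0.
  have [x Ax Mx] := ex (M + e).
  rewrite (lebesgue_d_split _ (@open_eball _ _ x e)).
  rewrite -natr1 mulrDl mul1r addrC EFinD leeD//.
    rewrite -(cE x); apply: le_lebesgue_d => y yx; split => //.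
    split.
      apply/parallel_setP => e' ee'; exists x => //.
      exact: lt_trans ee'.
    have := enormD y (x - y); rewrite addrC subrK (enormB x).
    by move: yx Mx; rewrite /eball/=; lra.
  apply: le_trans (ih (enorm x + e)) _; apply: le_lebesgue_d => y [yA /= xy].
  split; first by split => //=; lra.
  rewrite /eball/= => yx; have := enormD (y - x) x; rewrite subrK; lra.
have Afin : lam (parallel_set A e) \is a fin_num by rewrite ge0_fin_numE ?lebesgue_d_ge0.
have [m Hm] : exists m, (lam (parallel_set A e) < (m%:R * c)%:E)%E.
  exists (Num.truncn (fine (lam (parallel_set A e)) / c)).+1.
  rewrite -(fineK Afin) lte_fin -ltr_pdivrMr//.
  have /truncn_itv/andP[//] : 0 <= fine (lam (parallel_set A e)) / c.
  by rewrite divr_ge0 ?(ltW c0)// fine_ge0 ?lebesgue_d_ge0.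
have := H m (0 : R); rewrite leNgt => /negP; apply.
by apply: le_lt_trans Hm; apply: le_lebesgue_d => x [].
Qed.

Lemma open_lebesgue_d_gt0 U : open U -> U !=set0 -> (0 < lam U)%E.
Proof.
move=> oU [x Ux]; have [e e0 eU] := (openP_eball U).1 oU _ Ux.
apply: lt_le_trans (le_lebesgue_d eU); rewrite lebesgue_d_ball//.
by rewrite mule_gt0// lte_fin exprn_gt0.
Qed.

End Measure.

(** * The tiling and the renewal equation *)
Section Tiling.
Context {R : realType} {n N : nat}.
Local Notation d := n.+1.
Implicit Types (x y z : 'rV[R]_d) (A B U X : set 'rV[R]_d) (e : R).
Local Notation lam := (@lebesgue_d R d).
Variables (Phi : 'I_N -> 'rV[R]_d -> 'rV[R]_d) (r : 'I_N -> R).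
Variables (F O G : set 'rV[R]_d).
Hypothesis Phi_sim : contractive_similarities Phi r.
Hypothesis F_attractor : attractor Phi F.
Hypothesis O_feasible : feasible Phi O.
Hypothesis bdO_sub_F : boundary O `<=` F.
Hypothesis single_generator : generators Phi O = [set G].
Hypothesis G_open : open G.
Hypothesis K_bounded : ebounded (closure O).
Hypothesis ball_pos : (0 < lam (eball 0 1))%E.

Local Notation K := (closure O).

Let rgt0 i : 0 < r i. Proof. by have [/andP[]] := Phi_sim i. Qed.
Let Phi_similarity i : similarity (Phi i) (r i).
Proof. by split => //; have [_] := Phi_sim i. Qed.

Let oO : open O. Proof. by case: O_feasible. Qed.
Let PhiO i x : O x -> O (Phi i x).
Proof. by case: O_feasible => _ _ sub _ Ox; apply: (sub i); exists x. Qed.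
Let F_closed : closed F. Proof. by case: F_attractor => _ /compact_eclosed. Qed.

Let F_image x : F x <-> exists i y, F y /\ x = Phi i y.
Proof.
case: F_attractor => _ _ FE; rewrite {1}FE; split => [[i _ [y Fy <-]]|[i [y [Fy ->]]]].
  by exists i, y.
by exists i => //; exists y.
Qed.

Let PhiF i x : F x -> F (Phi i x).
Proof. by move=> Fx; apply/F_image; exists i, x. Qed.

Let PhiK i x : K x -> K (Phi i x).
Proof.
move=> Kx; have : (Phi i @` K) (Phi i x) by exists x.
rewrite (similarity_closure (Phi_similarity i)); apply: closureS.
by case: O_feasible.
Qed.

Let bdF x : K x -> ~ O x -> F x.
Proof.
move=> Kx nOx; apply: bdO_sub_F; split => //.
by have /interior_id -> := oO.
Qed.

Let contraction_ratio : exists2 q : R, 0 <= q < 1 & forall i, r i <= q.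
Proof.
exists (\big[Num.max/0]_i r i) => [|i]; last exact: le_bigmax.
rewrite {1}bigmax_idl le_max lexx /=; apply/bigmax_ltP; split => // i _.
by have [/andP[]] := Phi_sim i.
Qed.

Let word_map_dist w x y q : 0 <= q -> (forall i, r i <= q) ->
  enorm (word_map Phi w x - word_map Phi w y) <= q ^+ size w * enorm (x - y).
Proof.
move=> q0 rq; elim: w => [|i w ih] /=; first by rewrite expr0 mul1r.
have [_ ->] := Phi_similarity i; rewrite exprS -mulrA.
by rewrite ler_pM ?(ltW (rgt0 i)) ?enorm_ge0.
Qed.

(** Points that share arbitrarily long addresses with points of a closed set
    belong to it. *)
Let limit_of_words A B x : closed A -> ebounded B ->
  (forall m, exists w y z, [/\ size w = m, B y, B z, x = word_map Phi w y &
                               A (word_map Phi w z)]) -> A x.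
Proof.
move=> cA [M BM] xw; apply: closed_parallel_set => // e e0.
have [q /andP[q0 q1] rq] := contraction_ratio.
have cv : (fun m => q ^+ m * (M + M)) @ \oo --> 0 * (M + M).
  by apply: cvgMl; apply: cvg_expr; rewrite ger0_norm.
rewrite mul0r in cv.
have /cvgrPdist_lt/(_ e e0)[m _ /(_ m (leqnn m))] := cv.
rewrite sub0r normrN => lt.
have [w [y [z [sw By Bz -> Az]]]] := xw m.
exists (word_map Phi w z) => //; apply: le_lt_trans lt.
apply: le_trans (word_map_dist _ _ _ q0 rq) _; rewrite sw.
apply: le_trans (ler_norm _); rewrite ler_wpM2l ?exprn_ge0//.
apply: le_trans (enormD _ _) _; rewrite enormN.
by apply: lerD; apply: BM.
Qed.

Let F_ebounded : ebounded F.
Proof. by case: F_attractor => _ /compact_ebounded. Qed.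

Lemma attractor_sub_closure : F `<=` K.
Proof.
move=> x Fx; case: O_feasible => _ [z Oz] _ _.
have [M FM] := F_ebounded; have [M' KM] := K_bounded.
apply: (@limit_of_words K (F `|` K)).
- exact: closed_closure.
- exists (Num.max M M') => y [/FM|/KM] yM; apply: le_trans yM _.
    by rewrite le_max lexx.
  by rewrite le_max lexx orbT.
move=> m.
have [w [y [sw Fy ->]]] : exists w y, [/\ size w = m, F y & x = word_map Phi w y].
  elim: m => [|m [w [y [sw /F_image[i [y' [Fy' ->]]] ->]]]]; first by exists [::], x.
  exists (rcons w i), y'; rewrite size_rcons sw; split => //.
  by rewrite /word_map foldr_rcons.
exists w, y, z; split => //; [by left|by right; exact: subset_closure|].
have : K z by exact: subset_closure.
elim: {sw} w => //= i w ih Kz; exact/PhiK/ih.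
Qed.

Let open_disjoint_K i j x : i != j -> O x -> K `<=` [set y | Phi i x <> Phi j y].
Proof.
move=> ij Ox y Ky /= e.
have [_ _ _ /(_ _ _ ij)] := O_feasible.
move=> /(disjoint_open_closure (similarity_open (Phi_similarity i) oO)).
rewrite -(similarity_closure (Phi_similarity j)) => /seteqP[+ _].
by move=> /(_ (Phi i x)); apply; split; [exists x|exists y].
Qed.

Let PhiO_F i x : O x -> F (Phi i x) -> F x.
Proof.
move=> Ox /F_image[j [y [Fy e]]]; have [ij|ij] := eqVneq i j.
  by rewrite -ij in e; rewrite (similarity_inj (Phi_similarity i) e).
by have := open_disjoint_K ij Ox (attractor_sub_closure Fy).
Qed.

Let G_eq : G = O `\` ifs_image Phi K.
Proof.
have : generators Phi O G by rewrite single_generator.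
move=> [x0 Ux0 <-]; apply/seteqP; split; first exact: connected_component_sub.
move=> x Ux.
have : generators Phi O (connected_component (O `\` ifs_image Phi K) x) by exists x.
rewrite single_generator => /= gx.
have : generators Phi O (connected_component (O `\` ifs_image Phi K) x0) by exists x0.
rewrite single_generator => /= ->; rewrite -gx.
exact: connected_component_refl.
Qed.

Let G_sub x : G x -> O x /\ ~ F x.
Proof.
rewrite G_eq => -[Ox nK]; split => // /F_image[i [y [Fy e]]]; apply: nK.
by exists i => //; exists y => //; exact: attractor_sub_closure.
Qed.

Let O_cover x : O x -> ~ F x -> G x \/ exists i y, [/\ O y, ~ F y & x = Phi i y].
Proof.
move=> Ox nFx; have [Gx|nGx] := pselect (G x); first by left.
right; have [i _ [y Ky e]] : ifs_image Phi K x.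
  by apply: contrapT => nK; apply: nGx; rewrite G_eq.
have nFy : ~ F y by move=> Fy; apply: nFx; rewrite -e; exact: PhiF.
exists i, y; split => //; apply: contrapT => nOy; exact/nFy/bdF.
Qed.

(** The tiles exhaust [O] up to the attractor: a point in no tile has arbitrarily
    long addresses, hence is in [F]. *)
Lemma tiling_unionE : tiling_union Phi O = O `\` F.
Proof.
apply/seteqP; split => [x [_ [w [G' [+ ->]]]]|x [Ox nFx]].
  rewrite single_generator /= => -> [y Gy <-].
  elim: w => [|i w [Ow nFw]] /=; first exact: G_sub.
  by split; [exact: PhiO|move=> /PhiO_F-/(_ Ow)].
apply: contrapT => nTx; apply: (nFx); have [[f0 Ff0] _ _] := F_attractor.
have [M FM] := F_ebounded; have [M' KM] := K_bounded.
apply: (@limit_of_words F (F `|` K)) => //.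
  exists (Num.max M M') => y [/FM|/KM] yM; apply: le_trans yM _.
    by rewrite le_max lexx.
  by rewrite le_max lexx orbT.
move=> m; have [w [y [sw Oy nFy ->]]] : exists w y,
    [/\ size w = m, O y, ~ F y & x = word_map Phi w y].
  elim: m => [|m [w [y [sw Oy nFy xw]]]].
    by exists [::], x; split => // Fx.
  have [Gy|[i [y' [Oy' nFy' yE]]]] := O_cover Oy nFy.
    exfalso; apply: nTx; exists (word_map Phi w @` G); last by exists y.
    by exists w, G; rewrite single_generator.
  exists (rcons w i), y'; rewrite size_rcons sw; split => //.
  by rewrite /word_map foldr_rcons -yE.
exists w, y, f0; split => //; [by right; exact: subset_closure|by left|].
by elim: {sw} w => //= i w; exact: PhiF.
Qed.

(** Inner tubes are defined by the distance to the complement, but inside [O] the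
    distance to [F] is the same and has the advantage of scaling exactly under
    the similarities; whence these two functions. *)
Definition tube_volume e := lam ((O `\` F) `&` parallel_set F e).
Definition generator_tube_volume e := lam (G `&` parallel_set F e).

Lemma inner_tube_tiling e : inner_tube_volume (tiling_union Phi O) e = tube_volume e.
Proof.
rewrite tiling_unionE; congr lam; apply/seteqP; split => x [[Ox nFx] xe]; split => //.
  apply: parallel_set_sub xe => y nTy.
  have [Fy|nFy] := pselect (F y); first by exists y.
  have nOy : ~ O y by move=> Oy; exact: nTy.
  have [z [Kz nOz xz _]] := segment_meets_boundary oO Ox nOy.
  by exists z => //; exact: bdF.
by apply: parallel_set_sub xe => y Fy; exists y => // -[].
Qed.

(** The boundary of [G] is contained in [F]: a boundary point inside [O] and outside
    [F] would be in [G] or in one of the open sets [Phi i @` O], which are disjoint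
    from [G]. *)
Lemma inner_tube_generator e : inner_tube_volume G e = generator_tube_volume e.
Proof.
congr lam; apply/seteqP; split => x [Gx xe]; split => //.
  apply: parallel_set_sub xe => y nGy.
  have [z [Gz nGz xz _]] := segment_meets_boundary G_open Gx nGy.
  exists z => //; apply: contrapT => nFz.
  have Kz : K z by move: Gz; apply: closureS => t /G_sub[].
  have Oz : O z by apply: contrapT => nOz; exact/nFz/bdF.
  have [//|[i [t [Ot nFt zE]]]] := O_cover Oz nFz.
  have oPO := similarity_open (Phi_similarity i) oO.
  have /(disjoint_open_closure oPO)/seteqP[/(_ z) + _] : Phi i @` O `&` G = set0.
    apply/seteqP; split => // _ [[u Ou <-]]; rewrite G_eq => -[_]; apply.
    by exists i => //; exists u => //; exact: subset_closure.
  by apply; split => //; exists t.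
by apply: parallel_set_sub xe => y Fy; exists y => // /G_sub[].
Qed.

(** Seen from inside [Phi i @` O], the points of [F] outside [Phi i @` F] are no closer
    than the boundary of [Phi i @` O], which is contained in [Phi i @` F]. *)
Let parallel_set_Phi i x e : O x -> parallel_set F e (Phi i x) <-> parallel_set F (e / r i) x.
Proof.
move=> Ox; have [r0 PhiE] := Phi_similarity i; split => [/parallel_setP xe|/parallel_setP xe].
  apply/parallel_setP => e'; rewrite ltr_pdivrMr// => /xe[_ /F_image[j [y [Fy ->]]]].
  rewrite mulrC; have [<-|ij] := eqVneq i j.
    by rewrite PhiE ltr_pM2l// => ?; exists y.
  have nPO : ~ (Phi i @` O) (Phi j y).
    move=> [t Ot e0]; exact: (open_disjoint_K ij Ot (attractor_sub_closure Fy)).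
  have PO : (Phi i @` O) (Phi i x) by exists x.
  have oPO := similarity_open (Phi_similarity i) oO.
  have [z [+ nPz xz _]] := segment_meets_boundary oPO PO nPO.
  rewrite -(similarity_closure (Phi_similarity i)) => -[t Kt zE].
  move=> lt; exists t; first by apply: bdF => // Ot; apply: nPz; exists t.
  by rewrite -(ltr_pM2l r0) -PhiE zE; exact: le_lt_trans lt.
apply/parallel_setP => e' ee'; have [|y Fy xy] := xe (e' / r i).
  by rewrite ltr_pM2r ?invr_gt0.
by exists (Phi i y); [exact: PhiF|rewrite PhiE mulrC -ltr_pdivlMr].
Qed.

(** Up to [F], the set [O] consists of [G] and of the disjoint copies [Phi i @` O],
    and inside each copy the tube is a scaled copy of the whole tube. *)
Lemma tube_volume_renewal e : tube_volume e =
  (\sum_i (r i ^+ d)%:E * tube_volume (e / r i) + generator_tube_volume e)%E.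
Proof.
rewrite [LHS](@lebesgue_d_split_fin _ _ _ (fun i => Phi i @` O)); last 2 first.
- by move=> i; exact: (similarity_open (Phi_similarity i)).
- by case: O_feasible.
congr (_ + lam _)%E.
  apply: eq_bigr => i _; rewrite -(lebesgue_d_similarity ball_pos _ (Phi_similarity i)).
  congr lam; apply/seteqP; split => [x [[[_ nFx] xe] [y Oy yE]]|_ [y [[Oy nFy] ye] <-]].
    rewrite -yE in nFx xe *; exists y => //; split; last exact/parallel_set_Phi.
    by split => // Fy; apply: nFx; exact: PhiF.
  split; last by exists y.
  split; last exact/parallel_set_Phi.
  by split; [exact: PhiO|move=> /PhiO_F-/(_ Oy)].
apply/seteqP; split => [x [[[Ox nFx] xe] nPx]|x [Gx xe]].
  split => //; have [//|[i [y [Oy _ xE]]]] := O_cover Ox nFx.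
  by exfalso; apply: nPx; exists i => //; exists y.
have [Ox nFx] := G_sub Gx; split => // -[i _ [y Oy yE]].
move: Gx; rewrite G_eq => -[_]; apply; exists i => //; exists y => //.
exact: subset_closure.
Qed.

Let O_ebounded : ebounded O.
Proof. by apply: ebounded_sub K_bounded; exact: subset_closure. Qed.

Lemma generator_volume_gt0 : (0 < lam G)%E.
Proof.
apply: open_lebesgue_d_gt0 => //.
have : generators Phi O G by rewrite single_generator.
by move=> [x Ux <-]; exists x; exact: connected_component_refl.
Qed.

(** [O] contains its disjoint images together with [G], which has positive
    measure. *)
Lemma sum_ratios_lt1 : \sum_i r i ^+ d < 1.
Proof.
have Ofin : lam O \is a fin_num.
  by rewrite ge0_fin_numE ?lebesgue_d_ge0//; exact: lebesgue_d_bounded.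
have Gfin : lam G \is a fin_num.
  rewrite ge0_fin_numE ?lebesgue_d_ge0//; apply: lebesgue_d_bounded.
  by apply: ebounded_sub O_ebounded => x /G_sub[].
have O0 : (0 < lam O)%E by case: O_feasible => _ O0 _ _; exact: open_lebesgue_d_gt0.
have : (\sum_i (r i ^+ d)%:E * lam O + lam G <= lam O)%E.
  rewrite [leRHS](@lebesgue_d_split_fin _ _ _ (fun i => Phi i @` O)); last 2 first.
  - by move=> i; exact: (similarity_open (Phi_similarity i)).
  - by case: O_feasible.
  apply: leeD.
    apply: lee_sum => i _; rewrite -(lebesgue_d_similarity ball_pos _ (Phi_similarity i)).
    by apply: le_lebesgue_d => _ [y Oy <-]; split; [exact: PhiO|exists y].
  apply: le_lebesgue_d => x Gx; have [Ox _] := G_sub Gx; split => // -[i _ [y Oy yE]].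
  move: Gx; rewrite G_eq => -[_]; apply; exists i => //; exists y => //.
  exact: subset_closure.
move: O0 generator_volume_gt0; rewrite -(fineK Ofin) -(fineK Gfin).
set v := fine (lam O); set g := fine _.
under [in X in _ -> _ -> X -> _]eq_bigr do rewrite -EFinM.
rewrite !lte_fin sumEFin -EFinD lee_fin -mulr_suml => v0 g0 le.
by rewrite -(ltr_pM2r v0) mul1r; lra.
Qed.

Lemma attractor_null : lam F = 0%E.
Proof.
have Ffin : lam F \is a fin_num.
  by rewrite ge0_fin_numE ?lebesgue_d_ge0//; exact: lebesgue_d_bounded.
have F0 : 0 <= fine (lam F) by rewrite fine_ge0// lebesgue_d_ge0.
have : (lam F <= \sum_i (r i ^+ d)%:E * lam F)%E.
  apply: (@le_trans _ _ (\sum_i lam (Phi i @` F))%E); last first.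
    by apply: lee_sum => i _; rewrite (lebesgue_d_similarity ball_pos _ (Phi_similarity i)).
  apply: lebesgue_d_fin_cover => x /F_image[i [y [Fy ->]]].
  by exists i => //; exists y.
rewrite -(fineK Ffin).
under eq_bigr do rewrite -EFinM.
rewrite sumEFin lee_fin -mulr_suml => le; congr EFin; apply/eqP.
rewrite eq_le F0 andbT; have := sum_ratios_lt1; nra.
Qed.

Let lebesgue_dU_null A B : lam B = 0%E -> lam (A `|` B) = lam A.
Proof.
move=> B0; apply/eqP; rewrite eq_le; apply/andP; split.
  by apply: le_trans (lebesgue_dU _ _) _; rewrite B0 adde0.
by apply: le_lebesgue_d => x; left.
Qed.

(** Inside [O], the parallel set of [F] is the inner tube of the tiling up to the
    null set [F]; outside, it is the parallel set of [K], because the boundary of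
    [K] is contained in [F]. *)
Lemma parallel_volumeE e : 0 <= e ->
  lam (parallel_set F e) = (tube_volume e + (lam (parallel_set K e) - lam K))%E.
Proof.
move=> e0; rewrite (lebesgue_d_split (parallel_set F e) oO); congr (_ + _)%E.
  rewrite /tube_volume -[RHS](lebesgue_dU_null _ (_ : lam (F `&` O) = 0)%E); last first.
    apply/eqP; rewrite eq_le lebesgue_d_ge0 andbT -attractor_null.
    by apply: le_lebesgue_d => x [].
  congr lam; apply/seteqP; split => [x [xe Ox]|x [[[Ox _] xe]|[Fx Ox]]]; last 2 first.
  - by [].
  - by split => //; exact: sub_parallel_set.
  by have [Fx|nFx] := pselect (F x); [right|left].
have Kfin : lam K \is a fin_num.
  by rewrite ge0_fin_numE ?lebesgue_d_ge0//; exact: lebesgue_d_bounded.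
have oKC : open (~` K) by rewrite openC; exact: closed_closure.
rewrite (lebesgue_d_split (parallel_set K e) oKC) [parallel_set K e `\` _]setDE setCK.
rewrite (setIidr (@sub_parallel_set _ _ K _ e0)) addeK//.
rewrite (_ : parallel_set F e `\` O =
    (parallel_set K e `&` ~` K) `|` (parallel_set F e `&` (K `\` O))).
  apply: lebesgue_dU_null; apply/eqP; rewrite eq_le lebesgue_d_ge0 andbT -attractor_null.
  by apply: le_lebesgue_d => x [_ [Kx nOx]]; exact: bdF.
apply/seteqP; split => [x [xe nOx]|x [[xe nKx]|[xe [Kx nOx]]]]; last 2 first.
- have nOx : ~ O x by move=> Ox; apply: nKx; exact: subset_closure.
  split => //; apply: parallel_set_sub xe => y Ky.
  have [Oy|nOy] := pselect (O y); last by exists y => //; exact: bdF.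
  have [z [Kz nOz _ xz]] := segment_meets_boundary oO Oy nOx.
  by exists z; [exact: bdF|rewrite (enormB x y)].
- by [].
have [Kx|nKx] := pselect (K x); first by right.
left; split => //; apply: parallel_set_sub xe => y Fy; exists y => //.
exact: attractor_sub_closure.
Qed.

(** A point within [e] of [F] is within [e] of one of the finitely many pieces
    [Phi i @` F]: otherwise its distances to all of them exceed [e] by a margin. *)
Lemma parallel_volume_le_renewal e :
  (lam (parallel_set F e) <= \sum_i (r i ^+ d)%:E * lam (parallel_set F (e / r i)))%E.
Proof.
apply: (@le_trans _ _ (\sum_i lam (Phi i @` parallel_set F (e / r i)))%E); last first.
  by apply: lee_sum => i _; rewrite (lebesgue_d_similarity ball_pos _ (Phi_similarity i)).
apply: lebesgue_d_fin_cover => x /parallel_setP xe; apply: contrapT => nx.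
have /choice[e' He'] i : exists e', e < e' /\ forall y, F y -> e' <= enorm (x - Phi i y).
  have [y yE] := similarity_surj (Phi_similarity i) x.
  apply: contrapT => ne; apply: nx; exists i => //; exists y => //.
  apply/parallel_setP => e'; have [r0 PhiE] := Phi_similarity i.
  rewrite ltr_pdivrMr// => ee'; apply: contrapT => nz; apply: ne; exists (e' * r i).
  split => // z Fz; rewrite leNgt; apply/negP => lt; apply: nz; exists z => //.
  by move: lt; rewrite -yE PhiE mulrC ltr_pM2r.
have [|y /F_image[i [z [Fz ->]]]] := xe (\big[Num.min/(e + 1)]_i e' i).
  by apply: lt_bigmin => [|i _]; [rewrite ltrDl|have [] := He' i].
apply/negP; rewrite -leNgt; apply: le_trans (_ : e' i <= _); first exact: bigmin_le.
by have [_] := He' i; exact.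
Qed.

Lemma tube_volume_homo e e' : e <= e' -> (tube_volume e <= tube_volume e')%E.
Proof.
by move=> ee'; apply: le_lebesgue_d => x [Tx xe]; split => //; exact: parallel_set_mono xe.
Qed.

Lemma generator_tube_volume_homo e e' :
  e <= e' -> (generator_tube_volume e <= generator_tube_volume e')%E.
Proof.
by move=> ee'; apply: le_lebesgue_d => x [Tx xe]; split => //; exact: parallel_set_mono xe.
Qed.

Lemma tube_volume_le e : (tube_volume e <= lam O)%E.
Proof. by apply: le_lebesgue_d => x [[]]. Qed.

Lemma outer_volume_ge0 e : 0 <= e -> (0 <= lam (parallel_set K e) - lam K)%E.
Proof.
move=> e0; rewrite sube_ge0.
  by apply: le_lebesgue_d; exact: sub_parallel_set.
apply/orP; left; rewrite ge0_fin_numE ?lebesgue_d_ge0//.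
exact: lebesgue_d_bounded.
Qed.

End Tiling.

Section Inradius.
Context {R : realType} {n : nat}.
Local Notation d := n.+1.
Implicit Types (x y z : 'rV[R]_d) (G : set 'rV[R]_d).

Let inradius_has_sup G : open G -> G !=set0 -> ebounded G ->
  has_sup [set rho : R | 0 < rho /\ exists x, eball x rho `<=` G].
Proof.
move=> oG [x Gx] [M GM]; split.
  by have [e e0 eG] := (openP_eball G).1 oG _ Gx; exists e; split => //; exists x.
exists (M + M + M + 1) => rho [rho0 [y yG]].
rewrite leNgt; apply/negP => lt.
have Gy : G y by apply: yG; rewrite /eball/= subrr enorm0.
have M0 : 0 <= M by apply: le_trans (GM _ Gy); exact: enorm_ge0.
pose u : 'rV[R]_d := (M + M + 1) *: delta_mx 0 ord0.
have un : enorm u = M + M + 1.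
  rewrite enormZ ger0_norm; last by lra.
  rewrite (_ : enorm _ = 1) ?mulr1//.
  rewrite /enorm (bigD1 ord0)//= big1 => [|i i0]; rewrite !mxE ?eqxx ?addr0 ?expr1n ?sqrtr1//.
  by rewrite (negbTE i0) expr0n.
have /yG/GM : eball y rho (y + u) by rewrite /eball/= addrC addKr un; lra.
have := GM _ Gy; have := enormB (y + u) y.
have := enorm_triangle 0 (y + u) y; rewrite addrC addKr un subr0 sub0r enormN; lra.
Qed.

Lemma inradius_gt0 G : open G -> G !=set0 -> ebounded G -> 0 < inradius G.
Proof.
move=> oG G0 bG; have hs := inradius_has_sup oG G0 bG.
have [[rho Hrho] _] := hs; have [rho0 _] := Hrho.
by apply: lt_le_trans rho0 _; apply: ub_le_sup => //; case: hs.
Qed.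

(** No point of [G] is further from the complement than the inradius, so that
    the inner tube of that width is all of [G]. *)
Lemma inner_tube_inradius G (e : R) : open G -> G !=set0 -> ebounded G ->
  inradius G <= e -> inner_tube_volume G e = lebesgue_d G.
Proof.
move=> oG G0 bG ge; congr lebesgue_d; apply/seteqP; split => [x []//|x Gx].
split => //; apply/parallel_setP => e' ee'; apply: contrapT => ny.
have : e' <= inradius G.
  apply: ub_le_sup; first by case: (inradius_has_sup oG G0 bG).
  split; first by apply: lt_trans ee'; apply: lt_le_trans (inradius_gt0 oG G0 bG) ge.
  exists x => y yx; apply: contrapT => nGy; apply: ny; exists y => //.
  by rewrite enormB.
by rewrite leNgt (le_lt_trans ge).
Qed.

End Inradius.

(** * Integrals against the measure ds/s on the half-line *)
(** This measure is invariant under scaling, so that integration preserves renewal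
    equations, which are convolution equations for it. *)
Section LogIntegral.
Context {R : realType}.
Implicit Types (f g F : R -> R) (a b c k q s t : R).
Local Notation mu := (@lebesgue_measure R).

Definition logint f (A : set R) : \bar R := (\int[mu]_(s in A) (f s / s)%:E)%E.

Definition posmeas f :=
  (forall s, 0 < s -> 0 <= f s) /\ measurable_fun (`]0, +oo[%classic : set R) f.

Lemma FTC_pos F f a b : 0 < a -> a < b ->
  (forall x : R, 0 < x -> is_derive x 1 F (f x)) ->
  (forall x : R, 0 < x -> {for x, continuous f}) ->
  (\int[mu]_(x in `]a, b]) (f x)%:E = (F b - F a)%:E)%E.
Proof.
move=> a0 ab dF cf.
have cF (x : R) : 0 < x -> {for x, continuous F}.
  by move=> x0; apply/differentiable_continuous/derivable1_diffP; have [] := dF x x0.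
have itv0 x : x \in `[a, b] -> 0 < x.
  by rewrite in_itv/= => /andP[ax _]; exact: lt_le_trans ax.
have cab : {within `[a, b], continuous f}.
  by apply: continuous_in_subspaceT => x; rewrite inE => /itv0; exact: cf.
rewrite EFinB -(@continuous_FTC2 _ f F a b ab cab); first last.
- move=> x xab; rewrite derive1E; have x0 : 0 < x.
    by apply: itv0; move: xab; rewrite !in_itv/= => /andP[/ltW-> /ltW->].
  by have [_] := dF x x0.
- split.
  + move=> x xab; have x0 : 0 < x.
      by apply: itv0; move: xab; rewrite !in_itv/= => /andP[/ltW-> /ltW->].
    by have [] := dF x x0.
  + by apply: cvg_at_right_filter; exact: cF.
  + by apply: cvg_at_left_filter; apply: cF; exact: lt_trans ab.
rewrite integral_itv_obnd_cbnd//; apply/measurable_EFinP.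
apply: (@measurable_funS _ _ _ _ `[a, b]) => //.
  by apply: subset_itvr; rewrite bnd_simp.
by apply: subspace_continuous_measurable_fun.
Qed.

Lemma continuous_powR_pos q x : 0 < x -> {for x, continuous (fun s : R => s `^ q)}.
Proof.
move=> x0; apply/differentiable_continuous/derivable1_diffP.
by have [] := is_derive1_powR q x0.
Qed.

Lemma powR_div q s : 0 < s -> s `^ q / s = s `^ (q - 1).
Proof.
move=> s0; have h : (q == 1) ==> (s != 0) by rewrite (gt_eqF s0) implybT.
by rewrite (powRB h) (powRr1 (ltW s0)).
Qed.

Lemma powRN_cvg0 c : 0 < c -> s `^ (- c) @[s --> +oo] --> (0 : R).
Proof.
move=> c0; apply/cvgr0Pnorm_lt => e e0; near=> s.
have s0 : 0 < s by near: s; exact: nbhs_pinfty_gt.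
rewrite powRN ger0_norm ?invr_ge0 ?powR_ge0// invf_plt ?posrE ?powR_gt0//.
have -> : e^-1 = (e^-1 `^ c^-1) `^ c.
  by rewrite -powRrM mulVf ?gt_eqF// powRr1// invr_ge0 ltW.
by apply: gt0_ltr_powR => //; rewrite ?nnegrE ?powR_ge0 ?(ltW s0)//.
Unshelve. all: by end_near. Qed.

Lemma itvcc_pos a x : 0 <= a -> x \in `]a, +oo[ -> 0 < x.
Proof. by rewrite in_itv/= andbT; exact: le_lt_trans. Qed.

Lemma posmeas_log f (A : set R) : measurable A -> A `<=` [set x | 0 < x] ->
  posmeas f -> measurable_fun A (fun s : R => (f s / s)%:E).
Proof.
move=> mA A0 [_ mf]; apply/measurable_EFinP; apply: measurable_funM.
  by apply: measurable_funS mf => // x /A0; rewrite /= in_itv/= andbT.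
apply: (@measurable_funS _ _ _ _ (`]0, +oo[%classic : set R)) => //.
  by move=> x /A0; rewrite /= in_itv/= andbT.
apply: open_continuous_measurable_fun => // x; rewrite inE/= in_itv/= andbT => x0.
by apply: inv_continuous; rewrite gt_eqF.
Qed.

Let posmeas_log_ge0 f (A : set R) s : A `<=` [set x | 0 < x] ->
  posmeas f -> A s -> (0 <= (f s / s)%:E)%E.
Proof. by move=> A0 [f0 _] /A0 /= s0; rewrite lee_fin divr_ge0 ?f0// ltW. Qed.

Lemma ray_pos a : 0 <= a -> (`]a, +oo[%classic : set R) `<=` [set x | 0 < x].
Proof. by move=> a0 x; rewrite /= in_itv/= andbT; exact: le_lt_trans. Qed.

Lemma itv_pos a b : 0 <= a -> (`]a, b]%classic : set R) `<=` [set x | 0 < x].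
Proof. by move=> a0 x; rewrite /= in_itv/= => /andP[+ _]; exact: le_lt_trans. Qed.

Lemma logint_ge0 f (A : set R) : A `<=` [set x | 0 < x] -> posmeas f ->
  (0 <= logint f A)%E.
Proof. by move=> A0 pf; apply: integral_ge0 => s; exact: posmeas_log_ge0. Qed.

Lemma le_logint f g (A : set R) : measurable A -> A `<=` [set x | 0 < x] ->
  posmeas f -> posmeas g -> (forall s, A s -> f s <= g s) ->
  (logint f A <= logint g A)%E.
Proof.
move=> mA A0 pf pg fg; apply: ge0_le_integral => //.
- by move=> s; exact: posmeas_log_ge0.
- exact: posmeas_log.
- exact: posmeas_log.
- by move=> s As; rewrite lee_fin ler_wpM2r ?fg// invr_ge0 ltW//; exact: A0.
Qed.

Lemma logint_split_itv f a b (i : itv_bound R) : 0 <= a -> a <= b -> (BRight b <= i)%O ->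
  posmeas f -> logint f [set` Interval (BRight a) i] =
               (logint f `]a, b] + logint f [set` Interval (BRight b) i])%E.
Proof.
move=> a0 ab bi pf.
have -> : [set` Interval (BRight a) i] = `]a, b] `|` [set` Interval (BRight b) i].
  by rewrite -itv_bndbnd_setU// bnd_simp.
have sub : (`]a, b] `|` [set` Interval (BRight b) i] : set R) `<=` [set x | 0 < x].
  move=> x [|]; first exact: itv_pos.
  by rewrite /= itv_boundlr => /andP[+ _]; rewrite bnd_simp; apply: le_lt_trans; exact: le_trans ab.
apply: ge0_integral_setU => //.
- by apply: posmeas_log => //; exact: measurableU.
- by move=> s; exact: posmeas_log_ge0.
apply/eqP/seteqP; split => x //= []; rewrite in_itv/= itv_boundlr bnd_simp => /andP[_ xb].
by rewrite ltNge xb.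
Qed.

Lemma logint_split f a b : 0 <= a -> a <= b -> posmeas f ->
  logint f `]a, +oo[ = (logint f `]a, b] + logint f `]b, +oo[)%E.
Proof. by move=> a0 ab pf; exact: logint_split_itv. Qed.

Lemma logintD f g (A : set R) : measurable A -> A `<=` [set x | 0 < x] ->
  posmeas f -> posmeas g ->
  logint (fun s => f s + g s) A = (logint f A + logint g A)%E.
Proof.
move=> mA A0 pf pg; rewrite /logint -ge0_integralD//; first last.
- exact: posmeas_log.
- by move=> s; exact: posmeas_log_ge0.
- exact: posmeas_log.
- by move=> s; exact: posmeas_log_ge0.
by apply: eq_integral => s _; rewrite mulrDl EFinD.
Qed.

Lemma logintZ f k (A : set R) : measurable A -> A `<=` [set x | 0 < x] ->
  0 <= k -> posmeas f -> logint (fun s => k * f s) A = (k%:E * logint f A)%E.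
Proof.
move=> mA A0 k0 pf; rewrite /logint -ge0_integralZl_EFin//; first last.
- exact: posmeas_log.
- by move=> s; exact: posmeas_log_ge0.
by apply: eq_integral => s _; rewrite -mulrA EFinM.
Qed.

Lemma posmeasD f g : posmeas f -> posmeas g -> posmeas (fun s => f s + g s).
Proof.
move=> [f0 mf] [g0 mg]; split => [s s0|]; first by rewrite addr_ge0 ?f0 ?g0.
exact: measurable_funD.
Qed.

Lemma posmeasZ f k : 0 <= k -> posmeas f -> posmeas (fun s => k * f s).
Proof.
move=> k0 [f0 mf]; split => [s s0|]; first by rewrite mulr_ge0 ?f0.
exact: measurable_funM.
Qed.

Lemma posmeasM f g : posmeas f -> posmeas g -> posmeas (fun s => f s * g s).
Proof.
move=> [f0 mf] [g0 mg]; split => [s s0|]; first by rewrite mulr_ge0 ?f0 ?g0.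
exact: measurable_funM.
Qed.

Lemma posmeas_powR q : posmeas (fun s => s `^ q).
Proof.
split => [s _|]; first exact: powR_ge0.
exact: measurable_funS (measurable_powR q).
Qed.

Lemma posmeas_cst k : 0 <= k -> posmeas (fun=> k).
Proof. by move=> k0; split => //; exact: measurable_cst. Qed.

Lemma posmeas_homo f : (forall s, 0 < s -> 0 <= f s) ->
  (forall s t, 0 < s -> s <= t -> f s <= f t) -> posmeas f.
Proof.
move=> f0 fh; split => //.
apply: (@eq_measurable_fun _ _ _ _ _ (fun s => if s <= 0 then 0 else f s)).
  by move=> s; rewrite inE/= in_itv/= andbT ltNge => /negbTE->.
apply: nondecreasing_measurable => // s t st.
case: (leP s 0) => s0; case: (leP t 0) => t0 //; first exact: f0.
- by move: (lt_le_trans s0 st); rewrite ltNge t0.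
- exact: fh.
Qed.

(** Dilating the argument turns Lebesgue measure into a multiple of itself. *)
Lemma logint_scale f k a : 0 < k -> 0 < a -> posmeas f ->
  logint (fun s => f (s / k)) `]a, +oo[ = logint f `]a / k, +oo[.
Proof.
move=> k0 a0 pf.
have kV : 0 <= k^-1 by rewrite invr_ge0 ltW.
pose phi (s : measurableTypeR R) : measurableTypeR R := s / k.
have mphi : measurable_fun setT phi by exact: measurable_funM.
have mphia : measurable_fun (`]a, +oo[%classic : set R) phi by exact: measurable_funS mphi.
pose nu0 := mscale (NngNum kV) (pushforward mu phi).
pose nu := nu0 mphi.
have ak : 0 < a / k by exact: divr_gt0.
have preimE (i : itv_bound R) b : phi @^-1` [set` Interval (BRight b) i] =
    [set` Interval (BRight (b * k)) (match i with BSide x y => BSide x (y * k) | BInfty x => BInfty _ x end)].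
  apply/seteqP; split => s; rewrite /= /phi !itv_boundlr/=.
    by rewrite !bnd_simp ltr_pdivlMr//; case: i => [[] y|[]]; rewrite ?bnd_simp//
      ?ltr_pdivrMr ?ler_pdivrMr.
  by rewrite !bnd_simp ltr_pdivlMr//; case: i => [[] y|[]]; rewrite ?bnd_simp//
    ?ltr_pdivrMr ?ler_pdivrMr.
have nuE X : measurable X -> mu X = nu X.
  apply: lebesgue_measure_unique => _ [[x y] _ <-].
  rewrite /nu/nu0/= /mscale/= /pushforward preimE/=.
  rewrite !lebesgue_measure_itv/= !lte_fin ltr_pM2r//.
  case: ifPn => xy; last by rewrite mule0.
  by rewrite -!EFinB -EFinM -mulrBl mulrCA mulVf ?mulr1// gt_eqF.
have mf : measurable_fun (`]a / k, +oo[%classic : set R) (fun s => (f s / s)%:E).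
  by apply: posmeas_log => //; apply: ray_pos; exact: ltW.
rewrite /logint [RHS](eq_measure_integral (nu0 mphi)); last by move=> A mA _; exact: nuE.
rewrite ge0_integral_mscale//; last first.
  by move=> s; apply: posmeas_log_ge0 => //; apply: ray_pos; exact: ltW.
rewrite ge0_integral_pushforward//; last first.
  by move=> s; rewrite inE; apply: posmeas_log_ge0 => //; apply: ray_pos; exact: ltW.
have phiray s : (`]a, +oo[%classic : set R) s -> (`]a / k, +oo[%classic : set R) (phi s).
  by rewrite /= !in_itv/= !andbT /phi ltr_pM2r ?invr_gt0.
rewrite preimE divfK ?gt_eqF//= -ge0_integralZl_EFin//; first last.
- apply: measurable_comp mf _ => //.
  by move=> _ [s sa <-]; exact: phiray.
- move=> s /phiray; apply: posmeas_log_ge0 => //; apply: ray_pos; exact: ltW.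
apply: eq_integral => s; rewrite inE/= => /(itvcc_pos (ltW a0)) s0.
rewrite -EFinM /phi; congr EFin; field.
by rewrite !gt_eqF.
Qed.

Lemma logint_cst k a b : 0 < a -> a <= b ->
  logint (fun=> k) `]a, b] = (k * (ln b - ln a))%:E.
Proof.
move=> a0; rewrite le_eqVlt => /predU1P[<-|ab].
  by rewrite subrr mulr0 set_itvoc0 /logint integral_set0.
pose F s : R := k * ln s.
rewrite (_ : _ * _ = F b - F a); last by rewrite /F mulrBr.
have dF (x : R) : 0 < x -> is_derive x 1 F (k * x^-1).
  by move=> x0; have := is_derive1_ln x0 => dx; exact: is_deriveZ.
rewrite -(FTC_pos a0 ab dF)// => x x0; apply: continuousM; first exact: cvg_cst.
by apply: inv_continuous; rewrite gt_eqF.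
Qed.

Lemma logint_powR_ray c a : 0 < a -> 0 < c ->
  logint (fun s => s `^ (- c)) `]a, +oo[ = (a `^ (- c) / c)%:E.
Proof.
move=> a0 c0.
pose F s : R := - c^-1 * s `^ (- c).
have dF (x : R) : 0 < x -> is_derive x 1 F (x `^ (- c - 1)).
  move=> x0; rewrite (_ : _ `^ _ = - c^-1 * (- c * x `^ (- c - 1))).
    by have := is_derive1_powR (- c) x0 => dx; exact: is_deriveZ.
  by rewrite mulrA mulrNN mulVf ?mul1r// gt_eqF.
have cf (x : R) : 0 < x -> {for x, continuous (fun s : R => s `^ (- c - 1))}.
  exact: continuous_powR_pos.
have -> : (a `^ (- c) / c)%:E = (0%:E - (F a)%:E)%E.
  by rewrite -EFinB /F sub0r mulNr opprK mulrC.
rewrite -(@ge0_continuous_FTC2y _ (fun s => s `^ (- c - 1)) F).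
- rewrite /logint integral_itv_obnd_cbnd; last first.
    apply: (posmeas_log _ _ (posmeas_powR _)) => //; apply: ray_pos; exact: ltW.
  apply: eq_integral => s; rewrite inE/= in_itv/= andbT => sa.
  have s0 := lt_le_trans a0 sa.
  by rewrite powR_div.
- by move=> x _; exact: powR_ge0.
- apply: continuous_in_subspaceT => x; rewrite inE/= in_itv/= andbT => ax.
  by apply: cf; exact: lt_le_trans ax.
- rewrite -[X in _ --> X](mulr0 (- c^-1)); apply: cvgMr; exact: powRN_cvg0.
- by move=> x ax; have [] := dF x (lt_trans a0 ax).
- apply: cvg_at_right_filter; apply/differentiable_continuous/derivable1_diffP.
  by have [] := dF a a0.
- move=> x; rewrite in_itv/= andbT derive1E => ax.
  by have [_] := dF x (lt_trans a0 ax).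
Qed.

End LogIntegral.

Lemma posmeas_dil {R : realType} (f : R -> R) (k : R) : 0 < k -> posmeas f ->
  posmeas (fun s => f (s / k)).
Proof.
move=> k0 [f0 mf]; split => [s s0|]; first by apply: f0; exact: divr_gt0.
have mphi : measurable_fun (`]0, +oo[%classic : set R) (fun s => s / k).
  exact: measurable_funM.
apply: measurable_comp mf _ => //.
move=> _ [s s0 <-]; move: s0; rewrite /= !in_itv/= !andbT => s0.
exact: divr_gt0.
Qed.

Lemma logint_sum {R : realType} (I : Type) (l : seq I) (f : I -> R -> R) (A : set R) :
  measurable A -> A `<=` [set x | 0 < x] -> (forall i, posmeas (f i)) ->
  posmeas (fun s => \sum_(i <- l) f i s) /\
  logint (fun s => \sum_(i <- l) f i s) A = (\sum_(i <- l) logint (f i) A)%E.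
Proof.
move=> mA A0 pf; elim: l => [|i l [ihp ih]].
  split; first by under eq_fun do rewrite big_nil; exact: posmeas_cst.
  rewrite big_nil /logint; under eq_integral do rewrite big_nil mul0r.
  exact: integral0.
split; first by under eq_fun do rewrite big_cons; exact: posmeasD.
rewrite big_cons -ih -logintD//; congr logint.
by apply/funext => s; rewrite big_cons.
Qed.

Lemma right_lim_le {R : realType} (f : R -> R) (z : R) : {for 0, continuous f} ->
  (forall t, 0 < t -> f t <= z) -> f 0 <= z.
Proof.
move=> cf fz; rewrite leNgt; apply/negP => zf.
have /cvgr_gt/(_ _ zf) : f @ (0 : R) --> f 0 by exact: cf.
move=> /nbhs_ballP[e /= e0 /(_ (e / 2))]; rewrite /ball/= sub0r normrN.
have e20 : 0 < e / 2 by rewrite divr_gt0.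
rewrite gtr0_norm// ltr_pdivrMr// ltr_pMr// ltr1n => /(_ isT).
by rewrite ltNge fz.
Qed.

Lemma cvg_at_right0 {R : realType} (T : Type) (X : set_system T) {FX : Filter X}
    (u : T -> R) :
  (\forall x \near X, 0 < u x) -> u @ X --> (0 : R) -> u @ X --> (0 : R)^'+.
Proof.
move=> u0 uc A [e /= e0 eA]; have /cvgrPdist_lt/(_ e e0) := uc.
by apply: filterS2 u0 => x ux /= ue; exact: eA.
Qed.

Lemma unit_sum_index {R : realType} {N : nat} (p : 'I_N -> R) :
  \sum_i p i = 1 -> exists i : 'I_N, true.
Proof.
move=> p_sum; have [N0|N0] := posnP N; last by exists (Ordinal N0).
have := p_sum; rewrite big1 => [/esym/eqP|i _]; first by rewrite oner_eq0.
by have := ltn_ord i; rewrite {2}N0.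
Qed.

(** * Renewal theory *)
Section Renewal.
Context {R : realType} {N : nat}.
Variables (p r : 'I_N -> R).
Hypothesis r_itv : forall i, 0 < r i < 1.
Hypothesis p_gt0 : forall i, 0 < p i.
Hypothesis p_sum : \sum_i p i = 1.

Let r_gt0 i : 0 < r i. Proof. by have /andP[] := r_itv i. Qed.

Let ratio_bounds : exists a b, [/\ 0 < a, 0 < b < 1 & forall i, a <= r i <= b].
Proof.
exists (\big[Num.min/2^-1]_i r i), (\big[Num.max/2^-1]_i r i); split.
- by apply/lt_bigmin => //; rewrite invr_gt0.
- apply/andP; split.
    by apply: lt_le_trans (bigmax_ge_id _ _ _ _); rewrite invr_gt0.
  apply/bigmax_ltP; split => [|i _]; last by have /andP[] := r_itv i.
  by rewrite invf_lt1// ltr1n.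
- by move=> i; rewrite bigmin_le// le_bigmax.
Qed.

(** A function dominated by its own average over the larger scales [e / r i] is
    bounded near [0] by a bound valid on a single period. *)
Lemma renewal_maximum_principle (e0 : R) : 0 < e0 -> exists2 e1, e0 < e1 &
  forall (u : R -> R) C,
  (forall e, 0 < e <= e0 -> u e <= \sum_i p i * u (e / r i)) ->
  (forall e, e0 < e <= e1 -> u e <= C) ->
  forall e, 0 < e <= e1 -> u e <= C.
Proof.
move=> e00; have [a [b [a0 /andP[b0 b1] rab]]] := ratio_bounds.
have [i _] := unit_sum_index p_sum; have /andP[ai ib] := rab i.
have a1 : a < 1 by rewrite (le_lt_trans ai)// (le_lt_trans ib).
exists (e0 / a); first by rewrite ltr_pdivlMr// gtr_pMr.
move=> u C ur uC.
(* Each step extends the bound downwards by the factor [b]. *)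
suff H k e : e0 * b ^+ k < e -> e <= e0 / a -> u e <= C.
  move=> e /andP[epos e1].
  have [k Hk] : exists k, e0 * b ^+ k < e.
    have cv : (fun k => e0 * b ^+ k) @ \oo --> e0 * 0.
      by apply: cvgMr; apply: cvg_expr; rewrite gtr0_norm.
    rewrite mulr0 in cv.
    have /cvgr_lt/(_ _ epos)[k _ /(_ k (leqnn k)) Hk] := cv.
    by exists k.
  exact: H Hk e1.
elim: k e => [|k ih] e; first by rewrite expr0 mulr1 => *; apply: uC; apply/andP.
move=> lo hi; have [ee0|ee0] := leP e e0; last by apply: uC; apply/andP.
have epos : 0 < e by apply: le_lt_trans lo; rewrite mulr_ge0 ?(ltW e00)// exprn_ge0// ltW.
apply: le_trans (ur _ _) _; first by rewrite epos.
rewrite -[C]mul1r -p_sum mulr_suml; apply: ler_sum => j _.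
rewrite ler_pM2l//; have /andP[aj jb] := rab j; apply: ih.
  rewrite ltr_pdivlMr//; apply: le_lt_trans lo; rewrite exprSr mulrA.
  by rewrite ler_wpM2l// mulr_ge0 ?(ltW e00)// exprn_ge0// ltW.
by rewrite ler_pM ?invr_ge0 ?(ltW epos) ?(ltW (r_gt0 j))// lef_pV2// posrE.
Qed.

Let t i := - ln (r i).
Let t_gt0 i : 0 < t i. Proof. by rewrite oppr_gt0 ln_lt0. Qed.
Let rE i : r i = expR (- t i). Proof. by rewrite opprK lnK// posrE. Qed.

Definition mean_log := \sum_i p i * - ln (r i).

Lemma mean_log_gt0 : 0 < mean_log.
Proof.
have [i _] := unit_sum_index p_sum; rewrite /mean_log (bigD1 i)//=.
apply: ltr_pwDl; first by rewrite mulr_gt0// t_gt0.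
by apply: sumr_ge0 => j _; rewrite mulr_ge0 ?(ltW (p_gt0 j))// ltW// t_gt0.
Qed.

Let T (w : seq 'I_N) := \sum_(i <- w) t i.

Let T_cat w w' : T (w ++ w') = T w + T w'.
Proof. by rewrite /T big_cat. Qed.

Let T_rep m w : T (flatten (nseq m w)) = m%:R * T w.
Proof.
elim: m => [|m ih] /=; first by rewrite /T big_nil mul0r.
by rewrite T_cat ih -natr1 mulrDl mul1r addrC.
Qed.

Let T_seq1 i : T [:: i] = t i. Proof. by rewrite /T big_seq1. Qed.

Definition nonarithmetic := ~ exists (h : R) (k : 'I_N -> nat), 0 < h /\
  forall i, (0 < k i)%N /\ - ln (r i) = (k i)%:R * h.

(** A subgroup of the reals without arbitrarily small positive elements is
    generated by its least positive element. *)
Let small_difference : nonarithmetic -> forall eta, 0 < eta ->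
  exists w1 w2, 0 < T w1 - T w2 < eta.
Proof.
move=> nl eta eta0; apply: contrapT => no; apply: nl.
pose H := [set x : R | exists w1 w2, x = T w1 - T w2].
have HB x y : H x -> H y -> H (x - y).
  move=> [w1 [w2 ->]] [w3 [w4 ->]]; exists (w1 ++ w4), (w2 ++ w3).
  by rewrite !T_cat; ring.
have HM m x : H x -> H (m%:R * x).
  move=> [w1 [w2 ->]]; exists (flatten (nseq m w1)), (flatten (nseq m w2)).
  by rewrite !T_rep mulrBr.
have Ht i : H (t i) by exists [:: i], [::]; rewrite T_seq1 /T big_nil subr0.
pose P := [set x : R | H x /\ 0 < x].
have Peta x : P x -> eta <= x.
  move=> [[w1 [w2 ->]] x0]; rewrite leNgt; apply/negP => lt; apply: no.
  by exists w1, w2; rewrite x0.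
have Plb : has_inf P.
  split; last by exists eta => x /Peta.
  by have [i _] := unit_sum_index p_sum; exists (t i); split.
pose h := inf P.
have etah : eta <= h by apply: lb_le_inf; [case: Plb|move=> x /Peta].
have hle x : P x -> h <= x by move=> Px; apply: ge_inf => //; case: Plb.
have Ph : P h.
  have [y Py yh] := inf_adherent eta0 Plb.
  have : h <= y by exact: hle.
  rewrite le_eqVlt => /predU1P[->//|hy].
  have yh0 : 0 < y - h by rewrite subr_gt0.
  have [z Pz zy] := inf_adherent yh0 Plb; rewrite -/h addrC subrK in zy.
  have : P (y - z) by split; [apply: HB; [case: Py|case: Pz]|rewrite subr_gt0].
  move=> /Peta; have := hle _ Pz; rewrite -/h in yh; lra.
have h0 : 0 < h by case: Ph.
exists h, (fun i => Num.truncn (t i / h)); split => // i.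
have /andP[k1 k2] : (Num.truncn (t i / h))%:R <= t i / h < (Num.truncn (t i / h)).+1%:R.
  by apply: truncn_itv; rewrite divr_ge0// ltW.
set k := Num.truncn _ in k1 k2 *.
have e : t i = k%:R * h.
  apply/eqP; rewrite eq_le; apply/andP; split; last by rewrite -ler_pdivlMr.
  rewrite -subr_le0 leNgt; apply/negP => lt.
  have : P (t i - k%:R * h) by split => //; apply: HB => //; apply: HM; case: Ph.
  move=> /hle; move: k2; rewrite -natr1 ltr_pdivrMr// mulrDl mul1r; lra.
split; last exact: e.
by rewrite lt0n; apply/eqP => k0; have := t_gt0 i; rewrite e k0 mul0r ltxx.
Qed.

(** If the sums over two words differ by a small [x > 0], the sums over [m] of these
    words form an arithmetic progression of step [x], which for large [m] reaches
    the progression for [m + 1]. *)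
Let words_dense : nonarithmetic -> forall eta, 0 < eta ->
  exists M, forall x, M <= x -> exists w, x - eta < T w <= x.
Proof.
move=> nl eta eta0; have [w1 [w2 /andP[+ +]]] := small_difference nl eta0.
have [i _] := unit_sum_index p_sum.
set x := T w1 - T w2 => x0 xeta.
pose a := T (i :: w2); pose w1' := i :: w1.
have aE : T w1' = a + x.
  by rewrite /a /w1' -cat1s T_cat -(cat1s i w2) T_cat /x; ring.
have a0 : 0 < a.
  rewrite /a -cat1s T_cat T_seq1 ltr_pwDl//.
  by apply: sumr_ge0 => j _; exact: ltW.
pose m0 := (Num.truncn (a / x)).+1.
have am0 : a / x < m0%:R.
  by have /truncn_itv/andP[] : 0 <= a / x by rewrite divr_ge0// ltW.
exists (m0%:R * a) => y ym.
have y0 : 0 <= y by apply: le_trans ym; rewrite mulr_ge0// ltW.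
have /truncn_itv/andP[m1 m2] : 0 <= y / a by rewrite divr_ge0// ltW.
set m := Num.truncn _ in m1 m2; rewrite ler_pdivlMr// in m1.
rewrite ltr_pdivrMr// -natr1 mulrDl mul1r in m2.
have /truncn_itv/andP[j1 j2] : 0 <= (y - m%:R * a) / x.
  by rewrite divr_ge0 ?(ltW x0)// subr_ge0.
set j := Num.truncn _ in j1 j2; rewrite ler_pdivlMr// in j1.
rewrite ltr_pdivrMr// -natr1 mulrDl mul1r in j2.
have m0m : (m0 <= m)%N.
  rewrite -ltnS -(ltr_nat R) -(ltr_pM2r a0) -natr1 mulrDl mul1r.
  by apply: le_lt_trans ym _.
have jm : (j <= m)%N.
  apply: leq_trans m0m; rewrite ltnW// -(ltr_nat R); apply: le_lt_trans am0.
  by rewrite ler_pdivlMr//; lra.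
exists (flatten (nseq (m - j) (i :: w2)) ++ flatten (nseq j w1')).
rewrite T_cat !T_rep -/a aE natrB//.
have -> : (m%:R - j%:R) * a + j%:R * (a + x) = m%:R * a + j%:R * x by ring.
by apply/andP; split; lra.
Qed.

(** The limit superior of an asymptotically averaged function is also its limit
    along all the translates, by words, of a sequence realising it: each term of
    the average is asymptotically at most [L], and so none can stay below. *)
Let extremal_sequence (psi : R -> R) (B : R) :
  (forall e, 0 < e <= 1 -> `|psi e| <= B) ->
  (fun e => psi e - \sum_i p i * psi (e * expR (t i))) @ 0^'+ --> (0 : R) ->
  exists L (u : nat -> R), [/\ forall k, 0 < u k, u @ \oo --> (0 : R),
    forall eta, 0 < eta -> \forall e \near 0^'+, psi e <= L + eta &
    forall w, (fun k => psi (u k * expR (T w))) @ \oo --> L].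
Proof.
move=> psiB psir.
pose S m := [set psi e | e in [set e : R | 0 < e <= m.+1%:R^-1]].
have inv1 m : m.+1%:R^-1 <= 1 :> R by rewrite invf_le1// ler1n.
have supS m : has_sup (S m).
  split; first by exists (psi m.+1%:R^-1); exists m.+1%:R^-1 => //=; rewrite invr_gt0 ltr0n lexx.
  exists B => _ [e /= /andP[e0 e1] <-]; apply: le_trans (ler_norm _) (psiB _ _).
  by rewrite e0 (le_trans e1).
have infS : has_inf (range (fun m => sup (S m))).
  split; first by exists (sup (S 0%N)); exists 0%N.
  exists (- B) => _ [m _ <-].
  apply: (@le_trans _ _ (psi m.+1%:R^-1)).
    have := psiB m.+1%:R^-1; rewrite invr_gt0 ltr0n inv1 => /(_ isT).
    by rewrite ler_norml => /andP[].
  apply: ub_le_sup; first by case: (supS m).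
  by exists m.+1%:R^-1 => //=; rewrite invr_gt0 ltr0n lexx.
pose L := inf (range (fun m => sup (S m))).
have limsup eta : 0 < eta -> \forall e \near 0^'+, psi e <= L + eta.
  move=> eta0; have [_ [m _ <-] lt] := inf_adherent eta0 infS.
  have m0 : 0 < m.+1%:R^-1 :> R by rewrite invr_gt0.
  near=> e; apply: le_trans (ltW lt); apply: ub_le_sup; first by case: (supS m).
  exists e => //=; apply/andP; split; near: e; first exact: nbhs_right_gt.
  exact: nbhs_right_le.
have /choice[u Hu] m : exists e, 0 < e <= m.+1%:R^-1 /\ L - m.+1%:R^-1 < psi e.
  have m0 : 0 < m.+1%:R^-1 :> R by rewrite invr_gt0.
  have [_ [e He <-] lt] := sup_adherent m0 (supS m).
  exists e; split => //; apply: le_lt_trans lt; rewrite lerD2r.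
  by apply: ge_inf; [case: infS|exists m].
have u0 k : 0 < u k by have [/andP[]] := Hu k.
have uc : u @ \oo --> (0 : R).
  apply: (@squeeze_cvgr _ _ _ _ (fun=> 0) (@harmonic R)); last 2 first.
  - exact: cvg_cst.
  - exact: cvg_harmonic.
  by near=> k; have [/andP[/ltW-> ->]] := Hu k.
have toR (v : nat -> R) : (forall k, 0 < v k) -> v @ \oo --> (0 : R) -> v @ \oo --> (0 : R)^'+.
  by move=> v0; apply: cvg_at_right0; exact: nearW.
exists L, u; split => //; elim => [|i w ih].
  rewrite /T big_nil expR0; under eq_fun do rewrite mulr1.
  apply/cvgrPdist_le => eta eta0.
  have upH : \forall k \near \oo, psi (u k) <= L + eta.
    exact: (toR _ u0 uc _ (limsup _ eta0)).
  near=> k.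
  have up : psi (u k) <= L + eta by near: k.
  have lo : L - eta <= psi (u k).
    apply: le_trans (ltW (Hu k).2); rewrite lerD2l lerN2.
    near: k; have /cvgrPdist_le/(_ eta eta0) := @cvg_harmonic R.
    by apply: filterS => k; rewrite sub0r normrN ger0_norm// invr_ge0.
  rewrite ler_norml; lra.
pose v k := u k * expR (T w).
have v0 k : 0 < v k by rewrite mulr_gt0// expR_gt0.
have vc j : (fun k => v k * expR (t j)) @ \oo --> (0 : R)^'+.
  apply: toR => [k|]; first by rewrite mulr_gt0// expR_gt0.
  rewrite -(mul0r (expR (T w) * expR (t j))) /v.
  by under eq_fun do rewrite -mulrA; exact: cvgMl.
have v1 : v @ \oo --> (0 : R)^'+.
  apply: toR => //; rewrite -(mul0r (expR (T w))); exact: cvgMl.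
have -> : (fun k => psi (u k * expR (T (i :: w)))) = (fun k => psi (v k * expR (t i))).
  by apply/funext => k; rewrite -cat1s T_cat T_seq1 addrC expRD mulrA.
apply/cvgrPdist_le => eta eta0.
have pi := p_gt0 i.
pose eta' := p i * eta / 3.
have eta'0 : 0 < eta' by rewrite divr_gt0// mulr_gt0.
have e3 : 3 * eta' = p i * eta by rewrite /eta'; field.
have eta'le : eta' <= eta.
  have : p i <= 1.
    by rewrite -p_sum (bigD1 i)//= lerDl sumr_ge0// => j _; exact: ltW.
  nra.
have HjH : \forall k \near \oo, forall j, psi (v k * expR (t j)) <= L + eta'.
  by apply: filter_forall => j; exact: (vc j _ (limsup _ eta'0)).
near=> k.
have Hj : forall j, psi (v k * expR (t j)) <= L + eta' by near: k.
have lo : L - eta' <= psi (v k).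
  near: k; have /cvgrPdist_le/(_ eta' eta'0) := ih.
  by apply: filterS => k; rewrite ler_norml /v; lra.
have er : psi (v k) - \sum_j p j * psi (v k * expR (t j)) <= eta'.
  near: k; have /cvgrPdist_le/(_ eta' eta'0) near0 := psir.
  have : \forall k \near \oo, `|0 - (psi (v k) - \sum_j p j * psi (v k * expR (t j)))| <= eta'.
    exact: v1 _ near0.
  by apply: filterS => k; rewrite sub0r normrN ler_norml => /andP[].
move: er; rewrite (bigD1 i)//=.
set s := \sum_(j | _) _.
have sle : s <= (1 - p i) * (L + eta').
  have -> : 1 - p i = \sum_(j | j != i) p j by rewrite -p_sum (bigD1 i)//= addrAC subrr add0r.
  by rewrite mulr_suml; apply: ler_sum => j _; rewrite ler_pM2l.
have := Hj i; set y := psi _ => yle er.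
have : p i * (L - eta) <= p i * y.
  rewrite mulrBr -e3; nra.
rewrite ler_pM2l// ler_norml; lra.
Unshelve. all: by end_near. Qed.


(** The weight [s `^ (- c)], [c] being the difference between the dimension of the
    space and that of the set, makes tube volumes bounded and turns their scaling
    relations into renewal equations. *)
Definition weighted (c : R) (f : R -> R) (s : R) : R := s `^ (- c) * f s.

Lemma posmeas_weighted c f : (forall s, 0 < s -> 0 <= f s) ->
  (forall s t, 0 < s -> s <= t -> f s <= f t) -> posmeas (weighted c f).
Proof. by move=> f0 fh; apply: posmeasM; [exact: posmeas_powR|exact: posmeas_homo]. Qed.

Lemma ler_weighted c (f f' : R -> R) s : f s <= f' s -> weighted c f s <= weighted c f' s.
Proof. by move=> ff; rewrite /weighted ler_wpM2l ?powR_ge0. Qed.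

Section TubeFunctions.
Variables (c Lam Z : R) (V v : R -> R).
Hypothesis c_gt0 : 0 < c.
Hypothesis V_ge0 : forall s, 0 < s -> 0 <= V s.
Hypothesis V_homo : forall s s', 0 < s -> s <= s' -> V s <= V s'.
Hypothesis V_le : forall s, 0 < s -> V s <= Lam.
Hypothesis v_ge0 : forall s, 0 < s -> 0 <= v s.
Hypothesis v_homo : forall s s', 0 < s -> s <= s' -> v s <= v s'.

Local Notation phi := (weighted c V).
Local Notation zeta := (weighted c v).

Hypothesis renewal : forall s, 0 < s -> phi s = \sum_i p i * phi (s / r i) + zeta s.
Let Zc e := fine (logint zeta `]e, +oo[).
Hypothesis Zc_cvg : Zc @ 0^'+ --> Z.

Let phi_pos : posmeas phi.
Proof. exact: posmeas_weighted. Qed.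

Let zeta_pos : posmeas zeta.
Proof. exact: posmeas_weighted. Qed.

Let phi_ge0 s : 0 < s -> 0 <= phi s. Proof. by case: phi_pos => H _; exact: H. Qed.

Lemma logint_weighted_fin e : 0 < e -> logint phi `]e, +oo[ \is a fin_num.
Proof.
move=> e0; have e0' := ltW e0; have esub := ray_pos e0'.
have Lam0 : 0 <= Lam by apply: le_trans (V_le e0); exact: V_ge0.
rewrite ge0_fin_numE; last exact: logint_ge0.
apply: (@le_lt_trans _ _ (logint (fun s => Lam * s `^ (- c)) `]e, +oo[)).
  apply: le_logint => //; first by apply: posmeasZ => //; exact: posmeas_powR.
  by move=> s /esub s0; rewrite /weighted mulrC ler_wpM2r ?powR_ge0 ?V_le.
rewrite logintZ//; last exact: posmeas_powR.
by rewrite logint_powR_ray// -EFinM ltry.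
Qed.

(** The tail integral of [phi] satisfies the renewal equation of [phi]
    integrated; its increments have the convergent right-hand side [Zc]. *)
Definition tail_integral e := fine (logint phi `]e, +oo[).
Local Notation I := tail_integral.

Let tail_renewal e : 0 < e -> I e = \sum_i p i * I (e / r i) + Zc e.
Proof.
move=> e0; have esub := ray_pos (ltW e0).
have e0r i : 0 < e / r i by exact: divr_gt0.
have pos_i i : posmeas (fun s => p i * phi (s / r i)).
  by apply: posmeasZ; [exact: ltW|exact: posmeas_dil].
have [pos_s sumE] := logint_sum (index_enum 'I_N) (measurable_itv `]e, +oo[) esub pos_i.
have ren : logint phi `]e, +oo[ = (\sum_i (p i)%:E * logint phi `](e / r i)%R, +oo[
    + logint zeta `]e, +oo[)%E.
  transitivity (logint (fun s => \sum_i p i * phi (s / r i) + zeta s) `]e, +oo[).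
    apply: eq_integral => s; rewrite inE => /esub s0.
    by rewrite -renewal.
  rewrite logintD// sumE; congr (_ + _)%E; apply: eq_bigr => i _.
  rewrite logintZ// ?(ltW (p_gt0 i))//; last exact: posmeas_dil.
  by rewrite logint_scale.
have zfin : logint zeta `]e, +oo[ \is a fin_num.
  rewrite ge0_fin_numE; last exact: logint_ge0.
  apply: le_lt_trans (_ : logint phi `]e, +oo[ < _)%E.
    rewrite ren leeDr// sume_ge0// => i _; rewrite mule_ge0 ?lee_fin ?(ltW (p_gt0 i))//.
    by apply: logint_ge0 => //; apply: ray_pos; exact: ltW.
  by rewrite -ge0_fin_numE ?logint_weighted_fin//; exact: logint_ge0.
rewrite /I ren fineD//; last first.
  by apply/sum_fin_numP => i _ _; rewrite fin_numM// logint_weighted_fin.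
congr (_ + _); rewrite -sum_fine; last by move=> i _; rewrite fin_numM// logint_weighted_fin.
by apply: eq_bigr => i _; rewrite fineM// logint_weighted_fin.
Qed.

Let tail_diff e e' : 0 < e -> e <= e' ->
  logint phi `]e, e'] = (I e - I e')%:E.
Proof.
move=> e0 ee'; have e'0 := lt_le_trans e0 ee'.
have := logint_split (ltW e0) ee' phi_pos.
rewrite -(fineK (logint_weighted_fin e0)) -(fineK (logint_weighted_fin e'0)) EFinB => ->.
by rewrite addeK.
Qed.

Let tail_ge0 e : 0 < e -> 0 <= I e.
Proof. by move=> e0; apply: fine_ge0; apply: logint_ge0 => //; apply: ray_pos; exact: ltW. Qed.

Let tail_homo e e' : 0 < e -> e <= e' -> I e' <= I e.
Proof.
move=> e0 ee'; rewrite -subr_ge0 -lee_fin -tail_diff//.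
by apply: logint_ge0 => //; apply: itv_pos; exact: ltW.
Qed.

Local Notation m := mean_log.

Let ln_div_r e i : 0 < e -> ln (e / r i) = ln e - ln (r i).
Proof. by move=> e0; rewrite ln_div ?posrE. Qed.

(** Elementary renewal theorem: adding or subtracting a slightly different
    multiple of the logarithm turns the tail integral into a function to which
    the maximum principle applies. *)
Lemma tail_integral_asymptotics :
  (fun e => I e / - ln e) @ 0^'+ --> Z / m.
Proof.
have m0 := mean_log_gt0.
have lnr k e : 0 < e -> \sum_i p i * (k * ln (e / r i)) = k * ln e + k * m.
  move=> e0; rewrite /m mulr_sumr -[k * ln e]mul1r -p_sum mulr_suml -big_split/=.
  by apply: eq_bigr => i _; rewrite ln_div_r//; ring.
apply/cvgrPdist_le => eta eta0.
have eta20 : 0 < eta / 2 by rewrite divr_gt0.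
have bound : exists2 C, 0 <= C & \forall e \near 0^'+,
    (Z / m - eta / 2) * - ln e - C <= I e <= C + (Z / m + eta / 2) * - ln e.
  have : \forall e \near 0^'+, `|Z - Zc e| <= m * (eta / 2).
    have me : 0 < m * (eta / 2) by rewrite mulr_gt0.
    by move/cvgrPdist_le : Zc_cvg; exact.
  move=> [d1 /= d10 Hd].
  pose e0 := d1 / 2; have e00 : 0 < e0 by rewrite divr_gt0.
  have ZcZ e : 0 < e <= e0 -> `|Z - Zc e| <= m * (eta / 2).
    move=> /andP[epos ee0]; apply: Hd => //=; rewrite sub0r normrN gtr0_norm//.
    by apply: le_lt_trans ee0 _; rewrite /e0 ltr_pdivrMr// ltr_pMr// ltr1n.
  have [e1 e01 maxp] := renewal_maximum_principle e00.
  pose k1 := Z / m + eta / 2; pose k2 := Z / m - eta / 2.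
  pose B := `|ln e0| + `|ln e1|.
  have lnB e : e0 < e <= e1 -> `|ln e| <= B.
    move=> /andP[lo hi]; have epos := lt_trans e00 lo.
    have l1 : ln e0 <= ln e by rewrite ler_ln ?posrE// ltW.
    have l2 : ln e <= ln e1 by rewrite ler_ln ?posrE// (lt_le_trans epos).
    rewrite /B ler_norml; apply/andP; split.
      have := ler_norm (- ln e0); have := normr_ge0 (ln e1); rewrite normrN; lra.
    have := ler_norm (ln e1); have := normr_ge0 (ln e0); lra.
  pose C := I e0 + (`|k1| + `|k2|) * B.
  have B0 : 0 <= B by rewrite addr_ge0.
  have kB k e : e0 < e <= e1 -> `|k * ln e| <= `|k| * B.
    by move=> H; rewrite normrM ler_wpM2l// lnB.
  have C0 : 0 <= C by rewrite addr_ge0 ?tail_ge0// mulr_ge0// addr_ge0.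
  exists C => //.
  near=> e.
  have epos : 0 < e by near: e; exact: nbhs_right_gt.
  have ee1 : 0 < e <= e1.
    by rewrite epos/=; near: e; apply: nbhs_right_le; exact: lt_trans e01.
  apply/andP; split.
    have := maxp (fun e => k2 * - ln e - I e) C _ _ e ee1.
    rewrite lerBlDr addrC -lerBlDr; apply => [e' e'e0|e' e'e1].
      have /andP[e'pos _] := e'e0.
      rewrite [leRHS](_ : _ = \sum_i p i * (- k2 * ln (e' / r i)) -
          \sum_i p i * I (e' / r i)); last first.
        by rewrite -sumrB; apply: eq_bigr => i _; ring.
      rewrite lnr// (tail_renewal e'pos).
      have := ZcZ _ e'e0; rewrite ler_norml => /andP[_ H].
      have -> : - k2 * m = m * (eta / 2) - Z by rewrite /k2; field; rewrite gt_eqF.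
      lra.
    have /andP[/(lt_trans e00) e'pos _] := e'e1.
    have := tail_ge0 e'pos; have := kB k2 _ e'e1; have := tail_ge0 e00.
    have := mulr_ge0 (normr_ge0 k1) B0.
    by rewrite ler_norml /C; lra.
  have := maxp (fun e => I e - k1 * - ln e) C _ _ e ee1.
  rewrite lerBlDr; apply => [e' e'e0|e' e'e1].
    have /andP[e'pos _] := e'e0.
    rewrite [leRHS](_ : _ = \sum_i p i * I (e' / r i) +
        \sum_i p i * (k1 * ln (e' / r i))); last first.
      by rewrite -big_split; apply: eq_bigr => i _ /=; ring.
    rewrite lnr// (tail_renewal e'pos).
    have := ZcZ _ e'e0; rewrite ler_norml => /andP[H _].
    have -> : k1 * m = m * (eta / 2) + Z by rewrite /k1; field; rewrite gt_eqF.
    lra.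
  have /andP[lo hi] := e'e1; have e'pos := lt_trans e00 lo.
  have := kB k1 _ e'e1; have := tail_homo e00 (ltW lo).
  have := mulr_ge0 (normr_ge0 k2) B0.
  by rewrite ler_norml /C; lra.
have [C C0 HC] := bound.
near=> e.
have epos : 0 < e by near: e; exact: nbhs_right_gt.
have lnpos : 0 < - ln e.
  rewrite oppr_gt0 ln_lt0// epos/=; near: e; exact: nbhs_right_lt.
have Cln : C <= eta / 2 * - ln e.
  rewrite mulrC -ler_pdivrMr// lerNr.
  have -> : - (C / (eta / 2)) = ln (expR (- (C / (eta / 2)))) by rewrite expRK.
  rewrite ler_ln ?posrE ?expR_gt0//; near: e.
  by apply: nbhs_right_le; exact: expR_gt0.
have /andP[lo hi] : (Z / m - eta / 2) * - ln e - C <= I e <= C + (Z / m + eta / 2) * - ln e.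
  by near: e.
rewrite ler_norml; apply/andP; split.
  rewrite lerBrDl -lerBrDr opprK ler_pdivrMr//.
  by apply: le_trans hi _; rewrite [eta in leRHS]splitr; move: Cln; set x := - ln e; lra.
rewrite lerBlDl -lerBlDr ler_pdivlMr//.
by apply: le_trans lo; rewrite [eta in leLHS]splitr; move: Cln; set x := - ln e; lra.
Unshelve. all: by end_near. Qed.

Hypothesis phi_bounded : exists B, forall s, 0 < s <= 1 -> phi s <= B.
Hypothesis zeta_cvg0 : zeta @ 0^'+ --> (0 : R).

Let phi_expR s i : phi (s / r i) = phi (s * expR (t i)).
Proof. by rewrite [r i in LHS]rE expRN invrK. Qed.

Let phi_le_dil a s : 0 < a -> a <= s -> (s / a) `^ (- c) * phi a <= phi s.
Proof.
move=> a0 as_; have s0 := lt_le_trans a0 as_.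
have -> : (s / a) `^ (- c) * phi a = s `^ (- c) * V a.
  rewrite /weighted mulrA -powRM ?divr_ge0 ?(ltW a0) ?(ltW s0)//.
  by rewrite divfK// gt_eqF.
by rewrite ler_wpM2l ?powR_ge0 ?V_homo.
Qed.

(** If [phi] tends to [L] along all the translates of a sequence, the density of
    the translations and the monotonicity of [V] keep [phi] close to [L] on
    whole periods, over which the integral of [phi] is asymptotically [Z]. *)
Let limit_along_words (u : nat -> R) (L : R) : nonarithmetic ->
  (forall k, 0 < u k) -> u @ \oo --> (0 : R) ->
  (forall w, (fun k => phi (u k * expR (T w))) @ \oo --> L) -> L = Z / m.
Proof.
move=> nl u0 uc uL; have m0 := mean_log_gt0.
suff H eta : 0 < eta -> m * (expR (- (2 * c * eta)) * (L - eta)) <= Z /\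
    Z <= m * (expR (2 * c * eta) * (L + eta)).
  apply/eqP; rewrite eq_le; apply/andP; split.
    rewrite ler_pdivlMr// mulrC.
    have := @right_lim_le _ (fun eta => m * (expR (- (2 * c * eta)) * (L - eta))) Z.
    have -> : m * (expR (- (2 * c * 0)) * (L - 0)) = m * L.
      by rewrite mulr0 oppr0 expR0 mul1r addr0.
    apply; last by move=> e /H[].
    move=> x; apply: cvgMr; apply: cvgM; last by apply: cvgB; [exact: cvg_cst|exact: cvg_id].
    apply: continuous_comp; last exact: continuous_expR.
    by apply: cvgN; apply: cvgMr; exact: cvg_id.
  rewrite ler_pdivrMr// mulrC -lerN2.
  have := @right_lim_le _ (fun eta => - (m * (expR (2 * c * eta) * (L + eta)))) (- Z).
  have -> : m * (expR (2 * c * 0) * (L + 0)) = m * L by rewrite mulr0 expR0 mul1r addr0.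
  apply; last by move=> e /H[_]; rewrite lerN2.
  move=> x; apply: cvgN; apply: cvgMr; apply: cvgM; last by apply: cvgD; [exact: cvg_cst|exact: cvg_id].
  apply: continuous_comp; last exact: continuous_expR.
  by apply: cvgMr; exact: cvg_id.
move=> eta0; have [M HM] := words_dense nl eta0.
pose ell := \sum_i t i.
have tell i : t i <= ell.
  by rewrite /ell (bigD1 i)//= lerDl sumr_ge0// => j _; exact: ltW.
have ell0 : 0 <= ell by apply: sumr_ge0 => j _; exact: ltW.
(* The words [w j] sample the period with step [eta]; two more than fit in it are
   needed, as the upper bound for [phi] uses a sample on the right. *)
pose J := (Num.truncn (ell / eta)).+3.
have /choice[w Hw] j : exists w, M + j%:R * eta - eta < T w <= M + j%:R * eta.
  by apply: HM; rewrite lerDl mulr_ge0// ltW.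
pose e k := u k * expR M.
have e0 k : 0 < e k by rewrite mulr_gt0// expR_gt0.
have ec : e @ \oo --> (0 : R)^'+.
  apply: cvg_at_right0; first exact: nearW.
  by rewrite -(mul0r (expR M)); exact: cvgMl.
have nearw : \forall k \near \oo, forall j : 'I_J, `|L - phi (u k * expR (T (w j)))| <= eta.
  by apply: filter_forall => j; have /cvgrPdist_le/(_ eta eta0) := uL (w j).
have window k s : (forall j : 'I_J, `|L - phi (u k * expR (T (w j)))| <= eta) ->
    e k < s <= e k * expR ell ->
    expR (- (2 * c * eta)) * (L - eta) <= phi s <= expR (2 * c * eta) * (L + eta).
  move=> Hk /andP[slo shi].
  have s0 := lt_trans (e0 k) slo.
  pose x := ln (s / e k).
  have se : s = e k * expR x.
    by rewrite lnK ?posrE ?divr_gt0// mulrCA mulfV ?mulr1// gt_eqF.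
  have x0 : 0 <= x by rewrite ln_ge0// ler_pdivlMr// mul1r ltW.
  have xell : x <= ell.
    by rewrite -ler_expR lnK ?posrE ?divr_gt0// ler_pdivrMr// mulrC.
  have /truncn_itv/andP[j1 j2] : 0 <= x / eta by rewrite divr_ge0// ltW.
  set j := Num.truncn _ in j1 j2.
  rewrite ler_pdivlMr// in j1; rewrite ltr_pdivrMr// -natr1 mulrDl mul1r in j2.
  have jJ : (j < (Num.truncn (ell / eta)).+1)%N.
    by rewrite ltnS le_truncn// ler_wpM2r// invr_ge0 ltW.
  have jJ0 : (j < J)%N by exact: (leqW (leqW jJ)).
  have jJ2 : (j.+2 < J)%N by rewrite /J !ltnS.
  apply/andP; split.
    have := Hk (Ordinal jJ0); rewrite /= ler_norml => /andP[_ La].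
    have /andP[w1 w2] := Hw j.
    set a := u k * expR (T (w j)) in La.
    have a0 : 0 < a by rewrite mulr_gt0// expR_gt0.
    have sa : s / a = expR (M + x - T (w j)).
      rewrite se /e /a !expRD expRN; field.
      by rewrite !gt_eqF ?expR_gt0.
    have as_ : a <= s.
      by rewrite -[a]mul1r -ler_pdivlMr// sa -expR0 ler_expR; lra.
    have [Lneg|Lpos] := leP (L - eta) 0.
      apply: (@le_trans _ _ 0); last exact: phi_ge0.
      by rewrite mulr_ge0_le0// expR_ge0.
    apply: le_trans (phi_le_dil a0 as_); rewrite sa.
    apply: ler_pM; rewrite ?expR_ge0 ?(ltW Lpos)//; last by lra.
    have wx : M + x - T (w j) <= 2 * eta by lra.
    rewrite -expRM ler_expR mulrN lerN2 (_ : 2 * c * eta = 2 * eta * c); last by ring.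
    by rewrite ler_pM2r.
  have := Hk (Ordinal jJ2); rewrite /= ler_norml => /andP[La _].
  have /andP[w1 w2] := Hw j.+2.
  rewrite -natr1 -natr1 in w1 w2.
  set a := u k * expR (T (w j.+2)) in La.
  have a0 : 0 < a by rewrite mulr_gt0// expR_gt0.
  have as_ : a / s = expR (T (w j.+2) - (M + x)).
    rewrite se /e /a !expRD !expRN !expRD; field.
    by rewrite !gt_eqF ?expR_gt0.
  have sa : s <= a.
    by rewrite -[s]mul1r -ler_pdivlMr// as_ -expR0 ler_expR; lra.
  have := phi_le_dil s0 sa; rewrite as_ -expRM => le.
  have phia : phi a <= L + eta by lra.
  have : phi s <= expR (c * (T (w j.+2) - (M + x))) * phi a.
    apply: le_trans (ler_wpM2l (expR_ge0 _) le).
    by rewrite mulrA -expRD mulrN (mulrC c) subrr expR0 mul1r.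
  move/le_trans; apply; apply: ler_pM; rewrite ?expR_ge0 ?phi_ge0//.
  have wx : T (w j.+2) - (M + x) <= 2 * eta by lra.
  rewrite ler_expR (_ : 2 * c * eta = c * (2 * eta)); last by ring.
  by rewrite ler_pM2l.
have period k : (forall j : 'I_J, `|L - phi (u k * expR (T (w j)))| <= eta) ->
    m * (expR (- (2 * c * eta)) * (L - eta)) <= Zc (e k) <= m * (expR (2 * c * eta) * (L + eta)).
  move=> Hk; have ek := e0 k.
  have ZcE : Zc (e k) = \sum_i p i * (I (e k) - I (e k / r i)).
    rewrite -[LHS](addKr (\sum_i p i * I (e k / r i))) -tail_renewal//.
    rewrite addrC -[I (e k) in LHS]mul1r -p_sum mulr_suml -sumrB.
    by apply: eq_bigr => i _; rewrite mulrBr.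
  have er i : e k <= e k / r i.
    by rewrite ler_pdivlMr// ler_piMr ?(ltW ek)//; have /andP[_ /ltW] := r_itv i.
  have lnE i : ln (e k / r i) - ln (e k) = t i by rewrite ln_div_r// addrC addKr.
  have itv i s : (`]e k, e k / r i]%classic : set R) s -> e k < s <= e k * expR ell.
    rewrite /= in_itv/= => /andP[-> /le_trans->//].
    by rewrite [r i]rE expRN invrK ler_pM2l// ler_expR.
  rewrite ZcE /m !mulr_suml; apply/andP; split; apply: ler_sum => i _; rewrite -mulrA ler_pM2l//.
    have [Lneg|Lpos] := leP (L - eta) 0.
      apply: (@le_trans _ _ 0); last by rewrite subr_ge0 tail_homo.
      rewrite mulr_ge0_le0 ?(ltW (t_gt0 i))// mulr_ge0_le0// expR_ge0.
    rewrite -lee_fin -tail_diff// -/(t i) mulrC -lnE -logint_cst//.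
    apply: le_logint => //; first by apply: itv_pos; exact: ltW.
      by apply: posmeas_cst; rewrite mulr_ge0 ?expR_ge0 ?(ltW Lpos).
    by move=> s /itv/(window _ _ Hk)/andP[].
  rewrite [leRHS]mulrC -/(t i) -lee_fin -tail_diff// -lnE -logint_cst//.
  apply: le_logint => //; first by apply: itv_pos; exact: ltW.
    apply: posmeas_cst; have := Hk ord0; rewrite ler_norml => /andP[H _].
    have : 0 <= phi (u k * expR (T (w (@ord0 J.-1)))) by rewrite phi_ge0// mulr_gt0// expR_gt0.
    by move=> H'; rewrite mulr_ge0 ?expR_ge0//; lra.
  by move=> s /itv/(window _ _ Hk)/andP[].
have Zce : Zc \o e @ \oo --> Z by apply: cvg_comp Zc_cvg; exact: ec.
have bnds : \forall k \near \oo, m * (expR (- (2 * c * eta)) * (L - eta)) <= (Zc \o e) k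
    <= m * (expR (2 * c * eta) * (L + eta)).
  by apply: filterS nearw => k; exact: period.
split.
  have := limr_ge (cvgP _ Zce); rewrite (cvg_lim _ Zce)//; apply.
  by apply: filterS bnds => k /andP[].
have := limr_le (cvgP _ Zce); rewrite (cvg_lim _ Zce)//; apply.
by apply: filterS bnds => k /andP[].
Qed.

(** The limits superior and inferior of [phi] both are limits along words. *)
Lemma renewal_nonlattice_limit : nonarithmetic -> phi @ 0^'+ --> Z / m.
Proof.
move=> nl; have [B HB] := phi_bounded.
have ren_err : (fun e => phi e - \sum_i p i * phi (e * expR (t i))) @ 0^'+ --> (0 : R).
  apply: (cvg_trans _ zeta_cvg0); apply: near_eq_cvg; near=> e.
  rewrite renewal; last by near: e; exact: nbhs_right_gt.
  have -> : \sum_i p i * phi (e / r i) = \sum_i p i * phi (e * expR (t i)).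
    by apply: eq_bigr => i _; rewrite phi_expR.
  by rewrite addrAC subrr add0r.
have phiB e : 0 < e <= 1 -> `|phi e| <= B.
  by move=> e01; rewrite ger0_norm ?HB// phi_ge0//; case/andP: e01.
have [L [u [u0 uc up uL]]] := extremal_sequence phiB ren_err.
have ren_errN : (fun e => - phi e - \sum_i p i * - phi (e * expR (t i))) @ 0^'+ --> (0 : R).
  have errN : (fun e => - (phi e - \sum_i p i * phi (e * expR (t i)))) @ 0^'+ --> (0 : R).
    by rewrite -[X in _ --> X]oppr0; exact: cvgN.
  apply: (cvg_trans _ errN).
  apply: near_eq_cvg; near=> e.
  have -> : \sum_i p i * - phi (e * expR (t i)) = - \sum_i p i * phi (e * expR (t i)).
    by rewrite -sumrN; apply: eq_bigr => i _; rewrite mulrN.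
  by rewrite opprD.
have phiBN e : 0 < e <= 1 -> `|- phi e| <= B by rewrite normrN; exact: phiB.
have [L' [u' [u'0 u'c up' uL']]] := extremal_sequence phiBN ren_errN.
have LE := limit_along_words nl u0 uc uL.
have L'E : - L' = Z / m.
  apply: (limit_along_words nl u'0 u'c) => w.
  rewrite (_ : (fun k => _) = (fun k => - - phi (u' k * expR (T w)))); last first.
    by apply/funext => k; rewrite opprK.
  by apply: cvgN; exact: uL'.
apply/cvgrPdist_le => eta eta0; near=> e; rewrite -LE.
have H1 : phi e <= L + eta by near: e; exact: up.
have H2 : - phi e <= L' + eta by near: e; exact: up'.
by rewrite ler_norml; lra.
Unshelve. all: by end_near. Qed.

End TubeFunctions.

End Renewal.

Lemma cvg_bigsum {R : realType} (I T : Type) (X : set_system T) {FX : Filter X}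
    (l : seq I) (f : I -> T -> R) (a : I -> R) :
  (forall i, f i @ X --> a i) ->
  (fun x => \sum_(i <- l) f i x) @ X --> \sum_(i <- l) a i.
Proof.
move=> fa; elim: l => [|i l ih].
  by rewrite big_nil; under eq_fun do rewrite big_nil; exact: cvg_cst.
by rewrite big_cons; under eq_fun do rewrite big_cons; exact: cvgD.
Qed.

(** * Monophase tile volumes *)
Section Monophase.
Context {R : realType} {d : nat}.
Variables (D g Lam B : R) (kappa : 'I_d.+1 -> R) (V v : R -> R).
Hypothesis D_range : d%:R - 1 < D < d%:R.
Hypothesis g_gt0 : 0 < g.
Hypothesis v_ge0 : forall s, 0 < s -> 0 <= v s.
Hypothesis v_homo : forall s s', 0 < s -> s <= s' -> v s <= v s'.
Hypothesis v_poly : forall s, 0 < s <= g -> v s = \sum_k kappa k * s ^+ (d - k).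
Hypothesis v_cst : forall s, g <= s -> v s = v g.
Hypothesis vg_gt0 : 0 < v g.

Local Notation c := (d%:R - D).
Local Notation zeta := (weighted c v).

Hypothesis zeta_bounded : forall s, 0 < s <= 1 -> zeta s <= B.

Let c_gt0 : 0 < c. Proof. by have /andP[] := D_range; rewrite subr_gt0. Qed.

Let q (k : 'I_d.+1) : R := D - k%:R.

Let q_gt0 (k : 'I_d.+1) : (k < d)%N -> 0 < q k.
Proof.
move=> kd; rewrite subr_gt0; have /andP[D1 _] := D_range; apply: le_lt_trans D1.
by rewrite lerBrDr natr1 ler_nat.
Qed.

Let q_neq0 (k : 'I_d.+1) : q k != 0.
Proof.
have [kd|kd] := ltnP k d; first by rewrite gt_eqF// q_gt0.
rewrite /q; have -> : k = d :> nat by apply/eqP; rewrite eqn_leq -ltnS ltn_ord.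
by rewrite lt_eqF//; have /andP[_] := D_range; rewrite subr_lt0.
Qed.

Let powRX (s : R) (k : 'I_d.+1) : 0 < s -> s `^ (- c) * s ^+ (d - k) = s `^ q k.
Proof.
move=> s0; rewrite -powR_mulrn ?(ltW s0)// -powRD; last by rewrite (gt_eqF s0) implybT.
by rewrite natrB -1?ltnS// /q; congr (_ `^ _); ring.
Qed.

Let weighted_inv (s x : R) : 0 < s -> s `^ c * (s `^ (- c) * x) = x.
Proof. by move=> s0; rewrite mulrA powRN divff ?mul1r// gt_eqF ?powR_gt0. Qed.

(** The constant coefficient is the limit of [v] at the origin, which vanishes
    since [v] is of order [s `^ c]. *)
Lemma kappa_top_eq0 (k : 'I_d.+1) : (d <= k)%N -> kappa k = 0.
Proof.
move=> dk; have -> : k = ord_max by apply/val_inj/eqP; rewrite /= eqn_leq -ltnS ltn_ord.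
pose P : {poly R} := \sum_(k < d.+1) kappa k *: 'X^(d - k).
have PE s : P.[s] = \sum_k kappa k * s ^+ (d - k).
  by rewrite horner_sum; apply: eq_bigr => j _; rewrite !(hornerE, hornerXn).
have P0 : P.[0] = kappa ord_max.
  rewrite PE big_ord_recr /= subnn expr0 mulr1 big1 ?add0r// => j _.
  by rewrite expr0n subn_eq0 leqNgt ltn_ord mulr0.
have cP : P.[s] @[s --> 0^'+] --> P.[0].
  by apply: cvg_at_right_filter; exact: continuous_horner.
have cv : P.[s] @[s --> 0^'+] --> (0 : R).
  apply: (@squeeze_cvgr _ _ _ _ (fun=> 0) (fun s => s `^ c * B)); last 2 first.
  - exact: cvg_cst.
  - by rewrite -[X in _ --> X](mul0r B); apply: cvgMl; exact: powR_cvg0.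
  near=> s.
  have s0 : 0 < s by near: s; exact: nbhs_right_gt.
  rewrite PE -v_poly; last by rewrite s0; near: s; exact: nbhs_right_le.
  rewrite v_ge0//= -[v s](weighted_inv _ s0).
  by rewrite ler_wpM2l ?powR_ge0// zeta_bounded// s0/=; near: s; exact: nbhs_right_le.
rewrite -P0 -(cvg_lim (@norm_hausdorff _ _) cP).
exact: (cvg_lim (@norm_hausdorff _ _) cv).
Unshelve. all: by end_near. Qed.

Let zetaE s : 0 < s <= g -> zeta s = \sum_k kappa k * s `^ q k.
Proof.
move=> /[dup] sg /andP[s0 _]; rewrite /weighted v_poly// mulr_sumr.
by apply: eq_bigr => k _; rewrite mulrCA powRX.
Qed.

Let powers_cvg0 (b : 'I_d.+1 -> R) : (forall k : 'I_d.+1, (d <= k)%N -> b k = 0) ->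
  (fun s => \sum_k b k * s `^ q k) @ 0^'+ --> (0 : R).
Proof.
move=> b0.
suff : (fun s => \sum_k b k * s `^ q k) @ 0^'+ --> \sum_(k < d.+1) (0 : R).
  by rewrite [X in _ --> X]big1.
apply: cvg_bigsum => k; have [kd|dk] := ltnP k d.
  rewrite -[X in _ --> X](mulr0 (b k)); apply: cvgMr.
  by apply: powR_cvg0; exact: q_gt0.
by rewrite b0//; under eq_fun do rewrite mul0r; exact: cvg_cst.
Qed.

Lemma zeta_cvg0 : zeta @ 0^'+ --> (0 : R).
Proof.
apply: (cvg_trans _ (powers_cvg0 kappa_top_eq0)); apply: near_eq_cvg; near=> s.
rewrite zetaE//; apply/andP; split; near: s; first exact: nbhs_right_gt.
exact: nbhs_right_le.
Unshelve. all: by end_near. Qed.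

(** The integral of [zeta] against ds/s over the whole half-line, by
    [zeta_tail_cvg]. *)
Definition monophase_constant :=
  (\sum_(k < d.+1 | (k < d)%N) g `^ (D - k%:R) / (D - k%:R) * (d%:R - k%:R) * kappa k) / c.

Let zeta_pos : posmeas zeta.
Proof. exact: posmeas_weighted. Qed.

Let F s : R := \sum_k kappa k / q k * s `^ q k.

Let zeta_tail e : 0 < e <= g ->
  logint zeta `]e, +oo[ = (F g - F e + v g * (g `^ (- c) / c))%:E.
Proof.
move=> /andP[e0 eg]; rewrite (logint_split (ltW e0) eg)// [RHS]EFinD; congr (_ + _)%E.
  move: eg; rewrite le_eqVlt => /predU1P[->|eg].
    by rewrite subrr set_itvoc0 /logint integral_set0.
  pose f s := \sum_k kappa k * s `^ (q k - 1).
  have dF (x : R) : 0 < x -> is_derive x 1 F (f x).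
    move=> x0; rewrite (_ : F = \sum_k (kappa k / q k) \*: (fun s : R => s `^ q k)); last first.
      by apply/funext => s; rewrite fct_sumE; apply: eq_bigr.
    rewrite /f (_ : \sum_k _ = \sum_k (kappa k / q k) *: (q k * x `^ (q k - 1))); last first.
      by apply: eq_bigr => k _; rewrite /GRing.scale/= mulrA divfK.
    apply: is_derive_sum => k; have := is_derive1_powR (q k) x0 => dx.
    exact: is_deriveZ.
  rewrite -(FTC_pos e0 eg dF) => [|x x0].
    apply: eq_integral => s; rewrite inE/= in_itv/= => /andP[se sg].
    have s0 := lt_trans e0 se.
    rewrite zetaE ?s0// mulr_suml; congr EFin; apply: eq_bigr => k _.
    by rewrite -mulrA powR_div.
  by apply: cvg_bigsum => k; apply: cvgMr; exact: continuous_powR_pos.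
rewrite EFinM -logint_powR_ray// -logintZ//; last 3 first.
- exact/ray_pos/ltW.
- exact: ltW.
- exact: posmeas_powR.
apply: eq_integral => s; rewrite inE/= in_itv/= andbT => sg.
by rewrite /weighted (v_cst (ltW sg)) (mulrC (v g)).
Qed.

Let monophase_constantE : monophase_constant = F g + v g * (g `^ (- c) / c).
Proof.
rewrite /monophase_constant v_poly ?g_gt0 ?lexx// [in LHS]big_mkcond /F !mulr_suml -big_split/=.
apply: eq_bigr => k _.
have -> : kappa k * g ^+ (d - k) * (g `^ (- c) / c) = kappa k * g `^ q k / c.
  by rewrite -(powRX k g_gt0); ring.
case: ifPn => [kd|]; last first.
  by rewrite -leqNgt => dk; rewrite kappa_top_eq0// !mul0r addr0.
have := q_neq0 k; have := gt_eqF c_gt0; rewrite -/(q k) /q => c0 q0.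
by field; rewrite q0 c0.
Qed.

Lemma zeta_tail_cvg :
  (fun e => fine (logint zeta `]e, +oo[)) @ 0^'+ --> monophase_constant.
Proof.
rewrite monophase_constantE.
have cv : (fun e => F g - F e + v g * (g `^ (- c) / c)) @ 0^'+
    --> F g - 0 + v g * (g `^ (- c) / c).
  apply: cvgD; last exact: cvg_cst.
  apply: cvgB; first exact: cvg_cst.
  by apply: powers_cvg0 => k dk; rewrite kappa_top_eq0// mul0r.
rewrite subr0 in cv; apply: (cvg_trans _ cv); apply: near_eq_cvg; near=> e.
rewrite zeta_tail//; apply/andP; split; near: e; first exact: nbhs_right_gt.
exact: nbhs_right_le.
Unshelve. all: by end_near. Qed.

Lemma monophase_constant_gt0 : 0 < monophase_constant.
Proof.
have A0 : 0 < v g * (g `^ (- c) / c) by rewrite mulr_gt0// divr_gt0// powR_gt0.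
apply: lt_le_trans A0 _; have := zeta_tail_cvg => cv.
have := limr_ge (cvgP _ cv); rewrite (cvg_lim _ cv)//; apply.
near=> e.
have e0 : 0 < e by near: e; exact: nbhs_right_gt.
have eg : e <= g by near: e; exact: nbhs_right_le.
rewrite zeta_tail ?e0//= lerDr.
have := logint_split (ltW e0) eg zeta_pos.
rewrite zeta_tail ?e0// [logint _ `]g, +oo[]zeta_tail ?g_gt0 ?lexx// subrr add0r.
have := @logint_ge0 _ zeta `]e, g]; move/(_ _ zeta_pos) => H.
have : (0 <= logint zeta `]e, g])%E.
  by apply: H => x; rewrite /= in_itv/= => /andP[+ _]; exact: lt_trans.
case: (logint _ _) => [x| |]//; rewrite -EFinD lee_fin => x0 [] e'; lra.
Unshelve. all: by end_near. Qed.

(** ** The lattice case *)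
Section Lattice.
Context {N : nat}.
Variables (p : 'I_N -> R) (n : 'I_N -> nat) (rho : R).
Hypothesis rho_itv : 0 < rho < 1.
Hypothesis n_gt0 : forall i, (0 < n i)%N.
Hypothesis p_gt0 : forall i, 0 < p i.
Hypothesis p_sum : \sum_i p i = 1.
Variable E : R.
Hypothesis V_cst : forall s, E <= s -> V s = Lam.
Hypothesis Lam_gt0 : 0 < Lam.
Local Notation phi := (weighted c V).
Hypothesis renewal : forall s, 0 < s ->
  phi s = \sum_i p i * phi (s / rho ^+ n i) + zeta s.

Let rho_gt0 : 0 < rho. Proof. by case/andP: rho_itv. Qed.
Let rho_lt1 : rho < 1. Proof. by case/andP: rho_itv. Qed.

(** All scales of the renewal equation are powers of [rho]; this combination of the
    intermediate ones telescopes it into a one-step recursion. *)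
Let Q e := \sum_i p i * \sum_(j < n i) phi (e / rho ^+ j).

Let Q_step e : 0 < e -> Q e = Q (e / rho) + zeta e.
Proof.
move=> e0; apply/eqP; rewrite addrC -subr_eq; apply/eqP; rewrite /Q -sumrB.
transitivity (\sum_i (p i * phi e - p i * phi (e / rho ^+ n i))).
  apply: eq_bigr => i _; rewrite -!mulrBr; congr (_ * _).
  transitivity (phi (e / rho ^+ 0) - phi (e / rho ^+ n i)); last by rewrite expr0 divr1.
  rewrite -sumrB.
  rewrite -(big_mkord xpredT (fun j => phi (e / rho ^+ j) - phi (e / rho / rho ^+ j))).
  rewrite (eq_bigr (fun j => - (phi (e / rho ^+ j.+1) - phi (e / rho ^+ j)))); last first.
    by move=> j _; rewrite opprB exprS invfM mulrA.
  by rewrite sumrN telescope_sumr// opprB.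
by rewrite sumrB -mulr_suml p_sum mul1r renewal//; lra.
Qed.

(** Beyond the scale where all tiles are full, [Q] is a multiple of a power; the
    recursion for [Q] brings this down to the inradius. *)
Let Q_large : exists2 A, 0 < A & forall x, g <= x -> Q x = A * x `^ (- c).
Proof.
suff H m : exists2 A, 0 < A & forall x, g <= x -> E * rho ^+ m <= x -> Q x = A * x `^ (- c).
  have cv : (fun m => E * rho ^+ m) @ \oo --> E * 0.
    by apply: cvgMr; apply: cvg_expr; rewrite gtr0_norm.
  rewrite mulr0 in cv.
  have /cvgr_lt/(_ _ g_gt0)[m _ /(_ m (leqnn m)) Hm] := cv.
  have [A A0 HA] := H m; exists A => // x gx; apply: HA => //.
  exact: le_trans (ltW Hm) gx.
elim: m => [|m [A A0 HA]].
  exists (\sum_i p i * \sum_(j < n i) (rho ^+ j)^-1 `^ (- c) * Lam).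
    have pos j : 0 < (rho ^+ j)^-1 `^ (- c) * Lam.
      by rewrite mulr_gt0// powR_gt0// invr_gt0 exprn_gt0.
    have [i _] := unit_sum_index p_sum; rewrite (bigD1 i)//=; apply: ltr_pwDl.
      rewrite mulr_gt0//; case: (n i) (n_gt0 i) => // k _.
      rewrite big_ord_recl; apply: ltr_pwDl => //.
      by apply: sumr_ge0 => j _; exact: ltW.
    by apply: sumr_ge0 => j _; rewrite mulr_ge0 ?(ltW (p_gt0 j))// sumr_ge0// => l _; exact: ltW.
  move=> x gx; rewrite expr0 mulr1 => Ex; have x0 := lt_le_trans g_gt0 gx.
  rewrite /Q mulr_suml; apply: eq_bigr => i _; rewrite -mulrA mulr_suml; congr (_ * _).
  apply: eq_bigr => j _; rewrite /weighted V_cst.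
    by rewrite powRM ?(ltW x0) ?invr_ge0 ?exprn_ge0 ?(ltW rho_gt0)//; ring.
  apply: le_trans Ex _; rewrite ler_pdivlMr ?exprn_gt0// ler_piMr ?(ltW x0)//.
  by rewrite exprn_ile1 ?(ltW rho_gt0) ?(ltW rho_lt1).
exists (A * rho `^ c + v g); first by rewrite ltr_pDr// mulr_gt0// powR_gt0.
move=> x gx Ex; have x0 := lt_le_trans g_gt0 gx.
have xr : x <= x / rho by rewrite ler_pdivlMr// ler_piMr ?(ltW x0) ?(ltW rho_lt1).
rewrite Q_step// HA; last 2 first.
- exact: le_trans xr.
- by rewrite ler_pdivlMr// -mulrA -exprSr.
rewrite /weighted v_cst// mulrDl; congr (_ + _); last by rewrite mulrC.
rewrite powRM ?(ltW x0) ?invr_ge0 ?(ltW rho_gt0)//.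
rewrite -powR_inv1 ?(ltW rho_gt0)// -powRrM mulrNN mul1r; ring.
Qed.

Let b k := kappa k / (1 - rho `^ q k).

Let b_top (k : 'I_d.+1) : (d <= k)%N -> b k = 0.
Proof. by move=> dk; rewrite /b kappa_top_eq0// mul0r. Qed.

(** The sum of [zeta (rho ^+ j * e)] over all [j]. *)
Let Psi e := \sum_k b k * e `^ q k.

Let Psi_step e : 0 < e <= g -> Psi e = zeta e + Psi (rho * e).
Proof.
move=> /[dup] eg /andP[e0 _]; rewrite zetaE// /Psi -big_split/=; apply: eq_bigr => k _.
have [kd|dk] := ltnP k d; last by rewrite b_top// kappa_top_eq0// !mul0r addr0.
rewrite powRM ?(ltW rho_gt0) ?(ltW e0)// /b; field.
rewrite subr_eq0 eq_sym lt_eqF//.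
have <- : 1 `^ q k = 1 by rewrite powR1.
by rewrite gt0_ltr_powR ?q_gt0// nnegrE ltW.
Qed.

(** If [phi] had a limit, then [Q + Psi (rho * _)], which is invariant under
    scaling by [rho], would be constant. On [rho * g, g] this equates a
    polynomial with nonzero constant term with a multiple of the power
    [e `^ c], [0 < c < 1], which is impossible because of their behaviour under
    scaling. *)
Lemma lattice_no_limit (L : R) : ~ (phi @ 0^'+ --> L).
Proof.
move=> phiL; have [A A0 QA] := Q_large.
pose L' := \sum_i p i * \sum_(j < n i) L.
have toR (e : R) j : 0 < e -> (fun m => rho ^+ m * e / rho ^+ j) @ \oo --> (0 : R)^'+.
  move=> e0; apply: cvg_at_right0; first by apply: nearW => m; rewrite !mulr_gt0 ?invr_gt0 ?exprn_gt0.
  rewrite -(mul0r (e / rho ^+ j)); under eq_fun do rewrite -mulrA.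
  by apply: cvgMl; apply: cvg_expr; rewrite gtr0_norm.
have QL e : 0 < e -> (fun m => Q (rho ^+ m * e)) @ \oo --> L'.
  move=> e0; apply: cvg_bigsum => i; apply: cvgMr; apply: cvg_bigsum => j.
  exact: (cvg_comp _ _ (toR e j e0) phiL).
have PsiL e : 0 < e -> (fun m => Psi (rho * (rho ^+ m * e))) @ \oo --> (0 : R).
  move=> e0; have := cvg_comp _ _ (toR (rho * e) 0%N (mulr_gt0 rho_gt0 e0)) (powers_cvg0 b_top).
  apply: cvg_trans; apply: near_eq_cvg; near=> m => /=.
  by rewrite expr0 divr1 mulrCA.
have inv e m : 0 < e <= g -> Q (rho ^+ m * e) + Psi (rho * (rho ^+ m * e)) = Q e + Psi (rho * e).
  move=> /andP[e0 eg]; elim: m => [|m <-]; first by rewrite expr0 mul1r.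
  have x0 : 0 < rho ^+ m * e by rewrite mulr_gt0// exprn_gt0.
  have rx : 0 < rho * (rho ^+ m * e) <= g.
    rewrite mulr_gt0//= mulrA -exprS; apply: le_trans eg.
    by rewrite ler_piMl ?(ltW e0)// exprn_ile1 ?(ltW rho_gt0) ?(ltW rho_lt1).
  rewrite exprS -mulrA Q_step; last by case/andP: rx.
  rewrite [rho * (rho ^+ m * e) / rho]mulrAC divff ?gt_eqF// mul1r.
  by rewrite -addrA -Psi_step.
have key e : rho * g <= e <= g -> A * rho `^ c * e `^ (- c) + Psi e = L'.
  move=> /andP[lo hi]; have e0 : 0 < e by apply: lt_le_trans lo; exact: mulr_gt0.
  have eg : 0 < e <= g by rewrite e0.
  have cst : (fun m => Q (rho ^+ m * e) + Psi (rho * (rho ^+ m * e))) @ \oo --> Q e + Psi (rho * e).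
    under eq_fun do rewrite inv//; exact: cvg_cst.
  have cst' : (fun m => Q (rho ^+ m * e) + Psi (rho * (rho ^+ m * e))) @ \oo --> L'.
    by rewrite -[X in _ --> X](addr0 L'); apply: cvgD; [exact: QL|exact: PsiL].
  rewrite -[RHS](cvg_lim (@norm_hausdorff _ _) cst').
  rewrite [RHS](cvg_lim (@norm_hausdorff _ _) cst) Q_step// -addrA -Psi_step// QA.
    congr (_ + _); rewrite powRM ?(ltW e0) ?invr_ge0 ?(ltW rho_gt0)//.
    by rewrite -powR_inv1 ?(ltW rho_gt0)// -powRrM mulrNN mul1r; ring.
  by rewrite ler_pdivlMr// mulrC.
set A' := A * rho `^ c in key; have A'0 : 0 < A' by rewrite mulr_gt0// powR_gt0.
pose P : {poly R} := A'%:P + \sum_k b k *: 'X^(d - k).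
have PE s : P.[s] = A' + \sum_k b k * s ^+ (d - k).
  rewrite hornerD hornerC horner_sum; congr (_ + _).
  by apply: eq_bigr => j _; rewrite !(hornerE, hornerXn).
have P0 : P.[0] = A'.
  rewrite PE big1 ?addr0// => k _; have [kd|dk] := ltnP k d; last by rewrite b_top// mul0r.
  by rewrite expr0n subn_eq0 leqNgt kd mulr0.
have keyP e : rho * g <= e <= g -> P.[e] = e `^ c * L'.
  move=> /[dup] eg /andP[lo _]; have e0 : 0 < e by apply: lt_le_trans lo; exact: mulr_gt0.
  rewrite -(key e eg) mulrDr mulrCA powRN divff ?mulr1 ?gt_eqF ?powR_gt0// PE.
  congr (_ + _); rewrite mulr_sumr; apply: eq_bigr => k _.
  by rewrite -(powRX k e0) mulrCA weighted_inv.
(* Scaling by [sqrt rho] maps the upper part of the interval of [keyP] into it, so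
   that the identity can be compared with its scaled copy. *)
clearbody P.
pose s := Num.sqrt rho.
have s0 : 0 < s by rewrite sqrtr_gt0.
have ss : s * s = rho by rewrite -expr2 sqr_sqrtr// ltW.
have s1 : s < 1 by rewrite -(ltr_pM2l s0) ss mulr1; rewrite -ss -[ltRHS]mulr1 ltr_pM2l//;
  rewrite ltNge; apply/negP => h; have := rho_lt1; rewrite -ss ltNge mulr_ege1.
pose P1 : {poly R} := P \Po (s *: 'X) - s `^ c *: P.
have P1E x : P1.[x] = P.[s * x] - s `^ c * P.[x].
  by rewrite /P1 hornerD hornerN hornerZ horner_comp [(s *: 'X).[x]]hornerZ hornerX.
have rootP1 e : s * g <= e <= g -> root P1 e.
  move=> /andP[lo hi]; have e0 : 0 < e by apply: lt_le_trans lo; exact: mulr_gt0.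
  rewrite /root P1E !keyP.
  - by rewrite powRM ?(ltW s0) ?(ltW e0)// mulrA subrr.
  - apply/andP; split => //; apply: le_trans lo; rewrite -ss -mulrA ler_piMl ?(ltW s1)//.
    by rewrite mulr_ge0// ltW.
  - rewrite -ss -mulrA ler_pM2l// lo/=; apply: le_trans hi.
    by rewrite ler_piMl ?(ltW s1) ?(ltW e0).
(* More roots than the degree of [P1] allows. *)
pose rs := [seq s * g + (1 - s) * g / j.+1%:R | j <- iota 0 (size P1)].
have P10 : P1 = 0.
  apply: (@roots_geq_poly_eq0 _ P1 rs); last by rewrite size_map size_iota.
    apply/allP => _ /mapP[j _ ->]; apply: rootP1.
    have h0 : 0 <= (1 - s) * g by rewrite mulr_ge0 ?subr_ge0 ?ltW.
    rewrite lerDl divr_ge0//=.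
    apply: (@le_trans _ _ (s * g + (1 - s) * g)); last by rewrite -mulrDl addrC subrK mul1r.
    by rewrite lerD2l ler_pdivrMr// ler_peMr// ler1n.
  rewrite map_inj_uniq ?iota_uniq// => i j /addrI/eqP.
  have h0 : (1 - s) * g != 0 by rewrite gt_eqF// mulr_gt0// subr_gt0.
  by move=> /eqP/(mulfI h0)/invr_inj/eqP; rewrite eqr_nat => /eqP[].
have : P1.[0] = 0 by rewrite P10 horner0.
rewrite P1E mulr0 P0 => /eqP.
rewrite subr_eq0 -[X in X == _]mul1r => /eqP/(mulIf (lt0r_neq0 A'0)).
have : s `^ c < 1 `^ c by rewrite gt0_ltr_powR ?nnegrE ?(ltW s0).
rewrite powR1.
by move=> + e1; rewrite -e1 ltxx.
Unshelve. all: by end_near. Qed.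

End Lattice.

End Monophase.

(** * Minkowski contents as limits of weighted functions *)
Section Contents.
Context {R : realType}.
Implicit Types (f : R -> R) (V : R -> \bar R) (a b c e l s : R).
Local Notation mu := (@lebesgue_measure R).

Lemma weighted_shift c c' f e : 0 < e ->
  weighted c f e = e `^ (c' - c) * weighted c' f e.
Proof.
move=> e0; rewrite /weighted mulrA -powRD; last by rewrite (gt_eqF e0) implybT.
by congr (_ `^ _ * _); ring.
Qed.

Lemma weighted_dil (d : nat) s f (r e : R) : 0 < r -> 0 < e ->
  r `^ s * weighted (d%:R - s) f (e / r) = e `^ (- (d%:R - s)) * (r ^+ d * f (e / r)).
Proof.
move=> r0 e0; rewrite /weighted powRM ?(ltW e0) ?invr_ge0 ?(ltW r0)//.
have rE : r `^ s * r^-1 `^ (- (d%:R - s)) = r ^+ d.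
  rewrite -(powR_inv1 (ltW r0)) -powRrM -powRD ?(gt_eqF r0) ?implybT//.
  by rewrite -powR_mulrn ?(ltW r0)//; congr (_ `^ _); ring.
by rewrite -rE; ring.
Qed.

Let content_near (d : nat) (alpha : R) V f : (forall e, 0 < e -> V e = (f e)%:E) ->
  \forall e \near 0^'+,
    ((e `^ (alpha - d%:R))%:E * V e)%E = (weighted (d%:R - alpha) f e)%:E.
Proof.
move=> Vf; near=> e; rewrite Vf; first by rewrite -EFinM /weighted opprB.
by near: e; exact: nbhs_right_gt.
Unshelve. all: by end_near. Qed.

Lemma has_contentE (d : nat) (alpha : R) V f l : (forall e, 0 < e -> V e = (f e)%:E) ->
  has_content d alpha V l%:E <-> weighted (d%:R - alpha) f @ 0^'+ --> l.
Proof.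
move=> /(content_near d alpha) E; split => [/fine_cvgP[_ H]|H].
  apply: (cvg_trans _ H); apply: near_eq_cvg.
  by apply: filterS E => e /= ->.
apply/fine_cvgP; split; first by apply: filterS E => e /= ->.
apply: (cvg_trans _ H); apply: near_eq_cvg.
by apply: filterS E => e /= ->.
Qed.

Lemma has_content_bounded (d : nat) (alpha : R) V f (m : \bar R) B :
  (forall e, 0 < e -> V e = (f e)%:E) ->
  (\forall e \near 0^'+, 0 <= weighted (d%:R - alpha) f e <= B) ->
  has_content d alpha V m -> exists l, m = l%:E.
Proof.
move=> Vf fB Vm; have E := content_near d alpha Vf.
have m0 : (0 <= m)%E.
  rewrite -(cvg_lim (@ereal_hausdorff R) Vm); apply: lime_ge; first exact: cvgP Vm.
  by apply: filterS2 E fB => e -> /andP[+ _]; rewrite lee_fin.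
have mB : (m <= B%:E)%E.
  rewrite -(cvg_lim (@ereal_hausdorff R) Vm); apply: lime_le; first exact: cvgP Vm.
  by apply: filterS2 E fB => e -> /andP[_ +]; rewrite lee_fin.
case: m m0 mB {Vm} => [l| |]// _ _; by exists l.
Qed.

Lemma inv_ln_cvg0 : (fun e => (- ln e)^-1) @ 0^'+ --> (0 : R).
Proof.
apply/gtr0_cvgV0; last by apply/cvgNry; exact: lnNy.
near=> e; rewrite oppr_gt0 ln_lt0//; apply/andP; split; near: e.
  exact: nbhs_right_gt.
exact: nbhs_right_lt.
Unshelve. all: by end_near. Qed.

(** The dimension is the exponent of any pair of power bounds. *)
Lemma ln_power_bounds f c A B : 0 < A ->
  (\forall e \near 0^'+, A * e `^ c <= f e <= B * e `^ c) ->
  (fun e => ln (f e) / ln e) @ 0^'+ --> c.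
Proof.
move=> A0 fAB.
have cv k : (fun e => c - k * (- ln e)^-1) @ 0^'+ --> c.
  rewrite -[X in _ --> X]subr0 -[X in _ --> _ - X](mulr0 k).
  by apply: cvgB; [exact: cvg_cst|apply: cvgMr; exact: inv_ln_cvg0].
apply: (squeeze_cvgr _ (cv (ln B)) (cv (ln A))); near=> e.
have e0 : 0 < e by near: e; exact: nbhs_right_gt.
have e1 : e < 1 by near: e; exact: nbhs_right_lt.
have le0 : ln e < 0 by rewrite ln_lt0// e0.
have /andP[lo hi] : A * e `^ c <= f e <= B * e `^ c by near: e.
have p0 : 0 < e `^ c by rewrite powR_gt0.
have f0 : 0 < f e by apply: lt_le_trans lo; rewrite mulr_gt0.
have B0 : 0 < B by rewrite -(pmulr_lgt0 _ p0); exact: lt_le_trans hi.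
have E k : 0 < k -> c - ln k * (- ln e)^-1 = ln (k * e `^ c) / ln e.
  move=> k0; rewrite lnM ?posrE// ln_powR; field; rewrite (lt_eqF le0)//.
rewrite !E// !ler_ndivrMr// !divfK ?lt_eqF//.
by rewrite !ler_ln ?posrE ?mulr_gt0// lo hi.
Unshelve. all: by end_near. Qed.

(** The sum of the powers is continuous in the exponent, and is [N] at [0]. *)
Lemma moran_exponent (d N : nat) (r : 'I_N -> R) : (2 <= N)%N ->
  (forall i, 0 < r i < 1) -> \sum_i r i ^+ d < 1 ->
  exists2 s, s < d%:R & \sum_i r i `^ s = 1.
Proof.
move=> N2 r01 sd; pose S s := \sum_i r i `^ s.
have S0 : S 0 = N%:R.
  by rewrite /S (eq_bigr (fun=> 1)) ?sumr_const ?card_ord// => i _; rewrite powRr0.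
have Sd : S d%:R = \sum_i r i ^+ d.
  by apply: eq_bigr => i _; rewrite powR_mulrn//; have /andP[/ltW] := r01 i.
have cS : continuous S.
  move=> x; apply: cvg_bigsum => i.
  have /andP[r0 _] := r01 i.
  have -> : (fun s => r i `^ s) = (fun s => expR (s * ln (r i))).
    by apply/funext => s; rewrite /powR gt_eqF.
  rewrite [X in _ --> X](_ : _ = expR (x * ln (r i))); last by rewrite /powR gt_eqF.
  apply: (@continuous_comp _ _ _ (fun s => s * ln (r i)) expR); last exact: continuous_expR.
  by apply: cvgMl.
have [||s + Ss] := @IVT R S 0 d%:R 1 (ler0n _ _).
- exact: continuous_subspaceT.
- rewrite S0 Sd ge_min le_max (ltW sd) orbT/= ler1n (leq_trans _ N2)//.
rewrite in_itv/= => /andP[s0 sd']; exists s => //.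
rewrite lt_neqAle sd' andbT; apply: contraTneq sd => sE.
by rewrite -Sd -sE Ss ltxx.
Qed.

(** ** Logarithmic averages *)

Lemma cesaro_log f l : posmeas f ->
  (forall e, 0 < e -> logint f `]e, 1] \is a fin_num) ->
  f @ 0^'+ --> l ->
  (fun e => fine (logint f `]e, 1]) / - ln e) @ 0^'+ --> l.
Proof.
move=> pf ffin fl; have [f0 _] := pf.
have l0 : 0 <= l.
  rewrite -(cvg_lim (@norm_hausdorff _ _) fl); apply: limr_ge; first exact: cvgP fl.
  by near=> e; apply: f0; near: e; exact: nbhs_right_gt.
apply/cvgrPdist_le => eta eta0; have eta20 : 0 < eta / 2 by rewrite divr_gt0.
have [D /= D0 HD] := ((cvgrPdist_le _ _).1 fl) _ eta20.
pose dl := Num.min 1 (D / 2).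
have dl0 : 0 < dl by rewrite lt_min ltr01 divr_gt0.
have dl1 : dl <= 1 by rewrite ge_min lexx.
have near_l s : 0 < s <= dl -> `|l - f s| <= eta / 2.
  move=> /andP[s0 sd]; apply: HD => //=; rewrite sub0r normrN gtr0_norm//.
  apply: le_lt_trans sd _; rewrite gt_min; apply/orP; right.
  by rewrite ltr_pdivrMr// ltr_pMr// ltr1n.
pose K := fine (logint f `]dl, 1]) + l * - ln dl.
have Kcv : (fun e => K * (- ln e)^-1) @ 0^'+ --> (0 : R).
  by rewrite -[X in _ --> X](mulr0 K); apply: cvgMr; exact: inv_ln_cvg0.
have Ksmall := ((cvgrPdist_le _ _).1 Kcv) _ eta20.
near=> e.
have e0 : 0 < e by near: e; exact: nbhs_right_gt.
have ed : e < dl by near: e; exact: nbhs_right_lt.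
have lne : 0 < - ln e by rewrite oppr_gt0 ln_lt0// e0 (lt_le_trans ed).
have lnd : 0 <= - ln dl by rewrite oppr_ge0 ln_le0.
have led : 0 <= ln dl - ln e by rewrite subr_ge0 ler_ln ?posrE// ltW.
have spl := logint_split_itv (ltW e0) (ltW ed) (_ : (BRight dl <= BRight 1)%O) pf.
have {}spl := spl dl1.
have Afin : logint f `]e, dl] \is a fin_num.
  rewrite ge0_fin_numE; last by apply: logint_ge0 => //; exact/itv_pos/ltW.
  apply: (@le_lt_trans _ _ (logint f `]e, 1])).
    by rewrite spl leeDl// logint_ge0//; exact/itv_pos/ltW.
  by rewrite -ge0_fin_numE ?ffin// logint_ge0//; exact/itv_pos/ltW.
have -> : fine (logint f `]e, 1]) = fine (logint f `]e, dl]) + fine (logint f `]dl, 1]).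
  by rewrite spl fineD ?ffin.
have hi : fine (logint f `]e, dl]) <= (l + eta / 2) * (ln dl - ln e).
  rewrite -lee_fin fineK// -logint_cst ?(ltW ed)//; apply: le_logint => //.
  - exact/itv_pos/ltW.
  - by apply: posmeas_cst; rewrite addr_ge0// ltW.
  move=> s; rewrite /= in_itv/= => /andP[es sd].
  have := near_l s; rewrite (lt_trans e0 es) sd => /(_ isT).
  by rewrite ler_norml => /andP[]; lra.
have lo : l * (ln dl - ln e) <= fine (logint f `]e, dl]) + eta / 2 * (ln dl - ln e).
  have peta : posmeas (fun=> eta / 2) by apply: posmeas_cst; exact: ltW.
  rewrite -lee_fin EFinD fineK// -!logint_cst ?(ltW ed)//.
  rewrite -logintD//; last exact/itv_pos/ltW.
  apply: (@le_logint _ (fun=> l) (fun s => f s + eta / 2)) => //; first exact/itv_pos/ltW.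
  - exact: posmeasD.
  move=> s; rewrite /= in_itv/= => /andP[es sd].
  have := near_l s; rewrite (lt_trans e0 es) sd => /(_ isT).
  by rewrite ler_norml => /andP[]; lra.
have Ke : `|K| <= eta / 2 * - ln e.
  rewrite -ler_pdivrMr// -[X in _ / X]gtr0_norm// -normfV -normrM.
  have : `|0 - K * (- ln e)^-1| <= eta / 2 by near: e; exact: Ksmall.
  by rewrite sub0r normrN.
have fd0 : 0 <= fine (logint f `]dl, 1]).
  by apply: fine_ge0; apply: logint_ge0 => //; exact/itv_pos/ltW.
rewrite -(ler_pM2r lne) -[X in _ * X <= _]gtr0_norm// -normrM mulrBl divfK ?gt_eqF//.
move: Ke; rewrite !ler_norml /K => /andP[K1 K2]; apply/andP; split; nra.
Unshelve. all: by end_near. Qed.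

Lemma logint_weighted_itv_fin c f e : 0 < c -> (forall s, 0 < s -> 0 <= f s) ->
  (forall s t, 0 < s -> s <= t -> f s <= f t) -> 0 < e ->
  logint (weighted c f) `]e, 1] \is a fin_num.
Proof.
move=> c0 f0 fh e0; have [e1|e1] := leP e 1; last first.
  rewrite (_ : `]e, 1]%classic = set0) ?/logint ?integral_set0//.
  by apply: set_itv_ge; rewrite bnd_simp -leNgt ltW.
rewrite ge0_fin_numE; last first.
  by apply: logint_ge0; [exact/itv_pos/ltW|exact: posmeas_weighted].
apply: (@le_lt_trans _ _ (logint (fun=> e `^ (- c) * f 1) `]e, 1])).
  apply: le_logint => //; first exact/itv_pos/ltW.
  - exact: posmeas_weighted.
  - by apply: posmeas_cst; rewrite mulr_ge0 ?powR_ge0 ?f0.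
  move=> s; rewrite /= in_itv/= => /andP[es s1]; have s0 := lt_trans e0 es.
  rewrite /weighted; apply: ler_pM; rewrite ?powR_ge0 ?f0 ?fh//.
  rewrite !powRN lef_pV2 ?posrE ?powR_gt0//.
  by apply: ge0_ler_powR; rewrite ?nnegrE ?(ltW c0) ?(ltW e0) ?(ltW s0) ?(ltW es).
by rewrite logint_cst// ltry.
Qed.

Lemma has_average_contentE (d : nat) (alpha : R) V f l :
  (forall e, 0 < e -> V e = (f e)%:E) -> posmeas f ->
  (forall e, 0 < e -> logint (weighted (d%:R - alpha) f) `]e, 1] \is a fin_num) ->
  (fun e => fine (logint (weighted (d%:R - alpha) f) `]e, 1]) / - ln e) @ 0^'+ --> l ->
  has_average_content d alpha V l%:E.
Proof.
move=> Vf pf ffin cv; set w := weighted _ f in ffin cv.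
have pw : posmeas w by apply: posmeasM => //; exact: posmeas_powR.
have invcv : (fun b => b^-1) @ (+oo%R : set_system R) --> (0 : R)^'+.
  have b0 : \forall b \near (+oo%R : set_system R), 0 < b by exact: nbhs_pinfty_gt.
  apply: cvg_at_right0; first by apply: filterS b0 => b; rewrite invr_gt0.
  by apply/gtr0_cvgV0; [exact: b0|exact: cvg_id].
have cvb := cvg_comp _ _ invcv cv.
have E : \forall b \near (+oo%R : set_system R),
   (((ln b)^-1)%:E * \int[mu]_(eps in `[b^-1%R, 1%R])
       ((eps `^ (alpha - d%:R) / eps)%:E * V eps))%E =
   (fine (logint w `]b^-1, 1]) / - ln b^-1)%:E.
  near=> b.
  have b1 : 1 < b by near: b; exact: nbhs_pinfty_gt.
  have b0 : 0 < b by exact: lt_trans b1.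
  have bV0 : 0 < b^-1 by rewrite invr_gt0.
  rewrite lnV ?posrE// opprK mulrC EFinM fineK ?ffin//; congr (_ * _)%E.
  rewrite /logint integral_itv_obnd_cbnd; last first.
    by apply: posmeas_log => //; exact/itv_pos/ltW.
  apply: eq_integral => s; rewrite inE/= in_itv/= => /andP[bs _].
  rewrite Vf ?(lt_le_trans bV0)// -EFinM /w /weighted opprB; congr EFin; ring.
apply/fine_cvgP; split; first by apply: filterS E => b /= ->.
apply: (cvg_trans _ cvb); apply: near_eq_cvg.
by apply: filterS E => b /= ->.
Unshelve. all: by end_near. Qed.

End Contents.

(** * Minkowski contents of the attractor and of its tiling *)
Section Assembly.
Context {R : realType} {n N : nat}.
Local Notation d := n.+1.
Variables (Phi : 'I_N -> 'rV[R]_d -> 'rV[R]_d) (r : 'I_N -> R).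
Variables (F : set 'rV[R]_d) (D : R) (O G : set 'rV[R]_d).
Variables (kappa : 'I_d.+1 -> R) (mout : R).
Hypothesis N_ge2 : (2 <= N)%N.
Hypothesis Phi_sim : contractive_similarities Phi r.
Hypothesis F_attractor : attractor Phi F.
Hypothesis F_dim : has_minkowski_dimension F D.
Hypothesis D_range : d%:R - 1 < D < d%:R.
Hypothesis O_feasible : feasible Phi O.
Hypothesis bdO_sub_F : boundary O `<=` F.
Hypothesis single_generator : generators Phi O = [set G].
Hypothesis G_monophase : monophase G kappa.
Hypothesis mout_ge0 : 0 <= mout.
Hypothesis K_outer : has_outer_minkowski_content D (closure O) mout%:E.

Local Notation lam := (@lebesgue_d R d).
Local Notation K := (closure O).
Local Notation c := (d%:R - D).
Implicit Types e s : R.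

Let r_itv i : 0 < r i < 1. Proof. by have [] := Phi_sim i. Qed.
Let r_gt0 i : 0 < r i. Proof. by have /andP[] := r_itv i. Qed.
Let c_gt0 : 0 < c. Proof. by have /andP[] := D_range; rewrite subr_gt0. Qed.

Let F_ebounded : ebounded F.
Proof. by case: F_attractor => _ /compact_ebounded. Qed.

(** Were all balls null, so would be the parallel sets of [F], and the dimension
    of [F] would be [d]. *)
Let ball_pos : (0 < lam (eball 0 1))%E.
Proof.
rewrite lt_neqAle lebesgue_d_ge0 andbT; apply/negP => /eqP ball0.
have par0 e : lam (parallel_set F e) = 0%E.
  have [M FM] := ebounded_parallel_set e F_ebounded.
  apply/eqP; rewrite eq_le lebesgue_d_ge0 andbT.
  apply: (@le_trans _ _ (lam (eball 0 (`|M| + 1)))).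
    apply: le_lebesgue_d => x /FM xM; rewrite /eball/= subr0.
    by apply: le_lt_trans xM _; have := ler_norm M; lra.
  by rewrite lebesgue_d_ball -?ball0 ?mule0// ltr_wpDl.
have : (fun e : R => d%:R - ln (fine (lam (parallel_set F e))) / ln e) @ 0^'+ --> (d%:R : R).
  under eq_fun do rewrite par0/= ln0// mul0r subr0.
  exact: cvg_cst.
move=> /(cvg_unique (@norm_hausdorff _ _) F_dim) DE.
by have /andP[_] := D_range; rewrite DE ltxx.
Qed.

Let K_bounded : ebounded K.
Proof.
have /fine_cvgP[fin _] := K_outer.
have [e e0 Ke] : exists2 e : R, 0 < e & (lam (parallel_set K e) < +oo)%E.
  suff : \forall e \near (0 : R)^'+, (0 < e) && (lam (parallel_set K e) < +oo)%E.
    by move=> /filter_ex[e /andP[]]; exists e.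
  near=> e.
  have e0 : 0 < e by near: e; exact: nbhs_right_gt.
  have : ((e `^ (D - d%:R))%:E * (lam (parallel_set K e) - lam K))%E \is a fin_num by near: e.
  rewrite e0/=; have p0 : 0 < e `^ (D - d%:R) by rewrite powR_gt0.
  have := lebesgue_d_ge0 (parallel_set K e).
  case: (lam (parallel_set K e)) => [x| |]//; rewrite ?ltry// => _.
  have E x : (+oo - x%:E = +oo :> \bar R)%E by [].
  case: (lam K) (lebesgue_d_ge0 K) => [y| |]// _; first by rewrite E gt0_muley// lte_fin.
  by rewrite /= gt0_muleNy ?lte_fin.
exact: (parallel_set_bounded ball_pos e0 Ke).
Unshelve. all: by end_near. Qed.

Let G_open : open G. Proof. by case: G_monophase. Qed.
Let G_bounded : ebounded G. Proof. by case: G_monophase. Qed.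
Let G_nonempty : G !=set0.
Proof.
have : generators Phi O G by rewrite single_generator.
by move=> [x Ux <-]; exists x; exact: connected_component_refl.
Qed.
Let O_bounded : ebounded O.
Proof. by apply: ebounded_sub K_bounded; exact: subset_closure. Qed.

Let g := inradius G.
Let g_gt0 : 0 < g. Proof. exact: inradius_gt0. Qed.

Let lam_fin A : ebounded A -> lam A \is a fin_num.
Proof. by move=> bA; rewrite ge0_fin_numE ?lebesgue_d_ge0// lebesgue_d_bounded. Qed.

Let V e := fine (tube_volume F O e).
Let v e := fine (generator_tube_volume F G e).
Let out e := fine (lam (parallel_set K e) - lam K)%E.
Let volF e := fine (lam (parallel_set F e)).

Let VE e : tube_volume F O e = (V e)%:E.
Proof. by rewrite fineK// lam_fin//; apply: ebounded_sub O_bounded => x [[]]. Qed.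
Let vE e : generator_tube_volume F G e = (v e)%:E.
Proof. by rewrite fineK// lam_fin//; apply: ebounded_sub G_bounded => x []. Qed.
Let volFE e : lam (parallel_set F e) = (volF e)%:E.
Proof. by rewrite fineK// lam_fin//; exact: ebounded_parallel_set. Qed.
Let outE e : (lam (parallel_set K e) - lam K)%E = (out e)%:E.
Proof.
by rewrite fineK// fin_numB lam_fin ?lam_fin//; exact: ebounded_parallel_set.
Qed.
Let lamO := fine (lam O).
Let lamOE : lam O = lamO%:E. Proof. by rewrite fineK// lam_fin. Qed.

Let V_ge0 e : 0 < e -> 0 <= V e.
Proof. by move=> _; apply: fine_ge0; exact: lebesgue_d_ge0. Qed.
Let v_ge0 e : 0 < e -> 0 <= v e.
Proof. by move=> _; apply: fine_ge0; exact: lebesgue_d_ge0. Qed.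
Let volF_ge0 e : 0 < e -> 0 <= volF e.
Proof. by move=> _; apply: fine_ge0; exact: lebesgue_d_ge0. Qed.
Let out_ge0 e : 0 < e -> 0 <= out e.
Proof. by move=> /ltW e0; exact/fine_ge0/(outer_volume_ge0 K_bounded). Qed.
Let V_homo e e' : 0 < e -> e <= e' -> V e <= V e'.
Proof. by move=> _ ee'; rewrite -lee_fin -!VE; exact: tube_volume_homo. Qed.
Let v_homo e e' : 0 < e -> e <= e' -> v e <= v e'.
Proof. by move=> _ ee'; rewrite -lee_fin -!vE; exact: generator_tube_volume_homo. Qed.
Let volF_homo e e' : 0 < e -> e <= e' -> volF e <= volF e'.
Proof.
move=> _ ee'; rewrite -lee_fin -!volFE; apply: le_lebesgue_d => x.
exact: parallel_set_mono.
Qed.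
Let out_homo e e' : 0 < e -> e <= e' -> out e <= out e'.
Proof.
move=> _ ee'; rewrite -lee_fin -!outE; apply: leeB => //; apply: le_lebesgue_d => x.
exact: parallel_set_mono.
Qed.
Let V_le e : 0 < e -> V e <= lamO.
Proof. by move=> _; rewrite -lee_fin -VE -lamOE; exact: tube_volume_le. Qed.

Let volume_split e : 0 < e -> volF e = V e + out e.
Proof.
move=> /ltW e0; apply: EFin_inj; rewrite EFinD -volFE -VE -outE.
exact: (parallel_volumeE Phi_sim F_attractor O_feasible bdO_sub_F single_generator G_open K_bounded ball_pos).
Qed.

Let V_renewal e : V e = \sum_i r i ^+ d * V (e / r i) + v e.
Proof.
apply: EFin_inj; rewrite EFinD -VE -vE.
rewrite (tube_volume_renewal Phi_sim F_attractor O_feasible bdO_sub_F single_generator K_bounded ball_pos).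
by rewrite -sumEFin; congr (_ + _)%E; apply: eq_bigr => i _; rewrite VE EFinM.
Qed.

Let volF_le_renewal e : volF e <= \sum_i r i ^+ d * volF (e / r i).
Proof.
rewrite -lee_fin -volFE -sumEFin.
apply: le_trans (parallel_volume_le_renewal Phi_sim F_attractor ball_pos e) _.
by apply: lee_sum => i _; rewrite volFE EFinM.
Qed.

Let v_innerE e : inner_tube_volume G e = (v e)%:E.
Proof.
rewrite -vE.
exact: (inner_tube_generator Phi_sim F_attractor O_feasible bdO_sub_F single_generator G_open K_bounded).
Qed.

Let v_poly e : 0 < e <= g -> v e = \sum_k kappa k * e ^+ (d - k).
Proof.
move=> eg; apply: EFin_inj; rewrite -v_innerE.
by case: G_monophase => _ _; exact.
Qed.

Let v_cst e : g <= e -> v e = v g.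
Proof.
by move=> ge; apply: EFin_inj; rewrite -!v_innerE !inner_tube_inradius.
Qed.

Let vg_gt0 : 0 < v g.
Proof.
rewrite -lte_fin -v_innerE inner_tube_inradius//.
exact: generator_volume_gt0 single_generator G_open ball_pos.
Qed.

Let V_cst : exists E, forall e, E <= e -> V e = lamO.
Proof.
have [[f Ff] _ _] := F_attractor; have [M OM] := O_bounded.
exists (`|M| + enorm f + 1) => e Me.
apply: EFin_inj; rewrite -VE -lamOE; apply/eqP; rewrite eq_le tube_volume_le/=.
have F0 : lam F = 0%E.
  exact: (attractor_null Phi_sim F_attractor O_feasible single_generator G_open K_bounded ball_pos).
apply: (@le_trans _ _ (lam ((O `\` F) `&` parallel_set F e `|` F))).
  apply: le_lebesgue_d => x Ox; have [Fx|nFx] := pselect (F x); first by right.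
  left; split => //; apply/parallel_setP => e' ee'; exists f => //.
  apply: le_lt_trans (enormD _ _) _; rewrite enormN.
  by have := OM _ Ox; have := ler_norm M; lra.
by apply: le_trans (lebesgue_dU _ _) _; rewrite F0 adde0.
Qed.

Let V_ge_v e : 0 < e -> v e <= V e.
Proof.
move=> e0; rewrite V_renewal lerDr sumr_ge0// => i _.
by rewrite mulr_ge0 ?exprn_ge0 ?(ltW (r_gt0 i))// V_ge0// divr_gt0.
Qed.

(** ** The dimension solves the Moran equation *)
(** For the solution [s] of the Moran equation, the renewal relations bound
    [s]-weighted volumes on one period and hence near [0]: the volume of the
    parallel sets from above, and that of the tubes of the tiling from below. *)

Let renewal_sum (s e : R) (f : R -> R) : 0 < e ->
  \sum_i r i `^ s * weighted (d%:R - s) f (e / r i) =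
  e `^ (- (d%:R - s)) * \sum_i r i ^+ d * f (e / r i).
Proof. by move=> e0; rewrite mulr_sumr; apply: eq_bigr => i _; rewrite weighted_dil. Qed.

Let volF_bounded s : s < d%:R -> \sum_i r i `^ s = 1 ->
  exists B, forall e, 0 < e <= 1 -> weighted (d%:R - s) volF e <= B.
Proof.
move=> sd sum1; have p_gt0 i : 0 < r i `^ s by rewrite powR_gt0.
have [e1 e11 maxp] := renewal_maximum_principle r_itv p_gt0 sum1 (@ltr01 R).
exists (volF e1) => e /andP[e0 e_1]; apply: (maxp (weighted (d%:R - s) volF)).
- by move=> x /andP[x0 _]; rewrite renewal_sum// ler_wpM2l ?powR_ge0.
- move=> x /andP[x1 xe]; have x0 := lt_trans ltr01 x1.
  rewrite -[leRHS]mul1r; apply: ler_pM; rewrite ?powR_ge0 ?volF_ge0 ?volF_homo//.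
  rewrite powRN invf_le1 ?powR_gt0//.
  rewrite -[leLHS](powRr0 x).
  by apply: ler_powR; [exact: ltW|rewrite subr_ge0 ltW].
- by rewrite e0 (le_trans e_1)// ltW.
Qed.

Let V_bounded_below s : s < d%:R -> \sum_i r i `^ s = 1 ->
  exists2 A, 0 < A & forall e, 0 < e <= g -> A <= weighted (d%:R - s) V e.
Proof.
move=> sd sum1; have p_gt0 i : 0 < r i `^ s by rewrite powR_gt0.
have [e1 ge1 maxp] := renewal_maximum_principle r_itv p_gt0 sum1 g_gt0.
have e10 := lt_trans g_gt0 ge1.
exists (e1 `^ (- (d%:R - s)) * v g) => [|e /andP[e0 eg]].
  by rewrite mulr_gt0// powR_gt0.
rewrite -lerN2; apply: (maxp (fun e => - weighted (d%:R - s) V e)) => [x /andP[x0 _]|x /andP[gx xe]|].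
- have -> : \sum_i r i `^ s * - weighted (d%:R - s) V (x / r i) =
      - (x `^ (- (d%:R - s)) * \sum_i r i ^+ d * V (x / r i)).
    by rewrite -renewal_sum// -sumrN; apply: eq_bigr => i _; rewrite mulrN.
  by rewrite lerN2 [leRHS]/weighted [V x]V_renewal ler_wpM2l ?powR_ge0// lerDl v_ge0.
- have x0 := lt_trans g_gt0 gx.
  rewrite lerN2 /weighted; apply: ler_pM; rewrite ?powR_ge0 ?(ltW vg_gt0)//.
    rewrite !powRN lef_pV2 ?posrE ?powR_gt0//.
    by apply: ge0_ler_powR; rewrite ?nnegrE ?subr_ge0 ?(ltW sd) ?(ltW x0) ?(ltW e10).
  by apply: le_trans (V_ge_v x0); rewrite v_homo// ltW.
- by rewrite e0 (le_trans eg)// ltW.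
Qed.

Let V_le_volF e : 0 < e -> V e <= volF e.
Proof. by move=> e0; rewrite volume_split// lerDl out_ge0. Qed.

(** The two bounds make [lam (parallel_set F e)] of exact order [e `^ (d - s)]. *)
Let moran : \sum_i r i `^ D = 1.
Proof.
have slt1 := sum_ratios_lt1 Phi_sim F_attractor O_feasible single_generator G_open K_bounded ball_pos.
have [s sd sum1] := moran_exponent N_ge2 r_itv slt1.
suff -> : D = s by [].
have [B HB] := volF_bounded sd sum1; have [A A0 HA] := V_bounded_below sd sum1.
have H : \forall e \near 0^'+, A * e `^ (d%:R - s) <= volF e <= B * e `^ (d%:R - s).
  near=> e.
  have e0 : 0 < e by near: e; exact: nbhs_right_gt.
  have p0 : 0 < e `^ (d%:R - s) by rewrite powR_gt0.
  have E : volF e = weighted (d%:R - s) volF e * e `^ (d%:R - s).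
    by rewrite /weighted powRN mulrAC mulVf ?mul1r// gt_eqF.
  rewrite E !ler_pM2r//; apply/andP; split; last first.
    by apply: HB; rewrite e0; near: e; exact: nbhs_right_le.
  apply: le_trans (HA e _) _; last by apply: ler_weighted; exact: V_le_volF.
  by rewrite e0; near: e; exact: nbhs_right_le.
have := ln_power_bounds A0 H => cv.
have cv' : (fun e => d%:R - ln (volF e) / ln e) @ 0^'+ --> d%:R - (d%:R - s).
  by apply: cvgB => //; exact: cvg_cst.
by rewrite (cvg_unique (@norm_hausdorff _ _) F_dim cv'); ring.
Unshelve. all: by end_near. Qed.

Let p i := r i `^ D.
Let p_gt0 i : 0 < p i. Proof. exact: powR_gt0. Qed.

Let phi_renewal e : 0 < e ->
  weighted c V e = \sum_i p i * weighted c V (e / r i) + weighted c v e.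
Proof. by move=> e0; rewrite /p renewal_sum// -mulrDr -V_renewal. Qed.

Let phiF_bounded : exists B, forall e, 0 < e <= 1 -> weighted c volF e <= B.
Proof. by apply: volF_bounded moran; have /andP[] := D_range. Qed.

Let phi_bounded : exists B, forall e, 0 < e <= 1 -> weighted c V e <= B.
Proof.
have [B HB] := phiF_bounded; exists B => e /[dup] e1 /andP[e0 _].
by apply: le_trans (HB e e1); apply: ler_weighted; exact: V_le_volF.
Qed.

Let zeta_bounded : exists B, forall e, 0 < e <= 1 -> weighted c v e <= B.
Proof.
have [B HB] := phi_bounded; exists B => e /[dup] e1 /andP[e0 _].
by apply: le_trans (HB e e1); apply: ler_weighted; exact: V_ge_v.
Qed.

Local Notation Z := (monophase_constant D g kappa).
Local Notation m := (mean_log p r).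

Let zeta_tail : (fun e => fine (logint (weighted c v) `]e, +oo[)) @ 0^'+ --> Z.
Proof.
have [B HB] := zeta_bounded.
exact: (zeta_tail_cvg D_range g_gt0 v_ge0 v_homo v_poly v_cst vg_gt0 HB).
Qed.

Let Z_gt0 : 0 < Z.
Proof.
have [B HB] := zeta_bounded.
exact: (monophase_constant_gt0 D_range g_gt0 v_ge0 v_homo v_poly v_cst vg_gt0 HB).
Qed.

Let mT_gt0 : 0 < Z / m.
Proof. by rewrite divr_gt0//; exact: (mean_log_gt0 r_itv p_gt0 moran). Qed.

Let out_cvg : weighted c out @ 0^'+ --> mout.
Proof. by apply/(has_contentE _ _ _ (fun e _ => outE e)); exact: K_outer. Qed.

Let weighted_split e : 0 < e -> weighted c volF e = weighted c V e + weighted c out e.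
Proof. by move=> e0; rewrite /weighted volume_split// mulrDr. Qed.

Let F_content m' : has_minkowski_content D F m'%:E <-> weighted c volF @ 0^'+ --> m'.
Proof. by apply: has_contentE => e _; exact: volFE. Qed.

Let T_volumeE e : inner_tube_volume (tiling_union Phi O) e = (V e)%:E.
Proof.
rewrite -VE.
exact: (inner_tube_tiling Phi_sim F_attractor O_feasible bdO_sub_F single_generator K_bounded).
Qed.

Let F_cvg_of_T l : weighted c V @ 0^'+ --> l -> weighted c volF @ 0^'+ --> l + mout.
Proof.
move=> cv; apply: (cvg_trans _ (cvgD cv out_cvg)); apply: near_eq_cvg; near=> e => /=.
by rewrite weighted_split//; near: e; exact: nbhs_right_gt.
Unshelve. all: by end_near. Qed.

Lemma nonlattice_contents : ~ lattice r ->
  exists mF mT : R, [/\ 0 < mF, 0 < mT, has_minkowski_content D F mF%:E,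
    has_tiling_content D (tiling_union Phi O) mT%:E & mF = mT + mout].
Proof.
move=> nl; have cv : weighted c V @ 0^'+ --> Z / m.
  have [B HB] := zeta_bounded.
  apply: (renewal_nonlattice_limit r_itv p_gt0 moran c_gt0 V_ge0 V_homo V_le v_ge0 v_homo
    phi_renewal zeta_tail phi_bounded).
    exact: (zeta_cvg0 D_range g_gt0 v_ge0 v_poly HB).
  move=> [h [k [h0 hk]]]; apply: nl; exists (expR (- h)), k; split.
    by rewrite expR_gt0 expR_lt1 oppr_lt0.
  move=> i; have [ki rk] := hk i; split => //.
  by rewrite -expRM_natl mulrN -rk opprK lnK// posrE.
exists (Z / m + mout), (Z / m); split => //.
- by have := mT_gt0; have := mout_ge0; lra.
- by apply/F_content; exact: F_cvg_of_T.
- by apply/(has_contentE _ _ _ (fun e _ => T_volumeE e)).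
Qed.

Lemma nonlattice_measurable : ~ lattice r -> minkowski_measurable F.
Proof.
move=> /nonlattice_contents[mF [_ [mF0 _ FmF _ _]]]; exists D, mF; split => //.
have /andP[D1 D2] := D_range; rewrite (ltW D2) andbT.
apply: le_trans (ltW D1); rewrite -natr1; have := ler0n R n; lra.
Qed.

(** ** The lattice case *)
Section LatticeCase.
Variables (rho : R) (k : 'I_N -> nat).
Hypothesis r_lattice : lattice_with r rho k.

(** The exterior part converges, so that a content of [F] would give a limit of the
    weighted tube volume of the tiling. *)
Let no_limit (l : R) : ~ (weighted c volF @ 0^'+ --> l).
Proof.
move=> cv; have [B HB] := zeta_bounded; have [E VE'] := V_cst.
have [rho01 rk] := r_lattice.
have lamO0 : 0 < lamO.
  by apply: lt_le_trans vg_gt0 _; apply: le_trans (V_ge_v g_gt0) _; exact: V_le.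
apply: (@lattice_no_limit _ _ D g lamO B kappa V v D_range g_gt0 v_ge0
  v_poly v_cst vg_gt0 HB N p k rho rho01 _ p_gt0 moran E VE' lamO0 _ (l - mout)).
- by move=> i; have [] := rk i.
- by move=> e e0; rewrite phi_renewal//; congr (_ + _); apply: eq_bigr => i _; have [_ ->] := rk i.
apply: (cvg_trans _ (cvgB cv out_cvg)); apply: near_eq_cvg; near=> e => /=.
transitivity (weighted c volF e - weighted c out e) => //.
by rewrite weighted_split ?addrK//; near: e; exact: nbhs_right_gt.
Unshelve. all: by end_near. Qed.

Lemma lattice_no_content : ~ exists m' : \bar R, has_minkowski_content D F m'.
Proof.
move=> [m' Fm']; have [B HB] := phiF_bounded.
have [l ml] : exists l, m' = l%:E.
  apply: (has_content_bounded (fun e _ => volFE e) _ Fm'); near=> e.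
  have e0 : 0 < e by near: e; exact: nbhs_right_gt.
  rewrite [X in X && _]mulr_ge0 ?powR_ge0 ?volF_ge0//=; apply: HB; rewrite e0.
  by near: e; exact: nbhs_right_le.
by apply: (@no_limit l); apply/F_content; rewrite -ml.
Unshelve. all: by end_near. Qed.

(** In dimensions above [D] the content is zero; a finite content in a dimension
    below [D] would make the [D]-dimensional one zero. *)
Lemma lattice_not_measurable : ~ minkowski_measurable F.
Proof.
move=> [alpha [m' [_ m'0 Fm']]].
have {}Fm' : weighted (d%:R - alpha) volF @ 0^'+ --> m'.
  by apply/(has_contentE _ _ _ (fun e _ => volFE e)).
have cvpow q : 0 < q -> (fun e => e `^ q) @ 0^'+ --> (0 : R) by move=> q0; exact: powR_cvg0.
have [aD|Da|aD] := ltgtP alpha D; last first.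
- by apply: (@no_limit m'); rewrite -aD.
- have [B HB] := phiF_bounded.
  suff cv : weighted (d%:R - alpha) volF @ 0^'+ --> (0 : R).
    by move: m'0; rewrite (cvg_unique (@norm_hausdorff _ _) Fm' cv) ltxx.
  have aD : 0 < alpha - D by rewrite subr_gt0.
  apply: (@squeeze_cvgr _ _ _ _ (fun=> 0) (fun e => e `^ (alpha - D) * B)); last 2 first.
  + exact: cvg_cst.
  + by rewrite -[X in _ --> X](mul0r B); apply: cvgMl; exact: cvpow.
  near=> e.
  have e0 : 0 < e by near: e; exact: nbhs_right_gt.
  rewrite (weighted_shift _ c)// (_ : c - (d%:R - alpha) = alpha - D); last by ring.
  rewrite mulr_ge0 ?powR_ge0 ?mulr_ge0 ?powR_ge0 ?volF_ge0//= ler_wpM2l ?powR_ge0//.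
  by apply: HB; rewrite e0; near: e; exact: nbhs_right_le.
- apply: (@no_limit (0 * m')).
  have Da : 0 < D - alpha by rewrite subr_gt0.
  apply: (cvg_trans _ (cvgM (cvpow _ Da) Fm')); apply: near_eq_cvg; near=> e => /=.
  rewrite [RHS](weighted_shift _ (d%:R - alpha)); last by near: e; exact: nbhs_right_gt.
  by congr (_ `^ _ * _); ring.
Unshelve. all: by end_near. Qed.

End LatticeCase.

(** ** Average contents *)

Let pos_phi : posmeas (weighted c V). Proof. exact: posmeas_weighted. Qed.
Let pos_out : posmeas (weighted c out). Proof. exact: posmeas_weighted. Qed.

Let tail_split e : 0 < e <= 1 ->
  logint (weighted c V) `]e, 1] = (tail_integral c V e - tail_integral c V 1)%:E.
Proof.
move=> /andP[e0 e1].
have fin s : 0 < s -> logint (weighted c V) `]s, +oo[ = (tail_integral c V s)%:E.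
  by move=> s0; rewrite fineK// (logint_weighted_fin c_gt0 V_ge0 V_homo V_le).
have := logint_split (ltW e0) e1 pos_phi; rewrite !fin// => H.
by rewrite EFinB H addeK.
Qed.

Let phi_average :
  (fun e => fine (logint (weighted c V) `]e, 1]) / - ln e) @ 0^'+ --> Z / m.
Proof.
have cv1 := tail_integral_asymptotics r_itv p_gt0 moran c_gt0 V_ge0 V_homo V_le v_ge0 v_homo
  phi_renewal zeta_tail.
have cv2 : (fun e => tail_integral c V 1 * (- ln e)^-1) @ 0^'+ --> tail_integral c V 1 * 0.
  by apply: cvgMr; exact: inv_ln_cvg0.
rewrite mulr0 in cv2; rewrite -[X in _ --> X]subr0.
apply: (cvg_trans _ (cvgB cv1 cv2)); apply: near_eq_cvg; near=> e => /=.
rewrite tail_split; first by rewrite /= mulrBl.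
by apply/andP; split; near: e; [exact: nbhs_right_gt|exact: nbhs_right_le].
Unshelve. all: by end_near. Qed.

Lemma tiling_average_content :
  has_average_tiling_content D (tiling_union Phi O) (Z / m)%:E.
Proof.
apply: (has_average_contentE (fun e _ => T_volumeE e)).
- exact: posmeas_homo.
- by move=> e; exact: logint_weighted_itv_fin.
- exact: phi_average.
Qed.

Lemma attractor_average_content : has_average_minkowski_content D F (Z / m + mout)%:E.
Proof.
apply: (has_average_contentE (fun e _ => volFE e)).
- exact: posmeas_homo.
- by move=> e; exact: logint_weighted_itv_fin.
have out_average := cesaro_log pos_out (fun e => logint_weighted_itv_fin c_gt0 out_ge0 out_homo) out_cvg.
apply: (cvg_trans _ (cvgD phi_average out_average)); apply: near_eq_cvg; near=> e => /=.
have e0 : 0 < e by near: e; exact: nbhs_right_gt.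
rewrite -[LHS]mulrDl -fineD ?logint_weighted_itv_fin//; congr (fine _ / _).
rewrite -logintD//; last exact/itv_pos/ltW.
apply: eq_integral => s; rewrite inE/= in_itv/= => /andP[es _].
by rewrite weighted_split// (lt_trans e0).
Unshelve. all: by end_near. Qed.

Lemma lattice_mean (rho : R) (k : 'I_N -> nat) : lattice_with r rho k ->
  Z / m = Gamma_coef D G kappa /
    (c * \sum_(i < N) rho `^ ((k i)%:R * D) * (k i)%:R * ln (rho^-1)).
Proof.
move=> [/andP[rho0 _] rk]; rewrite /monophase_constant invfM mulrA; congr (_ / _ / _).
apply: eq_bigr => i _; have [_ ri] := rk i; rewrite /p ri -powR_mulrn ?(ltW rho0)//.
rewrite -powRrM ln_powR lnV ?posrE//; ring.
Qed.

Lemma average_content_gt0 : 0 < Z / m + mout.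
Proof. by have := mT_gt0; have := mout_ge0; lra. Qed.

End Assembly.

Lemma osc_dim_gt0 (R : realType) (d N : nat)
    (Phi : 'I_N -> 'rV[R]_d -> 'rV[R]_d) (O : set 'rV[R]_d) :
  (2 <= N)%N -> feasible Phi O -> (0 < d)%N.
Proof.
move=> N2; case: d Phi O => // Phi O [_ [x Ox] _ disj].
pose i : 'I_N := Ordinal (ltnW N2); pose j : 'I_N := Ordinal N2.
suff : set0 (Phi i x) by [].
rewrite -(disj i j isT); split; exists x => //.
by rewrite (thinmx0 (Phi i x)) thinmx0.
Qed.

Theorem theorem5p4 (R : realType) (d N : nat)
    (Phi : 'I_N -> 'rV[R]_d -> 'rV[R]_d) (r : 'I_N -> R)
    (F : set 'rV[R]_d) (D : R) (O G : set 'rV[R]_d)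
    (kappa : 'I_d.+1 -> R) (mout : R)
    (N_ge2 : (2 <= N)%N)
    (Phi_sim : contractive_similarities Phi r)
    (F_attractor : attractor Phi F)
    (Phi_osc : open_set_condition Phi)
    (F_dim : has_minkowski_dimension F D)
    (D_range : d%:R - 1 < D < d%:R)
    (O_feasible : feasible Phi O)
    (bdO_sub_F : boundary O `<=` F)
    (single_generator : generators Phi O = [set G])
    (G_monophase : monophase G kappa)
    (mout_ge0 : 0 <= mout)
    (K_outer : has_outer_minkowski_content D (closure O) mout%:E) :
  [/\ minkowski_measurable F <-> ~ lattice r,
      ~ lattice r ->
        exists mF mT : R,
          [/\ 0 < mF, 0 < mT,
              has_minkowski_content D F mF%:E,
              has_tiling_content D (tiling_union Phi O) mT%:E &
              mF = mT + mout]
    & forall (rho : R) (k : 'I_N -> nat), lattice_with r rho k ->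
        let mT := Gamma_coef D G kappa /
          ((d%:R - D) *
           \sum_(n < N) rho `^ ((k n)%:R * D) * (k n)%:R * ln (rho^-1)) in
        [/\ ~ (exists m : \bar R, has_minkowski_content D F m),
            has_average_tiling_content D (tiling_union Phi O) mT%:E,
            has_average_minkowski_content D F (mT + mout)%:E &
            0 < mT + mout]].
Proof.
have d0 := osc_dim_gt0 N_ge2 O_feasible.
case: d d0 Phi F D O G kappa Phi_sim F_attractor Phi_osc F_dim D_range O_feasible
  bdO_sub_F single_generator G_monophase K_outer => // n _ Phi F D O G kappa Phi_sim
  F_attractor _ F_dim D_range O_feasible bdO_sub_F single_generator G_monophase K_outer.
split.
- split=> [mF [rho [k rk]]|].
    exact: (lattice_not_measurable N_ge2 Phi_sim F_attractor F_dim D_range O_feasible bdO_sub_F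
      single_generator G_monophase K_outer rk).
  exact: (nonlattice_measurable N_ge2 Phi_sim F_attractor F_dim D_range O_feasible bdO_sub_F
    single_generator G_monophase mout_ge0 K_outer).
- exact: (nonlattice_contents N_ge2 Phi_sim F_attractor F_dim D_range O_feasible bdO_sub_F
    single_generator G_monophase mout_ge0 K_outer).
move=> rho k rk mT; rewrite {}/mT -(lattice_mean D G kappa rk); split.
- exact: (lattice_no_content N_ge2 Phi_sim F_attractor F_dim D_range O_feasible bdO_sub_F
    single_generator G_monophase K_outer rk).
- exact: (tiling_average_content N_ge2 Phi_sim F_attractor F_dim D_range O_feasible bdO_sub_F
    single_generator G_monophase K_outer).
- exact: (attractor_average_content N_ge2 Phi_sim F_attractor F_dim D_range O_feasible bdO_sub_F
    single_generator G_monophase K_outer).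
- exact: (average_content_gt0 N_ge2 Phi_sim F_attractor F_dim D_range O_feasible bdO_sub_F
    single_generator G_monophase mout_ge0 K_outer).
Qed.
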